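(* Under the standing assumptions in the context, let $d_0=d_1=:d$ and $c(x,\xi)=\|x-\xi\|$, and let $\bar u$ be an arbitrary local minimizer of (P) with adjoint state $p$. Suppose that $p$ is continuously differentiable in $\operatorname{int}(\omega_1)$ with Lipschitz continuous gradient with Lipschitz constant $L>0$, and that $u^0\ll\lambda^d$ with essentially bounded density $U^0=\frac{du^0}{d\lambda^d}\in L^\infty(\omega_0)$. Then the restriction of $\bar u$ to $\operatorname{int}(\omega_1)$ is absolutely continuous with respect to the $(d-1)$-dimensional Hausdorff measure $\mathcal H^{d-1}$.
   Context: For a compact set $X\subset\mathbb R^n$, $\mathfrak M(X)=C(X)^*$ denotes the finite signed Borel measures on $X$ with the total variation norm. $r'$ denotes the conjugate exponent of $r$; $\lambda^d$ is the Lebesgue measure. Absolute continuity with respect to $\mathcal H^{d-1}$ means: $\bar u(A)=0$ for every Borel set $A\subset\operatorname{int}(\omega_1)$ with $\mathcal H^{d-1}(A)=0$. Standing assumptions. $d_0\in\mathbb N$, $d_1\in\{2,3\}$; $\Omega\subset\mathbb R^{d_1}$ is a bounded Lipschitz domain; $\omega_0\subset\mathbb R^{d_0}$ and $\omega_1\subset\overline\Omega$ are nonempty compact sets; $u^0\in\mathfrak M(\omega_0)$, $u^0\ge 0$; $c\in C(\omega_0\times\omega_1)$; $\alpha>0$. $p_\Omega>d_1$ is an exponent (provided by Theorem 0.5(a) of Jerison–Kenig 1995) such that for every $p\in(p_\Omega',p_\Omega)$ and every $f\in W^{-1,p}(\Omega)$ the equation $-\Delta y=f$ (weak Laplacian,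 $-\langle\Delta y,v\rangle=\int_\Omega\nabla y\cdot\nabla v\,d\lambda^{d_1}$) has a unique solution $y\in W^{1,p}_0(\Omega)$. The exponent $q$ is fixed with $q'\in(d_1,p_\Omega)$ and, if $d_1=3$, additionally $q'<6$. $J:W^{1,q}_0(\Omega)\to\mathbb R$ is continuous and Gâteaux differentiable. $E:W^{1,q'}_0(\Omega)\to C(\omega_1)$ is the Sobolev embedding into $C_0(\Omega)\subset C(\overline\Omega)$ followed by restriction to $\omega_1$; $\langle E^*u,v\rangle=\int_{\omega_1}v\,du$. $S:=(-\Delta)^{-1}E^*:\mathfrak M(\omega_1)\to W^{1,q}_0(\Omega)$. $\mathrm D^c_{u^0}(u):=\inf\{\int c\,d\pi:\pi\in\mathfrak M(\omega_0\times\omega_1),\ \pi\ge0,\ (P_0)_\#\pi=u^0,\ (P_1)_\#\pi=u\}$ with coordinate projections $P_0,P_1$ and $\inf\emptyset=\infty$. Problem (P): minimize $f(u)=J(Su)+\alpha\,\mathrm D^c_{u^0}(u)$ over $u\in\mathfrak M(\omega_1)$. $\bar u$ is a local minimizer if $f(\bar u)<\infty$ and $f(\bar u)\le f(u)$ for all $u$ in some norm neighborhood of $\bar u$. The adjoint state associated with $\bar u$ is the unique $p\in W^{1,q'}_0(\Omega)\hookrightarrow C(\overline\Omega)$ with $-\Delta p=J'(S\bar u)$ in $W^{-1,q'}(\Omega)$. *)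

(* Defs.v *)
From HB Require Import structures.
From mathcomp Require Import all_boot all_order all_algebra.
From mathcomp Require Import all_classical all_reals all_analysis.
From mathcomp Require Import measurable_realfun.
Set Implicit Arguments.
Unset Strict Implicit.
Unset Printing Implicit Defensive.
Import Order.TTheory GRing.Theory Num.Theory.
Import numFieldNormedType.Exports.
Local Open Scope classical_set_scope.
Local Open Scope ring_scope.

Section borel.
Context (R : realType) (n : nat).
HB.instance Definition _ := @isMeasurable.Build (sigma_display (@open 'rV[R]_n))
  'rV[R]_n <<s open >> (@sigma_algebra0 _ setT _) (@sigma_algebraC _ _)
  (@sigma_algebra_bigcup _ setT _).
End borel.

Section lebesgue_step.
Context (R : realType) (n : nat).
Implicit Types (x : R) (v : 'rV[R]_n).

Lemma open_rV_measurable m (A : set 'rV[R]_m) : open A -> measurable A.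
Proof. exact: sub_sigma_algebra. Qed.

Lemma open_prod_measurable (W : set (R * 'rV[R]_n)) : open W -> measurable W.
Proof.
move=> oW.
pose B (i : rat * 'rV[rat]_n * nat) : set (R * 'rV[R]_n) :=
  ball (ratr i.1.1 : R) i.2.+1%:R^-1 `*`
  ball (map_mx ratr i.1.2 : 'rV[R]_n) i.2.+1%:R^-1.
have -> : W = \bigcup_i (if `[< B i `<=` W >] then B i else set0).
  apply/seteqP; split=> [[x v] Wxv|p [i _]]; last by case: ifPn => // /asboolP; apply.
  have /nbhs_ballP[e /= e0 eW] := open_nbhs_nbhs (conj oW Wxv).
  have [k _ /(_ k (leqnn k))/= ke] :=
    near_infty_natSinv_lt (PosNum (divr_gt0 e0 (ltr0n _ 2))).
  pose d : R := k.+1%:R^-1.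
  have d0 : 0 < d by rewrite invr_gt0.
  have rat_near (r : R) : {s : rat | ball (ratr s : R) d r}.
    apply: cid; have [//|s] := @rat_in_itvoo _ r (r + d); first by rewrite ltrDl.
    rewrite in_itv/= => /andP[rs sd]; exists s.
    by rewrite /ball/= ger0_norm ?subr_ge0 1?ltW// ltrBlDl.
  pose q := projT1 (rat_near x); pose w : 'rV_n := \row_j projT1 (rat_near (v ord0 j)).
  have bw : ball (map_mx ratr w : 'rV[R]_n) d v.
    split=> // i j; rewrite !mxE (ord1 i); exact: (projT2 (rat_near (v ord0 j))).
  have bq : ball (ratr q : R) d x by exact: projT2 (rat_near x).
  exists (q, w, k) => //; rewrite ifT; first by split.
  apply/asboolP => -[y z] [/= yb zb]; apply: eW; split => /=.
    by apply: (le_ball (ltW (_ : d + d < e))); [rewrite (splitr e) ltrD|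
       exact: ball_triangle (ball_sym bq) yb].
  by apply: (le_ball (ltW (_ : d + d < e))); [rewrite (splitr e) ltrD|
     exact: ball_triangle (ball_sym bw) zb].
apply: countable_bigcupT_measurable => // i; case: ifPn => // _.
apply: measurableX; first by apply: open_measurable; exact: ball_open.
by apply: open_rV_measurable; exact: ball_open.
Qed.

Definition rV_cons (p : R * 'rV[R]_n) : 'rV[R]_n.+1 :=
  \row_i oapp (p.2 ord0) p.1 (unlift ord0 i).

Definition rV_uncons (v : 'rV[R]_n.+1) : R * 'rV[R]_n :=
  (v ord0 ord0, \row_j v ord0 (lift ord0 j)).

Lemma rV_consK : cancel rV_cons rV_uncons.
Proof.
move=> [x v]; rewrite /rV_uncons mxE unlift_none; congr pair.
by apply/rowP => j; rewrite !mxE liftK.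
Qed.

Lemma rV_unconsK : cancel rV_uncons rV_cons.
Proof.
by move=> v; apply/rowP => i; rewrite mxE; case: unliftP => [j|] -> //=; rewrite mxE.
Qed.

Lemma continuous_rV_cons : continuous rV_cons.
Proof.
move=> p; apply/cvg_ballP => e e0; apply: filterS (nbhsx_ballx p e e0) => z [b1 [_ b2]].
split=> // i j; rewrite !mxE.
by case: unliftP => [k|] _ //=; exact: b2.
Qed.

Lemma measurable_rV_cons : measurable_fun setT rV_cons.
Proof.
apply: (@measurability _ _ _ _ _ _ (@open 'rV[R]_n.+1)) => //.
move=> _ [U oU <-]; rewrite setTI; apply: open_prod_measurable.
by move/continuousP: continuous_rV_cons; apply.
Qed.

Lemma measurable_rV_uncons : measurable_fun setT rV_uncons.
Proof.
apply: measurable_fun_pair.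
  apply: (measurability _ (RGenOpens.measurableE R)).
  move=> _ [_ [a [b ->]] <-]; rewrite setTI; apply: open_rV_measurable.
  have /continuousP := @coord_continuous R 1 n.+1 ord0 ord0; apply.
  exact: interval_open.
apply: (@measurability _ _ _ _ _ _ (@open 'rV[R]_n)) => //.
move=> _ [U oU <-]; rewrite setTI; apply: open_rV_measurable.
have c : continuous (fun v : 'rV[R]_n.+1 => \row_j v ord0 (lift ord0 j)).
  move=> p; apply/(@cvg_ballP _ _ _ _ (nbhs_filter p)) => e e0.
  apply: (@filterS _ (nbhs p) _ _ _ _ (nbhsx_ballx p e e0)) => z [_ b].
  by split=> // i j; rewrite !mxE; exact: b.
by move/continuousP: c; apply.
Qed.

Variable mu : {sigma_finite_measure set 'rV[R]_n -> \bar R}.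

Definition lebesgue_rV_step : set 'rV[R]_n.+1 -> \bar R :=
  pushforward (@lebesgue_measure R \x mu)%E rV_cons.

Let lebesgue_rV_step0 : lebesgue_rV_step set0 = 0%E.
Proof. by rewrite /lebesgue_rV_step /pushforward preimage_set0 measure0. Qed.

Let lebesgue_rV_step_ge0 A : (0 <= lebesgue_rV_step A)%E.
Proof. exact: (measure_ge0 (@lebesgue_measure R \x mu)%E). Qed.

Let mpre (A : set 'rV[R]_n.+1) : measurable A -> measurable (rV_cons @^-1` A).
Proof. by move=> mA; rewrite -[X in measurable X]setTI; exact: measurable_rV_cons. Qed.

Let lebesgue_rV_step_sigma_additive : semi_sigma_additive lebesgue_rV_step.
Proof.
move=> F mF tF mUF; rewrite /lebesgue_rV_step /pushforward preimage_bigcup.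
apply: measure_semi_sigma_additive.
- by move=> i; exact: mpre.
- apply/trivIsetP => /= i j _ _ ij; rewrite -preimage_setI.
  by move/trivIsetP : tF => /(_ _ _ _ _ ij) ->//; rewrite preimage_set0.
- by rewrite -preimage_bigcup; exact: mpre.
Qed.

HB.instance Definition _ := isMeasure.Build _ _ _ lebesgue_rV_step
  lebesgue_rV_step0 lebesgue_rV_step_ge0 lebesgue_rV_step_sigma_additive.

Let lebesgue_rV_step_sigma_finite : sigma_finite setT lebesgue_rV_step.
Proof.
have /sigma_finiteP[F [TF ndF Foo]] := sigma_finiteT (@lebesgue_measure R).
have /sigma_finiteP[G [TG ndG Goo]] := sigma_finiteT mu.
have preK k : rV_cons @^-1` (rV_uncons @^-1` (F k `*` G k)) = F k `*` G k.
  by apply/funext => p; rewrite /preimage /mkset rV_consK.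
exists (fun k => rV_uncons @^-1` (F k `*` G k)) => [|k].
  apply/seteqP; split=> // v _; case uv : (rV_uncons v) => [x w].
  have [i _ Fx] : (\bigcup_k F k) x by rewrite -TF.
  have [j _ Gw] : (\bigcup_k G k) w by rewrite -TG.
  exists (maxn i j) => //; rewrite /preimage /mkset uv; split => /=.
  - by move: x Fx {uv}; exact/subsetPset/ndF/leq_maxl.
  - by move: w Gw {uv}; exact/subsetPset/ndG/leq_maxr.
have [mF Fk] := Foo k; have [mG Gk] := Goo k.
have mFG : measurable (F k `*` G k) by exact: measurableX.
split; last first.
  rewrite /lebesgue_rV_step /pushforward preK product_measure1E//.
  by rewrite lte_mul_pinfty// ge0_fin_numE.
by rewrite -[X in measurable X]setTI; exact: measurable_rV_uncons.
Qed.

HB.instance Definition _ := Measure_isSigmaFinite.Build _ _ _ lebesgue_rV_step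
  lebesgue_rV_step_sigma_finite.
End lebesgue_step.


Fixpoint lebesgue_rV (R : realType) (n : nat) :
    {sigma_finite_measure set 'rV[R]_n -> \bar R} :=
  match n with
  | 0%N => dirac (0 : 'rV[R]_0)
  | m.+1 => lebesgue_rV_step (lebesgue_rV R m)
  end.

Section euclidean.
Context (R : realType) (n : nat).
Implicit Types (x y : 'rV[R]_n) (A : set 'rV[R]_n).

(* The library norm on row vectors is the max norm; it only provides the
   topology here. *)
Definition edot x y : R := \sum_i x ord0 i * y ord0 i.

Definition enorm x : R := Num.sqrt (edot x x).

Definition ediam A : \bar R :=
  ereal_sup [set e | e = 0%E \/
    exists x y, [/\ A x, A y & e = (enorm (x - y))%:E]].

(* Hausdorff measure of dimension s > 0, without normalising constant (which
   does not affect null sets). *)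
Definition hausdorff_pre (s : R) (delta : R) A : \bar R :=
  ereal_inf [set e | exists C : nat -> set 'rV[R]_n,
    [/\ A `<=` \bigcup_k C k, forall k, (ediam (C k) <= delta%:E)%E
      & e = (\sum_(0 <= k <oo) ediam (C k) `^ s)%E]].

Definition hausdorff (s : R) A : \bar R :=
  ereal_sup [set hausdorff_pre s delta A | delta in [set t : R | 0 < t]].

(* Around each boundary point x0, Omega is the strict epigraph, in the
   direction of the unit vector e, of a Lipschitz function of the component
   orthogonal to e. *)
Definition lipschitz_boundary A := forall x0, (closure A `\` A) x0 ->
  exists (e : 'rV[R]_n) (gamma : 'rV[R]_n -> R) (r k : R),
  [/\ enorm e = 1, 0 < r,
      forall x y, `|gamma x - gamma y| <= k * enorm (x - y)
    & forall x, enorm (x - x0) < r ->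
        A x <-> gamma (x - edot x e *: e) < edot x e].

Definition bounded_lipschitz_domain A :=
  [/\ open A, connected A, A !=set0, bounded_set A & lipschitz_boundary A].

Definition grad (f : 'rV[R]_n -> R) x : 'rV[R]_n :=
  \row_i 'D_(delta_mx ord0 i) f x.

End euclidean.

Definition conjugate (R : realType) (p : R) : R := p / (p - 1).

(* Elements of Sobolev spaces are represented by functions on R^n, of which only
   the values on Omega, up to null sets, matter.  Exponents are real and > 1. *)
Section sobolev.
Context (R : realType) (n : nat) (Omega : set 'rV[R]_n).
Local Notation V := 'rV[R]_n.
Local Notation lam := (lebesgue_rV R n).
Implicit Types (p : R) (y v h phi : V -> R) (F : (V -> R) -> R).

(* Test functions are C^1_c(Omega); C^oo_c(Omega) gives the same weak gradients
   and, for p < oo, the same closure in W^{1,p}. *)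
Definition test_function phi :=
  [/\ forall x, differentiable phi x, continuous (grad phi)
    & exists K : set V,
        [/\ compact K, K `<=` Omega & forall x, ~ K x -> phi x = 0]].

Definition locally_integrable_on h :=
  forall K : set V, compact K -> K `<=` Omega ->
    lam.-integrable K (EFin \o h).

Definition is_weak_gradient y (g : V -> V) :=
  [/\ locally_integrable_on y,
      forall i, locally_integrable_on (fun x => g x ord0 i)
    & forall phi, test_function phi -> forall i,
        (\int[lam]_(x in Omega) (y x * grad phi x ord0 i))%R =
        (- \int[lam]_(x in Omega) (g x ord0 i * phi x))%R].

(* Some weak gradient of y, when there is one: it is unique a.e. on Omega. *)
Definition wgrad y : V -> V := get [set g | is_weak_gradient y g].

Definition Lp_norm p h : \bar R := Lnorm lam p%:E (EFin \o (h \_ Omega)).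

Definition in_Lp p h := measurable_fun Omega h /\ (Lp_norm p h < +oo)%E.

Definition W1p p y := in_Lp p y /\
  exists2 g, is_weak_gradient y g & forall i, in_Lp p (fun x => g x ord0 i).

Definition W1p_norm p y : \bar R :=
  (Lp_norm p y + \sum_(i < n) Lp_norm p (fun x => wgrad y x ord0 i))%E.

Definition W1p0 p y := W1p p y /\
  exists2 phi : nat -> V -> R, forall k, test_function (phi k)
    & W1p_norm p (y \- phi k) @[k --> \oo] --> 0%E.

Definition W1p0_dual p F :=
  (forall (a : R) y v, W1p0 p y -> W1p0 p v ->
     F (fun x => a * y x + v x) = a * F y + F v) /\
  (exists C : R, forall y, W1p0 p y -> (`|F y|%:E <= C%:E * W1p_norm p y)%E).

(* W^{-1,p}(Omega), the dual of W^{1,p'}_0(Omega). *)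
Definition Wm1p p F := W1p0_dual (conjugate p) F.

(* - Delta y = F in W^{-1,p}(Omega), y in W^{1,p}_0(Omega). *)
Definition poisson_solution p F y := W1p0 p y /\
  forall v, W1p0 (conjugate p) v ->
    (\int[lam]_(x in Omega) edot (wgrad y x) (wgrad v x))%R = F v.

Definition poisson_well_posed p := forall F, Wm1p p F ->
  exists2 y, poisson_solution p F y
    & forall z, poisson_solution p F z -> {ae lam, forall x, Omega x -> z x = y x}.

(* Continuity for the seminorm on representatives; it entails that J does not
   distinguish functions equal a.e. on Omega. *)
Definition continuous_on_W1p0 p F := forall y, W1p0 p y ->
  forall e : R, 0 < e -> exists2 delta : R, 0 < delta & forall z, W1p0 p z ->
    (W1p_norm p (z \- y)%R < delta%:E)%E -> `|F z - F y| < e.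

Definition gateaux_derivative_on_W1p0 p F (dF : (V -> R) -> (V -> R) -> R) :=
  forall y, W1p0 p y -> W1p0_dual p (dF y) /\
    forall h, W1p0 p h ->
      t^-1 * (F (fun x => y x + t * h x) - F y) @[t --> 0^'] --> dF y h.

(* C_0(Omega), its elements being extended by 0 to R^n. *)
Definition C0 (w : V -> R) := continuous w /\ forall x, ~ Omega x -> w x = 0.

(* The Sobolev embedding into C_0(Omega): the representative lying in it. *)
Definition C0_representative v : V -> R :=
  get [set w | C0 w /\ {ae lam, forall x, Omega x -> w x = v x}].

End sobolev.

(* Elements of M(X), X a compact subset of R^n, are the charges on R^n
   concentrated on X. *)
Section measures.
Context (R : realType).

Definition concentrated_on d (T : measurableType d) (X : set T)
    (u : set T -> \bar R) :=
  forall A, measurable A -> A `&` X = set0 -> u A = 0%E.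

Section signed.
Context d (T : measurableType d).
Implicit Types (u v : {charge set T -> \bar R}).

Definition hahn_pos u : set T := projT1 (cid (Hahn_decomposition u)).

Definition hahn_neg u : set T :=
  projT1 (cid (projT2 (cid (Hahn_decomposition u)))).

Lemma hahnP u : hahn_decomposition u (hahn_pos u) (hahn_neg u).
Proof. exact: (projT2 (cid (projT2 (cid (Hahn_decomposition u))))). Qed.

Definition tv_norm u : \bar R := charge_variation (hahnP u) setT.

Definition tv_dist u v : \bar R := tv_norm (cadd u (copp v)).

Definition charge_integral u (X : set T) (f : T -> R) : R :=
  (\int[jordan_pos (hahnP u)]_(x in X) f x
   - \int[jordan_neg (hahnP u)]_(x in X) f x)%R.

Definition local_minimizer (X : set T) (f : {charge set T -> \bar R} -> \bar R) u :=
  [/\ concentrated_on X u, (f u < +oo)%E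
    & exists2 r : R, 0 < r & forall v, concentrated_on X v ->
        (tv_dist v u < r%:E)%E -> (f u <= f v)%E].

End signed.

Section transport.
Context (d0 d1 : nat) (omega0 : set 'rV[R]_d0) (omega1 : set 'rV[R]_d1).
Variable c : 'rV[R]_d0 -> 'rV[R]_d1 -> R.

Definition transport_plan (u0 : set 'rV[R]_d0 -> \bar R)
    (u : set 'rV[R]_d1 -> \bar R) (pi : set ('rV[R]_d0 * 'rV[R]_d1) -> \bar R) :=
  [/\ concentrated_on (omega0 `*` omega1) pi,
      forall A, measurable A -> pushforward pi fst A = u0 A
    & forall A, measurable A -> pushforward pi snd A = u A].

Definition transport_cost (u0 : set 'rV[R]_d0 -> \bar R)
    (u : set 'rV[R]_d1 -> \bar R) : \bar R :=
  ereal_inf [set e | exists2 pi :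
      {finite_measure set ('rV[R]_d0 * 'rV[R]_d1)%type -> \bar R},
    transport_plan u0 u pi
    & e = (\int[pi]_(z in omega0 `*` omega1) (c z.1 z.2)%:E)%E].

End transport.

Section control.
Context (d : nat) (Omega omega1 : set 'rV[R]_d).
Implicit Types (q : R) (u : {charge set 'rV[R]_d -> \bar R}).

Definition Estar u (v : 'rV[R]_d -> R) : R :=
  charge_integral u omega1 (C0_representative Omega v).

Definition solution_operator q u : 'rV[R]_d -> R :=
  get [set y | poisson_solution Omega q (Estar u) y].

Definition objective d0 (omega0 : set 'rV[R]_d0)
    (c : 'rV[R]_d0 -> 'rV[R]_d -> R) (u0 : set 'rV[R]_d0 -> \bar R)
    q (J : ('rV[R]_d -> R) -> R) (alpha : R) u : \bar R :=
  ((J (solution_operator q u))%:E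
   + alpha%:E * transport_cost omega0 omega1 c u0 u)%E.

(* p is the representative in C_0(Omega) of the adjoint state. *)
Definition adjoint_state q (dJ : ('rV[R]_d -> R) -> ('rV[R]_d -> R) -> R) u
    (p : 'rV[R]_d -> R) :=
  C0 Omega p /\
  poisson_solution Omega (conjugate q) (dJ (solution_operator q u)) p.

End control.
End measures.

(* Main.v *)
(* Testing the local minimality of ubar along segments towards the second
   marginal of an arbitrary plan pi' with first marginal u0 shows that a
   near-optimal plan of ubar nearly minimizes the integral of the phase
   p(xi) + alpha |x - xi| among all such pi'.  Hence mass only goes from x to
   points xi minimizing the phase over omega1: for K compact, ubar(K) vanishes
   as soon as u0 vanishes on the contact set of those x which have a minimizer
   in K.  If K lies in the interior of omega1, the first order condition at a
   minimizer xi <> x reads x = xi + s grad p(xi) with s = |x - xi| / alpha, so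
   the contact set is swept out by bounded segments based at K.  As grad p is
   Lipschitz, a cover of K by sets of diameters r_i yields a cover of the
   contact set of Lebesgue measure at most a constant times the sum of
   r_i^(d-1): the contact set of an H^(d-1)-null set K is Lebesgue null.

   That the state equation is solvable for measures on omega1, and that p
   represents the derivative of J along such segments, rests on the embedding
   of W^{1,q'}_0 into C_0, that is on Morrey's inequality. *)

Require Import Defs.
From HB Require Import structures.
From mathcomp Require Import all_boot all_order all_algebra.
From mathcomp Require Import all_classical all_reals all_analysis.
From mathcomp Require Import measurable_realfun.
From mathcomp Require Import ring lra.
From mathcomp Require finmap.
Set Implicit Arguments.
Unset Strict Implicit.
Unset Printing Implicit Defensive.
Import Order.TTheory GRing.Theory Num.Theory.
Import numFieldNormedType.Exports.
Local Open Scope classical_set_scope.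
Local Open Scope ring_scope.

(** * Lebesgue measure on row vectors *)

(** The infimum defining the transport cost is only approached, so the claim about where mass goes
    is proved quantitatively. Let [contact K delta] collect the points of [omega0] having in [K] a
    minimizer of the phase up to [delta]. A plan whose total phase is within epsilon of all
    competitors sends to [K], from outside this set, a mass of order epsilon / delta, by Markov's
    inequality. Epsilon tends to zero first, for fixed [delta]; then [delta] tends to zero, and the
    sets decrease to the exact contact set. They are compact when [K] is, which settles their
    measurability; this is why the argument treats compact [K] and reaches Borel sets by inner
    regularity. Competitors are graphs of maps, and the second marginal of a competitor is free: the
    comparison therefore decouples into a minimization for each x separately. Sobolev functions,
    weak gradients and states are representatives picked by choice operators. Much of the
    preparation shows that these choices are unique almost everywhere, so that linearity holds up to
    null sets and [J] cannot see the difference. *)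

Definition image_measure d d' (T1 : measurableType d) (T2 : measurableType d')
    (R : realFieldType) (m : {measure set T1 -> \bar R}) (f : T1 -> T2)
    (mf : measurable_fun setT f) : {measure set T2 -> \bar R} :=
  measure_function_pushforward__canonical__measure_function_Measure m mf.

(** Both sides are measures in [A], so uniqueness of Lebesgue measure reduces the claim to half-open
    intervals. *)
Lemma lebesgue_measure_affine (R : realType) (v t : R) (A : set R) :
  0 < t -> measurable A ->
  (t%:E * lebesgue_measure ((fun x : R => (v + t * x)%R) @^-1` A) = lebesgue_measure A)%E.
Proof.
move=> t0 mA.
have mf : measurable_fun setT ((fun x => v + t * x)
    : measurableTypeR R -> measurableTypeR R).
  by apply: measurable_funD => //; exact: measurable_funM.
pose nu : {measure set (measurableTypeR R) -> \bar R} :=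
  mscale (NngNum (ltW t0)) (image_measure (@lebesgue_measure R) mf).
rewrite -[LHS]/(nu A); apply/esym/lebesgue_measure_unique => {mA}// _ [[a b] _ <-].
rewrite /nu /= /mscale /= /pushforward.
have -> : (fun x : R => v + t * x) @^-1` `]a, b] = `](a - v) / t, (b - v) / t]%classic.
  apply/seteqP; split => x /=; rewrite !in_itv/=;
    by rewrite ltr_pdivrMr// ler_pdivlMr// ltrBlDl lerBrDl (mulrC x).
rewrite !lebesgue_measure_itv/= !lte_fin ltr_pM2r ?invr_gt0// ltrD2r.
case: ifPn => _; last by rewrite mule0.
by rewrite -!EFinB -EFinM; congr (_%:E); field; rewrite gt_eqF.
Qed.

Lemma ge0_integral_affine1 (R : realType) (v t : R) (f : R -> \bar R) :
  0 < t -> measurable_fun [set: R] f -> (forall x, 0 <= f x)%E ->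
  (t%:E * \int[lebesgue_measure]_x f (v + t * x)%R =
   \int[@lebesgue_measure R]_x f x)%E.
Proof.
move=> t0 mf f0.
have ma : measurable_fun setT ((fun x => v + t * x)
    : measurableTypeR R -> measurableTypeR R).
  by apply: measurable_funD => //; exact: measurable_funM.
transitivity (\int[mscale (NngNum (ltW t0))
    (image_measure (@lebesgue_measure R) ma)]_x f x)%E; last first.
  by apply: eq_measure_integral => A mA _; exact: lebesgue_measure_affine.
by rewrite ge0_integral_mscale// ge0_integral_pushforward.
Qed.

Section lebesgue_rV_theory.
Context (R : realType).
Local Notation lam n := (lebesgue_rV R n).
Implicit Types n : nat.

Lemma lebesgue_rVS n (A : set 'rV[R]_n.+1) :
  lam n.+1 A = (@lebesgue_measure R \x lam n)%E (@rV_cons R n @^-1` A).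
Proof. by []. Qed.

Lemma measurable_rV_cons_preimage n (A : set 'rV[R]_n.+1) :
  measurable A -> measurable (@rV_cons R n @^-1` A).
Proof. by move=> mA; rewrite -[X in measurable X]setTI; exact: measurable_rV_cons. Qed.

Lemma continuous_measurable_rV n m (f : 'rV[R]_n -> 'rV[R]_m) :
  continuous f -> measurable_fun setT f.
Proof.
move=> cf; apply: (@measurability _ _ _ _ _ _ (@open 'rV[R]_m)) => //.
move=> _ [U oU <-]; rewrite setTI; apply: open_rV_measurable.
by move/continuousP: cf; apply.
Qed.

Lemma continuous_affine_rV n (v : 'rV[R]_n) (t : R) :
  continuous (fun x : 'rV[R]_n => v + t *: x).
Proof. by move=> x; apply: (cvgD (cvg_cst v) (@scaler_continuous _ _ t x)). Qed.

Lemma measurable_affine_rV n (v : 'rV[R]_n) (t : R) :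
  measurable_fun setT (fun x : 'rV[R]_n => v + t *: x).
Proof. by apply: continuous_measurable_rV; exact: continuous_affine_rV. Qed.

Lemma affine_rV_cons n (v : 'rV[R]_n.+1) (t : R) (p : R * 'rV[R]_n) :
  v + t *: rV_cons p =
  rV_cons ((rV_uncons v).1 + t * p.1, (rV_uncons v).2 + t *: p.2).
Proof.
apply/rowP => i; rewrite !mxE; case: unliftP => [j|] -> /=; last by [].
by rewrite !mxE.
Qed.

(** The map acts separately on the head and on the tail of a row vector. The induction hypothesis
    rescales each slice by [t ^+ n], and the one-dimensional change of variables in the head
    supplies the last factor. *)
Lemma lebesgue_rV_affine n (v : 'rV[R]_n) (t : R) (A : set 'rV[R]_n) :
  0 < t -> measurable A ->
  ((t ^+ n)%:E * lam n ((fun x => (v + t *: x)%R) @^-1` A) = lam n A)%E.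
Proof.
move=> t0; elim: n v A => [|n IH] v A mA.
  rewrite expr0 mul1e; congr (lam 0 _).
  by apply/funext => x; rewrite /preimage /mkset; congr A; apply/rowP => -[].
have mB := measurable_rV_cons_preimage mA.
rewrite !lebesgue_rVS /product_measure1.
pose G := lam n \o xsection (@rV_cons R n @^-1` A).
have mG : measurable_fun setT G by exact: measurable_fun_xsection.
rewrite -[RHS](ge0_integral_affine1 (rV_uncons v).1 t0 mG)//.
have -> : (\int[lebesgue_measure]_x G ((rV_uncons v).1 + t * x)%R =
  \int[lebesgue_measure]_x ((t ^+ n)%:E * (lam n \o xsection
   (@rV_cons R n @^-1` ((fun x => (v + t *: x)%R) @^-1` A))) x))%E.
  apply: eq_integral => x _; rewrite /G /= -(IH (rV_uncons v).2); last first.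
    exact: measurable_xsection.
  congr (_ * lam n _)%E; apply/seteqP; split => w /=;
    by rewrite !/xsection /= !inE /preimage /= affine_rV_cons.
rewrite ge0_integralZl//; first by rewrite muleA -EFinM exprS.
- apply: measurable_fun_xsection; apply: measurable_rV_cons_preimage.
  by rewrite -[X in measurable X]setTI; apply: measurable_affine_rV.
- by rewrite lee_fin exprn_ge0// ltW.
Qed.

Lemma ge0_integral_affine n (v : 'rV[R]_n) (t : R) (f : 'rV[R]_n -> \bar R) :
  0 < t -> measurable_fun setT f -> (forall x, 0 <= f x)%E ->
  ((t ^+ n)%:E * \int[lam n]_x f (v + t *: x)%R = \int[lam n]_x f x)%E.
Proof.
move=> t0 mf f0; have ma := measurable_affine_rV v t.
have tn0 : 0 <= t ^+ n by rewrite exprn_ge0// ltW.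
transitivity (\int[mscale (NngNum tn0) (image_measure (lam n) ma)]_x f x)%E; last first.
  by apply: eq_measure_integral => A mA _; exact: lebesgue_rV_affine.
by rewrite ge0_integral_mscale// ge0_integral_pushforward.
Qed.

(** Balls of the max norm are cubes, hence products of an interval with a ball of one dimension
    less. *)
Lemma lebesgue_rV_ball n (x : 'rV[R]_n) (r : R) :
  0 < r -> lam n (ball x r) = ((r *+ 2) ^+ n)%:E.
Proof.
move=> r0; elim: n x => [|n IH] x.
  by rewrite /= diracE mem_set// /ball/=; split=> // i [].
rewrite lebesgue_rVS (_ : _ @^-1` _ =
    ball (rV_uncons x).1 r `*` ball (rV_uncons x).2 r); last first.
  apply/seteqP; split => [[y w] [_ b]|[y w] [/= b1 [_ b2]]].
    split=> /=; first by have := b ord0 ord0; rewrite !mxE unlift_none.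
    split=> // i j; have := b i (lift ord0 j); rewrite !mxE liftK/= => h.
    by rewrite (ord1 i) in h *.
  split=> // i j; rewrite (ord1 i) !mxE; case: unliftP => [k|] -> //=.
  by have := b2 ord0 k; rewrite !mxE.
rewrite product_measure1E; last 2 first.
- exact: measurable_ball.
- by apply: open_rV_measurable; exact: ball_open.
transitivity ((r *+ 2)%:E * ((r *+ 2) ^+ n)%:E)%E; last by rewrite -EFinM -exprS.
by congr (_ * _)%E; [exact: lebesgue_measure_ball (ltW r0)|exact: IH].
Qed.

Lemma lebesgue_rV_bounded n (A : set 'rV[R]_n) :
  measurable A -> bounded_set A -> (lam n A < +oo)%E.
Proof.
move=> mA [M [_ /(_ (`|M| + 1))]] Mb.
have M1 : M < `|M| + 1 by rewrite ltr_pwDr// ler_norm.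
have e0 : 0 < `|M| + 2 by rewrite ltr_wpDl.
apply: (@le_lt_trans _ _ (lam n (ball (0 : 'rV[R]_n) (`|M| + 2)))).
  apply: le_measure; rewrite ?inE//.
    by apply: open_rV_measurable; exact: ball_open.
  move=> x /(Mb M1) /= xM; rewrite -ball_normE /ball_/= sub0r normrN.
  by rewrite (le_lt_trans xM)// ltrD2l ltr1n.
by rewrite lebesgue_rV_ball// ltry.
Qed.

Lemma lebesgue_rV_open_gt0 n (A : set 'rV[R]_n) :
  open A -> A !=set0 -> (0 < lam n A)%E.
Proof.
move=> oA [x Ax]; have /nbhs_ballP[e /= e0 eA] := open_nbhs_nbhs (conj oA Ax).
apply: (@lt_le_trans _ _ (lam n (ball x e))).
  by rewrite lebesgue_rV_ball// lte_fin exprn_gt0// mulrn_wgt0.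
apply: le_measure => //; rewrite inE; apply: open_rV_measurable => //.
exact: ball_open.
Qed.

End lebesgue_rV_theory.

(** * Calculus of C^1 functions *)

Section C1_functions.
Context (R : realType) (n : nat).
Local Notation V := 'rV[R]_n.
Implicit Types (f g : V -> R) (x v : V) (i : 'I_n).

Definition C1 f := (forall x, differentiable f x) /\ continuous (grad f).

Lemma gradE f x i : grad f x ord0 i = 'D_(delta_mx ord0 i) f x.
Proof. by rewrite mxE. Qed.

Lemma edotC x v : edot x v = edot v x.
Proof. by apply: eq_bigr => i _; rewrite mulrC. Qed.

Lemma derive_grad f x v : differentiable f x -> 'D_v f x = edot (grad f x) v.
Proof.
move=> df; rewrite deriveE// [v in LHS]row_sum_delta linear_sum.
by apply: eq_bigr => i _; rewrite linearZ /= gradE deriveE// mulrC.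
Qed.

Lemma coord_comp_continuous (f : V -> V) i :
  continuous f -> continuous (fun x => f x ord0 i).
Proof.
move=> cf x; apply: (@continuous_comp _ _ _ f (fun y : V => y ord0 i)).
  exact: cf.
exact: coord_continuous.
Qed.

Lemma C1_continuous f : C1 f -> continuous f.
Proof. by move=> [df _] x; exact: differentiable_continuous. Qed.

Lemma C1_cst (a : R) : C1 (cst a).
Proof.
split=> [x|]; first exact: differentiable_cst.
rewrite (_ : grad _ = cst 0); first exact: cst_continuous.
by apply/funext => x; apply/rowP => i; rewrite gradE derive_cst mxE.
Qed.

Lemma gradD f g x : differentiable f x -> differentiable g x ->
  grad (fun y => f y + g y) x = grad f x + grad g x.
Proof.
move=> df dg; apply/rowP => i; rewrite !mxE.
by rewrite (@deriveD _ _ _ f g)//; exact: diff_derivable.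
Qed.

Lemma gradZ (a : R) f x : differentiable f x ->
  grad (fun y => a * f y) x = a *: grad f x.
Proof.
move=> df; apply/rowP => i; rewrite !mxE.
by rewrite (@deriveZ _ _ _ f)//; exact: diff_derivable.
Qed.

Lemma gradM f g x : differentiable f x -> differentiable g x ->
  grad (fun y => f y * g y) x = f x *: grad g x + g x *: grad f x.
Proof.
move=> df dg; apply/rowP => i; rewrite !mxE.
by rewrite (@deriveM _ _ f g)//; exact: diff_derivable.
Qed.

Lemma C1D f g : C1 f -> C1 g -> C1 (fun y => f y + g y).
Proof.
move=> [df cf] [dg cg]; split=> [x|]; first exact: (@differentiableD _ _ _ f g).
rewrite (_ : grad _ = fun x => grad f x + grad g x).
  by move=> x; apply: (cvgD (cf x) (cg x)).
by apply/funext => x; rewrite gradD.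
Qed.

Lemma C1Z (a : R) f : C1 f -> C1 (fun y => a * f y).
Proof.
move=> [df cf]; split=> [x|]; first exact: (@differentiableZ _ _ _ f).
rewrite (_ : grad _ = fun x => a *: grad f x).
  by move=> x; apply: (cvgZ (cvg_cst a) (cf x)).
by apply/funext => x; rewrite gradZ.
Qed.

Lemma C1M f g : C1 f -> C1 g -> C1 (fun y => f y * g y).
Proof.
move=> Cf Cg; have [df cf] := Cf; have [dg cg] := Cg.
split=> [x|]; first exact: (@differentiableM _ _ f g).
rewrite (_ : grad _ = fun x => f x *: grad g x + g x *: grad f x).
  move=> x; apply: (cvgD (cvgZ (C1_continuous Cf (x:=x)) (cg x))
    (cvgZ (C1_continuous Cg (x:=x)) (cf x))).
by apply/funext => x; rewrite gradM.
Qed.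

Lemma C1_comp (h dh : R -> R) f : (forall t : R, is_derive t 1 h (dh t)) ->
  continuous dh -> C1 f -> C1 (h \o f).
Proof.
move=> Dh cdh Cf; have [df cf] := Cf.
have dfh (t : R) : differentiable h t by apply/derivable1_diffP; have [] := Dh t.
split=> [x|]; first by apply: differentiable_comp.
rewrite (_ : grad _ = fun x => dh (f x) *: grad f x).
  move=> x; apply: (cvgZ _ (cf x)).
  by apply: continuous_comp; [exact: C1_continuous|exact: cdh].
apply/funext => x; apply/rowP => i; rewrite !mxE deriveE; last exact: differentiable_comp.
rewrite diff_comp//= diff1E//= derive1E -deriveE//.
by have [_ ->] := Dh (f x); rewrite -[LHS]/(_ * _) mulrC.
Qed.

Lemma C1_coord i : C1 (fun x : V => x ord0 i).
Proof.
split=> [x|]; first exact: differentiable_coord.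
rewrite (_ : grad _ = cst (delta_mx ord0 i)); first exact: cst_continuous.
apply/funext => x; apply/rowP => j; rewrite gradE.
rewrite deriveE; last exact: differentiable_coord.
have lc : linear (fun v : V => v ord0 i) by move=> a u v; rewrite !mxE.
pose F : {linear V -> R} := HB.pack (fun v : V => v ord0 i)
  (GRing.isLinear.Build _ _ _ _ (fun v : V => v ord0 i) lc).
rewrite (@diff_lin _ _ _ F); last exact: coord_continuous.
by rewrite /F/= !mxE eqxx/= eq_sym.
Qed.

Lemma C1_prod I (r : seq I) (F : I -> V -> R) :
  (forall k, C1 (F k)) -> C1 (fun x => \prod_(k <- r) F k x).
Proof.
move=> CF; elim: r => [|k r IH].
  rewrite (_ : (fun _ => _) = cst 1); first exact: C1_cst.
  by apply/funext => x; rewrite big_nil.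
rewrite (_ : (fun _ => _) = fun x => F k x * \prod_(k <- r) F k x).
  exact: (C1M (CF k) IH).
by apply/funext => x; rewrite big_cons.
Qed.

Lemma is_derive_line f (x v : V) (t : R) : differentiable f (x + t *: v) ->
  is_derive t 1 (fun s : R => f (x + s *: v)) (edot (grad f (x + t *: v)) v).
Proof.
move=> df.
have dl : is_diff t (fun s : R => x + s *: v) (fun s => s *: v).
  by apply: is_diff_eq; rewrite add0r.
have d1 : differentiable (fun s : R => f (x + s *: v)) t.
  by apply: (@differentiable_comp _ _ _ _ (fun s : R => x + s *: v) f).
apply: DeriveDef; first by apply/derivable1_diffP.
rewrite deriveE// (@diff_comp _ _ _ _ (fun s : R => x + s *: v) f)//=.
by rewrite diff_val scale1r -deriveE// derive_grad.
Qed.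

End C1_functions.

(** * Countable bases and generators of the Borel sets of row vectors *)

Section rV_topology.
Context (R : realType) (n : nat).
Local Notation V := 'rV[R]_n.
Implicit Types (x v : V) (A K U : set V).

Lemma continuous_measurable_rV_real (f : V -> R) :
  continuous f -> measurable_fun setT f.
Proof.
move=> cf; apply: (measurability _ (RGenOpens.measurableE R)).
move=> _ [_ [a [b ->]] <-]; rewrite setTI; apply: open_rV_measurable.
by move/continuousP: cf; apply; exact: interval_open.
Qed.

Lemma closed_rV_measurable A : closed A -> measurable A.
Proof.
move=> cA; rewrite -[A]setCK; apply: measurableC.
by apply: open_rV_measurable; exact: closed_openC.
Qed.

Lemma compact_rV_measurable K : compact K -> measurable K.
Proof.
by move=> cK; apply: closed_rV_measurable; apply: compact_closed => //;
  exact: norm_hausdorff.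
Qed.

Lemma compact_rV_finite K : compact K -> (lebesgue_rV R n K < +oo)%E.
Proof.
move=> cK; apply: lebesgue_rV_bounded; first exact: compact_rV_measurable.
exact: compact_bounded.
Qed.

(** An index (w, k) encodes the ball of rational centre w and radius 1 / (k + 1). There are
    countably many, and their closures are compact: what is assumed on compact subsets of an open
    set spreads to the whole set. *)
Definition qcenter (i : 'rV[rat]_n * nat) : V := map_mx ratr i.1.
Definition qradius (i : 'rV[rat]_n * nat) : R := i.2.+1%:R^-1.
Definition qball i : set V := ball (qcenter i) (qradius i).
Definition qcball i : set V := [set y | `|qcenter i - y| <= qradius i].

Lemma qradius_gt0 i : 0 < qradius i. Proof. by rewrite invr_gt0. Qed.

Lemma qball_sub i : qball i `<=` qcball i.
Proof. by move=> y; rewrite /qball -ball_normE => /ltW. Qed.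

Lemma qcball_compact i : compact (qcball i).
Proof.
apply: bounded_closed_compact; last first.
  have := @closed_ball_closed R V (qcenter i) (qradius i).
  by rewrite closed_ballE// qradius_gt0.
exists (`|qcenter i| + qradius i); split; first exact: num_real.
move=> M Mi y /= yi; rewrite (le_trans _ (ltW Mi))//.
rewrite -[y](subKr (qcenter i)) (le_trans (ler_normB _ _))// lerD2l.
exact: yi.
Qed.

Lemma open_qball U x : open U -> U x -> exists2 i, qball i x & qcball i `<=` U.
Proof.
move=> oU Ux; have /nbhs_ballP[e /= e0 eU] := open_nbhs_nbhs (conj oU Ux).
have [k _ /(_ k (leqnn k))/= ke] :=
  near_infty_natSinv_lt (PosNum (divr_gt0 e0 (ltr0n _ 2))).
pose d : R := k.+1%:R^-1; have d0 : 0 < d by rewrite invr_gt0.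
have rat_near (r : R) : {s : rat | ball (ratr s : R) d r}.
  apply: cid; have [//|s] := @rat_in_itvoo _ r (r + d); first by rewrite ltrDl.
  rewrite in_itv/= => /andP[rs sd]; exists s.
  by rewrite /ball/= ger0_norm ?subr_ge0 1?ltW// ltrBlDl.
pose w : 'rV_n := \row_j projT1 (rat_near (x ord0 j)).
have bw : ball (map_mx ratr w : V) d x.
  split=> // i j; rewrite !mxE (ord1 i); exact: (projT2 (rat_near (x ord0 j))).
exists (w, k); first exact: bw.
move=> y yi; apply: eU; rewrite -ball_normE /ball_/=.
rewrite -(subrKA (map_mx ratr w)) (le_lt_trans (ler_normD _ _))// (splitr e).
rewrite ltrD//; last by rewrite (le_lt_trans yi).
by move: bw; rewrite -ball_normE /ball_/= distrC => /lt_trans; apply.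
Qed.

Lemma open_bigcup_qcball U : open U ->
  U = \bigcup_i (if `[< qcball i `<=` U >] then qcball i else set0).
Proof.
move=> oU; apply/seteqP; split=> [x Ux|x [i _]]; last by case: ifPn => // /asboolP; apply.
have [i xi iU] := open_qball oU Ux.
by exists i => //; rewrite ifT; [exact: qball_sub|exact/asboolP].
Qed.

(** Meant for locally integrable functions, whose measurability is given on compact subsets only. *)
Lemma measurable_fun_open_compact d (T : measurableType d) U (f : V -> T) : open U ->
  (forall K, compact K -> K `<=` U -> measurable_fun K f) -> measurable_fun U f.
Proof.
move=> oU mf mU Y mY; rewrite [X in X `&` _](open_bigcup_qcball oU) setI_bigcupl.
apply: countable_bigcupT_measurable => // i; case: ifPn => [/asboolP iU|_].
  have cq := @qcball_compact i.
  exact: mf (compact_rV_measurable cq) _ mY.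
by rewrite set0I.
Qed.

Lemma negligible_open_qball (mu : {measure set V -> \bar R}) U (P : set V) : open U ->
  (forall i, qcball i `<=` U -> mu.-negligible (qball i `&` P)) ->
  mu.-negligible (U `&` P).
Proof.
move=> oU H.
pose F k := if unpickle k is Some i then
  (if `[< qcball i `<=` U >] then qball i `&` P else set0) else set0.
apply: (@negligibleS _ _ _ _ (\bigcup_k F k)).
  move=> x [Ux Px]; have [i xi iU] := open_qball oU Ux.
  by exists (pickle i) => //; rewrite /F pickleK ifT//; exact/asboolP.
apply: negligible_bigcup => k; rewrite /F; case: unpickle => [i|]; last exact: negligible_set0.
case: ifPn => [/asboolP iU|_]; last exact: negligible_set0.
exact: H.
Qed.

Definition box (a b : V) : set V :=
  [set x | forall i, a ord0 i < x ord0 i < b ord0 i].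

(** The corners are arbitrary, so empty boxes are included and the family is closed under
    intersection. It generates the Borel sets and starts the Dynkin argument of
    [test_integral_eq0]. *)
Definition boxes : set (set V) := [set box a.1 a.2 | a in setT].

Lemma boxI (a b c d : V) : box a b `&` box c d =
  box (\row_i Num.max (a ord0 i) (c ord0 i)) (\row_i Num.min (b ord0 i) (d ord0 i)).
Proof.
apply/seteqP; split => [x [xab xcd] i|x h].
  move: (xab i) (xcd i) => /andP[h1 h2] /andP[h3 h4].
  by rewrite !mxE gt_max lt_min h1 h2 h3 h4.
by split=> i; have := h i; rewrite !mxE gt_max lt_min
  => /andP[/andP[h1 h2] /andP[h3 h4]]; apply/andP.
Qed.

Lemma ball_box x (r : R) : 0 < r ->
  ball x r = box (\row_i (x ord0 i - r)) (\row_i (x ord0 i + r)).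
Proof.
move=> r0; apply/seteqP; split => [y [_ b] i|y h].
  have := b ord0 i; rewrite !mxE /ball/= ltr_norml => /andP[h1 h2].
  by apply/andP; split; lra.
split=> // i j; rewrite (ord1 i); have := h j; rewrite !mxE /ball/= ltr_norml => /andP[h1 h2].
by apply/andP; split; lra.
Qed.

Lemma boxes_setI_closed : setI_closed boxes.
Proof.
by move=> _ _ [[a b] _ <-] [[c d] _ <-]; rewrite /= boxI; eexists (_, _).
Qed.

Lemma open_box a b : open (box a b).
Proof.
rewrite openE => x xab; rewrite /interior/=.
have H i : nbhs x [set y : V | a ord0 i < y ord0 i < b ord0 i].
  have /continuousP/(_ _ (@interval_open R (BRight (a ord0 i)) (BLeft (b ord0 i)) isT isT)) :=
    @coord_continuous R 1 n ord0 i.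
  rewrite openE => /(_ x); rewrite /interior /preimage/= in_itv/= => /(_ (xab i)).
  by apply: (@filterS _ (nbhs x) (nbhs_filter x)) => y; rewrite /= in_itv.
exact: (@filter_forall _ _ _ (nbhs x) (nbhs_filter x) H).
Qed.

Lemma measurable_rV_boxes : @measurable _ V = <<s boxes >>.
Proof.
apply/seteqP; split; last first.
  apply: smallest_sub; first exact: sigma_algebra_measurable.
  by move=> _ [[a b] _ <-]; apply: open_rV_measurable; exact: open_box.
apply: smallest_sub; first exact: smallest_sigma_algebra.
move=> U oU.
pose F k := if unpickle k is Some i then
  if `[< qball i `<=` U >] then qball i else set0 else set0.
have -> : U = \bigcup_k F k.
  apply/seteqP; split => [x Ux|x [k _]].
    have [i xi iU] := open_qball oU Ux; exists (pickle i) => //.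
    by rewrite /F pickleK ifT//; apply/asboolP => y /qball_sub; exact: iU.
  by rewrite /F; case: unpickle => // i; case: ifPn => // /asboolP; apply.
have [s0 _ sU] := @smallest_sigma_algebra _ setT boxes.
apply: sU => k; rewrite /F; case: unpickle => // i; case: ifPn => // _.
apply: sub_gen_smallest; rewrite /qball ball_box ?qradius_gt0//.
by eexists (_, _).
Qed.

End rV_topology.

(** * Integration of compactly supported functions *)

Section compact_support.
Context (R : realType) (n : nat).
Local Notation V := 'rV[R]_n.
Local Notation lam := (lebesgue_rV R n).
Implicit Types (x v : V) (K : set V) (f : V -> R).

Lemma continuous_bounded_on f K : continuous f -> compact K ->
  exists M, 0 <= M /\ forall x, K x -> `|f x| <= M.
Proof.
move=> cf cK; have : compact (f @` K).
  by apply: continuous_compact => //; exact: continuous_subspaceT.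
move=> /compact_bounded[M [_ /(_ (`|M| + 1))]].
rewrite ltr_pwDr ?ler_norm// => /(_ isT) h; exists (`|M| + 1).
by split=> [|x Kx]; [rewrite addr_ge0|apply: h; exists x].
Qed.

Lemma continuous_integrable_compact f K : continuous f -> compact K ->
  lam.-integrable K (EFin \o f).
Proof.
move=> cf cK; have mK := compact_rV_measurable cK.
apply: measurable_bounded_integrable => //.
- exact: compact_rV_finite.
- by apply: measurable_funTS; exact: continuous_measurable_rV_real.
- have [M [_ fM]] := continuous_bounded_on cf cK.
  exists M; split; first exact: num_real.
  by move=> N MN x Kx; rewrite /= (le_trans (fM _ Kx))// ltW.
Qed.

Lemma EFin_patch T (D : set T) (f : T -> R) : EFin \o (f \_ D) = (EFin \o f) \_ D.
Proof. by apply/funext => x; rewrite /patch/=; case: ifPn. Qed.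

Lemma patch_support T (D K : set T) (f : T -> R) : K `<=` D ->
  (forall y, ~ K y -> f y = 0) -> f \_ D = f \_ K.
Proof.
move=> KD f0; apply/funext => x; rewrite /patch.
case: ifPn => [_|xD]; case: ifPn => // xK.
  by apply: f0 => Kx; move/negP: xK; apply; exact: mem_set.
by move/negP: xD => []; apply/mem_set/KD; exact: set_mem.
Qed.

Lemma compact_support_integrable f K (D : set V) : continuous f -> compact K ->
  measurable D -> (forall x, ~ K x -> f x = 0) -> lam.-integrable D (EFin \o f).
Proof.
move=> cf cK mD f0; apply: (@integrableS _ _ _ _ setT) => //.
have -> : EFin \o f = (EFin \o f) \_ K.
  by rewrite -EFin_patch -(patch_support (@subsetT _ _) f0) patch_setT.
exact: (proj1 (integrable_mkcond _ (compact_rV_measurable cK))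
  (continuous_integrable_compact cf cK)).
Qed.

Lemma integral_translate v (f : V -> \bar R) : measurable_fun setT f ->
  (\int[lam]_x f (x + v)%R = \int[lam]_x f x)%E.
Proof.
move=> mf.
have mp : measurable_fun setT (f^\+)%E by exact: measurable_funepos.
have mn : measurable_fun setT (f^\-)%E by exact: measurable_funeneg.
rewrite integralE [RHS]integralE.
rewrite -(@ge0_integral_affine _ _ v 1 (f^\+)%E)// -(@ge0_integral_affine _ _ v 1 (f^\-)%E)//.
rewrite expr1n !mul1e; congr (_ - _)%E; apply: eq_integral => x _;
  by rewrite /= ?(funeposE, funenegE) scale1r addrC.
Qed.

Lemma grad_support f K x : compact K -> (forall x, ~ K x -> f x = 0) ->
  ~ K x -> grad f x = 0.
Proof.
move=> cK f0 Kx; apply/rowP => i; rewrite !mxE.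
have cl : closed K by apply: compact_closed => //; exact: norm_hausdorff.
rewrite -(@derive_cst _ _ _ (0 : R) x (delta_mx ord0 i)).
have oK := closed_openC cl.
have [->|d0] := eqVneq (delta_mx ord0 i : V) 0; first by rewrite !derive0.
apply: near_eq_derive => //.
by apply: (filterS _ (open_nbhs_nbhs (conj oK Kx))) => y; exact: f0.
Qed.

Lemma mvt_line f (x v : V) (M : R) : C1 f -> (forall y, `|edot (grad f y) v| <= M) ->
  forall t, 0 < t -> `|f (x + t *: v) - f x| <= M * t.
Proof.
move=> [df cf] fM t t0.
have D (s : R) : is_derive s 1 (fun s : R => f (x + s *: v)) (edot (grad f (x + s *: v)) v).
  exact: is_derive_line.
have cl : {within `[0, t], continuous (fun s : R => f (x + s *: v))}.
  apply: continuous_subspaceT => s; apply: differentiable_continuous.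
  by apply/derivable1_diffP; have [] := D s.
have [s _] := MVT t0 (fun s _ => D s) cl.
rewrite scale0r addr0 subr0 => ->.
by rewrite normrM (gtr0_norm t0) ler_pM2r.
Qed.

(** The difference quotients of [f] have integral zero by translation invariance. They converge
    pointwise to the partial derivative and are dominated by a constant on a fixed compact set. *)
Lemma integral_partial_eq0 f K i : C1 f -> compact K -> (forall x, ~ K x -> f x = 0) ->
  (\int[lam]_x (grad f x ord0 i)%:E = 0)%E.
Proof.
move=> Cf cK f0; have [df cf] := Cf.
pose e : V := delta_mx ord0 i.
pose r (m : nat) : R := m.+1%:R^-1.
have r0 m : 0 < r m by rewrite invr_gt0.
pose F m x := (r m)^-1 * (f (x + r m *: e) - f x).
have contf := C1_continuous Cf.
have cFm m : continuous (fun x => f (x + r m *: e)).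
  move=> x; apply: (@continuous_comp _ _ _ (fun x : V => x + r m *: e) f); last exact: contf.
  rewrite (_ : (fun x : V => x + r m *: e) = fun x : V => r m *: e + 1 *: x).
    exact: continuous_affine_rV.
  by apply/funext => y; rewrite scale1r addrC.
have cF m : continuous (F m).
  by move=> x; apply: (cvgM (cvg_cst _) (cvgB (cFm m x) (contf x))).
have cg : continuous (fun x => grad f x ord0 i) by exact: coord_comp_continuous.
have edote y : edot (grad f y) e = grad f y ord0 i.
  by rewrite -derive_grad// gradE.
have [M [M0 gM]] := continuous_bounded_on cg cK.
have gM' y : `|edot (grad f y) e| <= M.
  rewrite edote; have [Ky|nKy] := pselect (K y); first exact: gM.
  by rewrite (grad_support cK f0 nKy) mxE normr0.
have [B [_ KB]] := compact_bounded cK.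
(* [K] lies in the ball of radius |B| + 1, and the increments [r m *: e] are no longer than [e]:
   this one compact set supports every quotient [F m]. *)
pose K' : set V := [set y | `|y| <= `|B| + 1 + `|e|].
have cK' : compact K'.
  apply: bounded_closed_compact.
    exists (`|B| + 1 + `|e|); split; first exact: num_real.
    by move=> N BN y /= yB; rewrite (le_trans yB)// ltW.
  rewrite (_ : K' = (fun y : V => `|y|) @^-1` [set t | t <= `|B| + 1 + `|e|])//.
  by apply: (proj1 (continuous_closedP (fun y : V => `|y|))); [exact: norm_continuous|exact: closed_le].
have FK' m x : ~ K' x -> F m x = 0.
  move=> nK'; have nK y : `|B| + 1 < `|y| -> f y = 0.
    move=> By; apply: f0 => /(KB (`|B| + 1)) h; move: By; rewrite ltNge h//.
    by rewrite ltr_pwDr// ler_norm.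
  have Bx : `|B| + 1 + `|e| < `|x| by rewrite ltNge; apply/negP.
  rewrite /F !nK ?subrr ?mulr0//; first by have := normr_ge0 e; lra.
  have : `|x| <= `|x + r m *: e| + `|r m *: e|.
    by rewrite -{1}(addrK (r m *: e) x) (le_trans (ler_normB _ _)).
  have : `|r m *: e| <= `|e|.
    by rewrite normrZ (gtr0_norm (r0 m)) ler_piMl// invf_le1// ler1n.
  by lra.
have FM m x : `|F m x| <= M.
  rewrite /F normrM gtr0_norm ?invr_gt0// mulrC ler_pdivrMr//.
  exact: mvt_line.
have Fcvg x : F m x @[m --> \oo] --> grad f x ord0 i.
  have [/cvg_ex[l /= cl] dl] := is_derive_line (x := x) (v := e) (t := 0) (df _).
  have ll : l = grad f x ord0 i.
    have <- : edot (grad f (x + 0 *: e)) e = l by rewrite -dl; exact/cvg_lim.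
    by rewrite scale0r addr0 edote.
  (* Dominated convergence concerns sequences, so the derivative is read along the nonzero
     increments 1 / (m + 1). *)
  rewrite -ll {dl ll}; move/cvgr_dnbhsP : cl => /(_ r) /=.
  move=> h; have {}h := h (conj (fun m => lt0r_neq0 (r0 m)) (@cvg_harmonic R)).
  apply: cvg_trans h; apply: near_eq_cvg; near=> m.
  by rewrite /F /= scale0r !addr0 -[(r m)%:A]/(r m * 1) mulr1.
have /= [] := @dominated_convergence _ _ _ lam setT measurableT
  (fun m x => (F m x)%:E) (fun x => (grad f x ord0 i)%:E) (EFin \o (cst M \_ K')).
- by move=> m; apply/measurable_EFinP; exact: continuous_measurable_rV_real.
- by apply/measurable_EFinP; exact: continuous_measurable_rV_real.
- by apply: nearW => x _; apply/cvg_EFin; [exact: nearW|exact: Fcvg].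
- rewrite EFin_patch; apply: (proj1 (integrable_mkcond _ (compact_rV_measurable cK'))).
  by apply: continuous_integrable_compact => //; exact: cst_continuous.
- apply: nearW => x m _; rewrite /= lee_fin /patch; case: ifPn => [_|xK']; first exact: FM.
  by rewrite FK' ?normr0// => K'x; move/negP: xK'; apply; exact: mem_set.
move=> _ _; set u := (X in X @ \oo --> _) => h.
suff u0 : u = cst 0%E.
  by apply: (@cvg_unique _ (@ereal_hausdorff R) _ _ _ _ h); rewrite u0; exact: cvg_cst.
apply/funext => m; rewrite /u/=.
rewrite /F; under eq_integral do rewrite EFinM.
have i1 : lam.-integrable setT (EFin \o f) by exact: compact_support_integrable cK _ _.
have i2 : lam.-integrable setT (fun x => (f (x + r m *: e))%:E).
  have -> : (fun x => (f (x + r m *: e))%:E) = EFin \o (fun x => r m * F m x + f x).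
    apply/funext => x /=; rewrite /F mulrA mulfV ?mul1r ?subrK//; exact: lt0r_neq0.
  apply: (@compact_support_integrable _ (K `|` K')) => //.
  - by move=> x; apply: (cvgD (cvgM (cvg_cst _) (cF m x)) (contf x)).
  - exact: compactU.
  - by move=> x /not_orP[nK nK']; rewrite FK'// f0// mulr0 addr0.
rewrite integralZl//; last first.
  exact: (@integrableB _ _ _ _ _ measurableT _ _ i2 i1).
under eq_integral do rewrite EFinB.
rewrite integralB// (@integral_translate (r m *: e) (EFin \o f)); last first.
  by apply/measurable_EFinP; exact: continuous_measurable_rV_real.
rewrite subee ?mule0//; exact: integrable_fin_num.
Unshelve. all: by end_near. Qed.

End compact_support.

(** * Uniqueness of weak gradients *)

Section bump.
Context (R : realType).
Implicit Types t : R.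

Definition sqr_pos t : R := Num.max 0 t ^+ 2.

Lemma sqr_pos_ge0 t : 0 <= sqr_pos t. Proof. exact: sqr_ge0. Qed.

Lemma continuous_pos_part : continuous (fun t : R => Num.max 0 t).
Proof. by move=> t; apply: continuous_max; [exact: cst_continuous|exact: cvg_id]. Qed.

Lemma is_derive_sqr_pos t : is_derive t 1 sqr_pos (2 * Num.max 0 t).
Proof.
have [t0|t0|->] := ltgtP t 0.
- apply: (@near_eq_is_derive _ _ _ (cst 0)).
    near=> s; rewrite /sqr_pos max_l ?expr0n//= ltW//.
    by near: s; exact: lt_nbhsl.
  by rewrite mulr0; exact: is_derive_cst.
- apply: (@near_eq_is_derive _ _ _ (fun s : R => s ^+ 2)).
    near=> s; rewrite /sqr_pos max_r//= ltW//.
    by near: s; exact: lt_nbhsr.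
  apply: is_derive_eq.
  by rewrite -[t%:A]/(t * 1) mulr1 mulr_natl.
- rewrite mulr0.
  have H : h^-1 *: ((sqr_pos \o shift 0) (h *: (1 : R)) - sqr_pos 0) @[h --> 0^'] --> (0 : R).
    apply/cvgrPdist_le => e e0; near=> h.
    rewrite sub0r normrN /sqr_pos/= maxxx expr0n/= subr0 addr0 -[_%:A]/(h * 1) mulr1.
    rewrite -[_ *: _]/(h^-1 * _) normrM normfV.
    have he : `|h| <= e by near: h; apply: dnbhs0_le.
    have h0 : h != 0 by near: h; exact: nbhs_dnbhs_neq.
    rewrite ler_pdivrMl ?normr_gt0// normrX expr2.
    have : `|Num.max 0 h| <= `|h|.
      by rewrite /Num.max; case: ifPn; rewrite ?normr0.
    have := normr_ge0 (Num.max 0 h); nra.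
  by apply: DeriveDef; [apply/cvg_ex; exists 0|exact/cvg_lim].
Unshelve. all: by end_near. Qed.

(** A cut-off by a rational function of the squared positive part: it is C^1, as test functions have
    to be, takes values in [0, 1], vanishes for t <= 0 and tends to 1 as m grows for t > 0. *)
Definition bump1 (m : nat) t : R := 1 - (1 + m%:R * sqr_pos t)^-1.

Lemma bump1_den m t : 1 <= 1 + m%:R * sqr_pos t.
Proof. by rewrite lerDl mulr_ge0// sqr_pos_ge0. Qed.

Lemma bump1_ge0 m t : 0 <= bump1 m t.
Proof.
by rewrite subr_ge0 invf_le1 ?bump1_den// (lt_le_trans ltr01)// bump1_den.
Qed.

Lemma bump1_le1 m t : bump1 m t <= 1.
Proof. by rewrite gerBl invr_ge0 (le_trans ler01)// bump1_den. Qed.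

Lemma bump1_eq0 m t : t <= 0 -> bump1 m t = 0.
Proof.
by move=> t0; rewrite /bump1 /sqr_pos max_l// expr0n mulr0 addr0 invr1 subrr.
Qed.

Lemma bump1_cvg t : 0 < t -> bump1 m t @[m --> \oo] --> (1 : R).
Proof.
move=> t0; rewrite -[X in _ --> X]subr0; apply: cvgB; first exact: cvg_cst.
have s0 : 0 < sqr_pos t by rewrite /sqr_pos max_r ?ltW// exprn_gt0.
apply/cvgrPdist_le => e e0; near=> m.
rewrite sub0r normrN gtr0_norm ?invr_gt0 ?(lt_le_trans ltr01) ?bump1_den//.
rewrite -[leRHS]invrK lef_pV2 ?posrE ?invr_gt0// ?(lt_le_trans ltr01) ?bump1_den//.
rewrite (@le_trans _ _ (m%:R * sqr_pos t))// ?lerDr// -ler_pdivrMr//.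
by near: m; exact: nbhs_infty_ger.
Unshelve. all: by end_near. Qed.

Lemma bump1_derive m : exists2 db : R -> R, continuous db &
  forall t, is_derive t 1 (bump1 m) (db t).
Proof.
pose D t := 1 + m%:R * sqr_pos t.
have D0 t : D t != 0 by rewrite gt_eqF// (lt_le_trans ltr01)// bump1_den.
pose dD t := m%:R * (2 * Num.max 0 t).
have dDP t : is_derive t 1 D (dD t).
  have := is_derive_sqr_pos t => H.
  have HZ : is_derive t 1 (fun s => m%:R * sqr_pos s) (dD t) by exact: is_deriveZ.
  by have := is_deriveD (is_derive_cst (1 : R) t 1) HZ; rewrite add0r.
have cD : continuous D.
  move=> t; apply: differentiable_continuous; apply/derivable1_diffP.
  by have [] := dDP t.
exists (fun t => D t ^- 2 * dD t).
  move=> t; apply: cvgM.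
    by apply: cvgV; [rewrite expf_neq0|exact: (cvgM (cD t) (cD t))].
  apply: cvgM; first exact: cvg_cst.
  by apply: cvgM; [exact: cvg_cst|exact: continuous_pos_part].
move=> t; have dV := is_deriveV (D0 t) (dDP t).
apply: (is_derive_eq (is_deriveB (is_derive_cst (1 : R) t 1) dV)).
by rewrite sub0r -scaleNr opprK.
Qed.

End bump.

Section box_bump.
Context (R : realType) (n : nat).
Local Notation V := 'rV[R]_n.
Implicit Types (x a b : V).

Definition cbox a b : set V :=
  [set x | forall i, a ord0 i <= x ord0 i <= b ord0 i].

Lemma cbox_compact a b : compact (cbox a b).
Proof.
rewrite (_ : cbox a b = [set x : V | forall i, `[a ord0 i, b ord0 i]%classic (x ord0 i)]).
  apply: (@rV_compact _ _ (fun i => `[a ord0 i, b ord0 i]%classic)) => i.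
  exact: segment_compact.
by apply/seteqP; split => x h i; have := h i; rewrite /= in_itv.
Qed.

(** As m grows these C^1 functions tend pointwise to the indicator of the open box, outside of which
    they vanish. *)
Definition box_bump m a b x : R :=
  \prod_i (bump1 m (x ord0 i - a ord0 i) * bump1 m (b ord0 i - x ord0 i)).

Lemma box_bump_C1 m a b : C1 (box_bump m a b).
Proof.
have [db cdb dbP] := @bump1_derive R m.
apply: C1_prod => i; apply: C1M; apply: (C1_comp dbP cdb).
  by apply: C1D; [exact: C1_coord|exact: C1_cst].
rewrite (_ : (fun _ => _) = (fun x : V => b ord0 i + -1 * x ord0 i)).
  apply: (@C1D _ _ (cst (b ord0 i)) (fun x : V => -1 * x ord0 i)); first exact: C1_cst.
  by apply: C1Z; exact: C1_coord.
by apply/funext => x; rewrite mulN1r.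
Qed.

Lemma box_bump_itv m a b x : 0 <= box_bump m a b x <= 1.
Proof.
rewrite /box_bump; apply: (big_ind (fun y : R => 0 <= y <= 1)).
- by rewrite ler01 lexx.
- by move=> y z /andP[y0 y1] /andP[z0 z1]; rewrite mulr_ge0//= mulr_ile1.
by move=> i _; rewrite mulr_ge0 ?bump1_ge0//= mulr_ile1 ?bump1_ge0 ?bump1_le1.
Qed.

Lemma box_bump_eq0 m a b x : ~ box a b x -> box_bump m a b x = 0.
Proof.
move=> /existsNP[i /negP]; rewrite negb_and -!leNgt => h.
apply/eqP; rewrite prodf_seq_eq0; apply/hasP; exists i; first by rewrite mem_index_enum.
by rewrite /= mulf_eq0; case/orP : h => h; apply/orP; [left|right];
  rewrite bump1_eq0// subr_le0.
Qed.

Lemma box_bump_cvg a b x : box a b x -> box_bump m a b x @[m --> \oo] --> (1 : R).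
Proof.
move=> h; rewrite [X in _ --> X](_ : 1 = \prod_(i < n) (1 : R)); last by rewrite big1.
apply: (cvg_big mul_continuous).
move=> i _; rewrite -[X in _ --> X]mulr1; have /andP[h1 h2] := h i.
by apply: cvgM; apply: bump1_cvg; rewrite subr_gt0.
Qed.

End box_bump.

Section weak_gradient_unique.
Context (R : realType) (n : nat) (Omega : set 'rV[R]_n).
Hypothesis oOmega : open Omega.
Local Notation V := 'rV[R]_n.
Local Notation lam := (lebesgue_rV R n).
Implicit Types (x a b : V) (f h : V -> R).

Let mOmega : measurable Omega := open_rV_measurable oOmega.

Lemma box_cbox a b : box a b `<=` cbox a b.
Proof. by move=> x h i; have /andP[/ltW -> /ltW ->] := h i. Qed.

Lemma norm_rV_le x (r : R) : 0 <= r -> (`|x| <= r) <-> (forall j, `|x ord0 j| <= r).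
Proof.
move=> r0; rewrite -[`|x|]/(mx_norm x) mx_normrE; split=> [/bigmax_leP[_ h] j|h].
  exact: (h (ord0, j)).
by apply/bigmax_leP; split=> // -[i j] _ /=; rewrite (ord1 i).
Qed.

Lemma qcball_cbox (i : 'rV[rat]_n * nat) : qcball i =
  cbox (\row_j ((qcenter R i) ord0 j - qradius R i)) (\row_j ((qcenter R i) ord0 j + qradius R i)).
Proof.
have r0 := @qradius_gt0 R n i.
apply/seteqP; split => [y /(norm_rV_le _ (ltW r0)) yi j|y h].
  by have := yi j; rewrite !mxE ler_norml => /andP[h1 h2]; apply/andP; split; lra.
apply/(norm_rV_le _ (ltW r0)) => j; have := h j.
by rewrite !mxE ler_norml => /andP[h1 h2]; apply/andP; split; lra.
Qed.

Lemma box_bump_test m a b : cbox a b `<=` Omega -> test_function Omega (box_bump m a b).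
Proof.
move=> abO; have [df cf] := @box_bump_C1 R n m a b.
split=> //; exists (cbox a b); split=> //; first exact: cbox_compact.
by move=> x nx; apply: box_bump_eq0 => /box_cbox.
Qed.

(** Each [box_bump] is a test function, and dominated convergence, with |h| on the closed box as
    majorant, passes to the indicator of the open box. *)
Lemma integral_box_eq0 h a b : locally_integrable_on Omega h ->
  (forall phi, test_function Omega phi -> \int[lam]_(x in Omega) (h x * phi x) = 0) ->
  cbox a b `<=` Omega -> (\int[lam]_(x in box a b) (h x)%:E = 0)%E.
Proof.
move=> lh h0 abO; pose K := cbox a b; have cK : compact K by exact: cbox_compact.
have mK := compact_rV_measurable cK.
have ih : lam.-integrable K (EFin \o h) by exact: lh.
have mh : measurable_fun K h by apply/measurable_EFinP; exact: measurable_int ih.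
have mb : measurable (box a b) by apply: open_rV_measurable; exact: open_box.
have mbump m : measurable_fun K (box_bump m a b).
  apply: measurable_funTS; apply: continuous_measurable_rV_real.
  exact: C1_continuous (box_bump_C1 _ _ _).
have hm m x : K x -> (`|(h x * box_bump m a b x)%:E| <= `|(h x)%:E|)%E.
  move=> _; rewrite lee_fin normrM ler_piMr//.
  by have /andP[b0 b1] := box_bump_itv m a b x; rewrite ger0_norm.
have ihm m : lam.-integrable K (fun x => (h x * box_bump m a b x)%:E).
  apply: le_integrable ih => //; first by apply/measurable_EFinP; exact: measurable_funM.
  exact: hm.
have hm0 m : (\int[lam]_(x in K) (h x * box_bump m a b x)%:E = 0)%E.
  have := h0 _ (box_bump_test m abO); rewrite Rintegral_mkcond.
  rewrite (@patch_support _ _ _ K)//; last first.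
    by move=> x nx; rewrite box_bump_eq0 ?mulr0// => /box_cbox.
  rewrite -Rintegral_mkcond /Rintegral => /(congr1 (@EFin R)).
  by rewrite fineK//; exact: integrable_fin_num.
have [] := @dominated_convergence _ _ _ lam K mK
  (fun m x => (h x * box_bump m a b x)%:E) ((EFin \o h) \_ (box a b)) (fun x => `|(h x)%:E|%E).
- by move=> m; exact: measurable_int (ihm m).
- apply/(measurable_restrict _ mb mK); apply: (measurable_funS mK _ (measurable_int _ ih)).
  by move=> x [].
- apply: nearW => x _; rewrite /patch; case: ifPn => [xb|xb].
    apply/cvg_EFin; first exact: nearW.
    rewrite -[X in _ --> X]mulr1; apply: cvgM; first exact: cvg_cst.
    by apply: box_bump_cvg; exact: set_mem.
  rewrite (_ : (fun _ => _) = cst 0%E); first exact: cvg_cst.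
  apply/funext => m; rewrite box_bump_eq0 ?mulr0// => xb'; move/negP : xb; apply.
  exact: mem_set.
- exact: integrable_abse.
- by apply: nearW => x m Kx; exact: hm.
move=> _ _; set u := (X in X @ \oo --> _) => hu.
have <- : (\int[lam]_(x in K) ((EFin \o h) \_ (box a b)) x = \int[lam]_(x in box a b) (h x)%:E)%E.
  by rewrite -integral_mkcondr setIidr//; exact: box_cbox.
apply: (@cvg_unique _ (@ereal_hausdorff R) _ _ _ _ hu).
by rewrite (_ : u = cst 0%E); [exact: cvg_cst|apply/funext => m; exact: hm0].
Qed.

(** The fundamental lemma of the calculus of variations. On a rational ball Q inside Omega, the
    Borel sets S for which h has zero integral over S and Q form a Dynkin class containing the
    boxes, hence all Borel sets; so h vanishes almost everywhere on Q, and countably many such balls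
    cover Omega. *)
Lemma test_integral_eq0 h : locally_integrable_on Omega h ->
  (forall phi, test_function Omega phi -> \int[lam]_(x in Omega) (h x * phi x) = 0) ->
  {ae lam, forall x, Omega x -> h x = 0}.
Proof.
move=> lh h0; apply: (@negligibleS _ _ _ _ (Omega `&` [set x | h x <> 0])).
  by move=> x /= /not_implyP.
apply: negligible_open_qball => // i iO.
have r0 := @qradius_gt0 R n i; pose Q : set V := qball i.
have mQ : measurable Q by apply: open_rV_measurable; exact: ball_open.
have cQ := @qcball_compact R n i; have mcQ := compact_rV_measurable cQ.
have ih : lam.-integrable Q (EFin \o h).
  by apply: (integrableS mcQ) => //; [exact: qball_sub|exact: lh].
have box0 a b : (\int[lam]_(x in box a b `&` Q) (h x)%:E = 0)%E.
  rewrite /Q /qball ball_box// boxI integral_box_eq0//.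
  apply: subset_trans iO; rewrite qcball_cbox => x hx j.
  by have := hx j; rewrite !mxE ge_max le_min => /andP[/andP[_ ->] /andP[_ ->]].
have h0S S : <<s @boxes R n >> S -> (\int[lam]_(x in S `&` Q) (h x)%:E = 0)%E.
  move: S; apply: (dynkin_induction (measurable_rV_boxes R n)).
  - exact: boxes_setI_closed.
  - by rewrite setTI -[Q]setIid {1}/Q /qball ball_box// box0.
  - by move=> _ [[a b] _ <-]; exact: box0.
  - move=> S mS S0; have mSQ : measurable (S `&` Q) by exact: measurableI.
    have mSQ' : measurable (~` S `&` Q) by apply: measurableI => //; exact: measurableC.
    have : (\int[lam]_(x in Q) (h x)%:E = 0)%E.
      by rewrite -[Q]setIid {1}/Q /qball ball_box// box0.
    have {1}-> : Q = (S `&` Q) `|` (~` S `&` Q) by rewrite -setIUl setUv setTI.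
    rewrite integral_setU//.
    + by rewrite S0 add0e.
    + by apply: (measurable_funS mQ _ (measurable_int _ ih)) => x [] [].
    + by rewrite disj_set2E; apply/eqP; rewrite setIACA setICr set0I.
  - move=> F mF tF F0; rewrite setI_bigcupl integral_bigcup.
    + by rewrite eseries0// => k _ _; exact: F0.
    + by apply/trivIsetP => j k _ _ jk; rewrite setIACA; move/trivIsetP : tF => ->//; rewrite set0I.
    + by move=> k; exact: measurableI.
    + apply: (integrableS mQ) ih => //; last by move=> x [k _ []].
      by apply: bigcupT_measurable => k; exact: measurableI.
have : ae_eq lam Q (EFin \o h) (cst 0%E).
  apply: integral_ae_eq => // E EQ mE; rewrite integral0.
  by rewrite -(setIidl EQ); apply: h0S; rewrite -measurable_rV_boxes.
apply: negligibleS => x [Qx hx]; apply/not_implyP; split=> //.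
by move=> /= [] /hx.
Qed.

End weak_gradient_unique.

(** * Weak gradients and Lebesgue norms *)

Section weak_gradient.
Context (R : realType) (n : nat) (Omega : set 'rV[R]_n).
Hypothesis oOmega : open Omega.
Local Notation V := 'rV[R]_n.
Local Notation lam := (lebesgue_rV R n).
Local Notation is_wg := (is_weak_gradient Omega).
Implicit Types (x : V) (y v h phi : V -> R) (g k : V -> V) (K : set V).

Let mOmega : measurable Omega := open_rV_measurable oOmega.

Lemma test_C1 phi : test_function Omega phi -> C1 phi. Proof. by case. Qed.

Lemma test_continuous phi : test_function Omega phi -> continuous phi.
Proof. by move=> /test_C1; exact: C1_continuous. Qed.

Lemma continuous_locally_integrable h : continuous h -> locally_integrable_on Omega h.
Proof. by move=> ch K cK _; exact: continuous_integrable_compact. Qed.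

Lemma locally_integrable_measurable h : locally_integrable_on Omega h ->
  measurable_fun Omega h.
Proof.
move=> lh; apply: measurable_fun_open_compact => // K cK KO.
by apply/measurable_EFinP; exact: measurable_int (lh K cK KO).
Qed.

Lemma locally_integrable_lin (a : R) h h' : locally_integrable_on Omega h ->
  locally_integrable_on Omega h' -> locally_integrable_on Omega (fun x => a * h x + h' x).
Proof.
move=> lh lh' K cK KO; have mK := compact_rV_measurable cK.
exact: (integrableD mK (integrableZl mK a (lh K cK KO)) (lh' K cK KO)).
Qed.

Lemma integrable_mul_bounded h phi K : compact K -> K `<=` Omega ->
  locally_integrable_on Omega h -> continuous phi -> (forall x, ~ K x -> phi x = 0) ->
  lam.-integrable Omega (EFin \o (fun x => h x * phi x)).
Proof.
move=> cK KO lh cphi phi0; have mK := compact_rV_measurable cK.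
have [M [M0 phiM]] := continuous_bounded_on cphi cK.
apply/(integrable_mkcond _ mOmega); rewrite -EFin_patch.
rewrite (@patch_support _ _ _ K) => // [|x nK]; last by rewrite phi0 ?mulr0.
rewrite EFin_patch; apply/(integrable_mkcond _ mK).
have ih := lh K cK KO; apply: (le_integrable mK _ _ (integrableZl mK M ih)).
  apply/measurable_EFinP; apply: measurable_funM.
    by apply/measurable_EFinP; exact: measurable_int ih.
  by apply: measurable_funTS; exact: continuous_measurable_rV_real.
move=> x Kx; rewrite /= lee_fin !normrM mulrC ler_wpM2r// (ger0_norm M0).
exact: phiM.
Qed.

Lemma integrable_mul_test h phi : locally_integrable_on Omega h ->
  test_function Omega phi -> lam.-integrable Omega (EFin \o (fun x => h x * phi x)).
Proof.
move=> lh tphi; have := test_continuous tphi; case: tphi => _ _ [K [cK KO phi0]] cphi.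
exact: (integrable_mul_bounded cK KO).
Qed.

Lemma integrable_mul_grad h phi i : locally_integrable_on Omega h ->
  test_function Omega phi ->
  lam.-integrable Omega (EFin \o (fun x => h x * grad phi x ord0 i)).
Proof.
move=> lh [dphi cg [K [cK KO phi0]]]; apply: (integrable_mul_bounded cK KO lh).
  exact: coord_comp_continuous.
by move=> x nK; rewrite (grad_support cK phi0 nK) mxE.
Qed.

Lemma weak_gradient_lin (a : R) y v g k : is_wg y g -> is_wg v k ->
  is_wg (fun x => a * y x + v x) (fun x => a *: g x + k x).
Proof.
move=> [ly lg gP] [lv lk kP]; split.
- exact: locally_integrable_lin.
- move=> i; rewrite (_ : (fun x => _) = fun x => a * g x ord0 i + k x ord0 i).
    exact: locally_integrable_lin.
  by apply/funext => x; rewrite !mxE.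
move=> phi tphi i.
have iy := integrable_mul_grad i ly tphi; have iv := integrable_mul_grad i lv tphi.
have ig := integrable_mul_test (lg i) tphi; have ik := integrable_mul_test (lk i) tphi.
transitivity (\int[lam]_(x in Omega) (a * (y x * grad phi x ord0 i) + v x * grad phi x ord0 i)).
  by apply: eq_Rintegral => x _; rewrite mulrDl mulrA.
rewrite RintegralD//; last exact: (integrableZl mOmega a iy).
rewrite RintegralZl// gP// kP// mulrN -opprD; congr (- _).
transitivity (\int[lam]_(x in Omega) (a * (g x ord0 i * phi x) + k x ord0 i * phi x)).
  by rewrite RintegralD// ?RintegralZl//; exact: (integrableZl mOmega a ig).
by apply: eq_Rintegral => x _; rewrite !mxE mulrDl mulrA.
Qed.

(** Makes the Sobolev norm of an almost everywhere zero function vanish, through which [J] is blind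
    to null sets. *)
Lemma weak_gradient_ae0 h : locally_integrable_on Omega h ->
  ae_eq lam Omega h (cst 0) -> is_wg h (fun=> 0).
Proof.
move=> lh h0; split=> //.
  by move=> i; apply: continuous_locally_integrable; rewrite mxE; exact: cst_continuous.
move=> phi tphi i.
have ih := integrable_mul_grad i lh tphi.
rewrite [RHS](_ : _ = 0); last first.
  by rewrite (@eq_Rintegral _ _ _ _ _ (cst 0)) ?Rintegral_cst ?mul0r ?oppr0// => x _; rewrite mxE mul0r.
rewrite /Rintegral (ae_eq_integral (cst 0%E)) ?integral0//.
  exact: measurable_int ih.
by apply: filterS h0 => x h0 Ox; rewrite h0//= mul0r.
Qed.

Lemma weak_gradient_uniq y g k : is_wg y g -> is_wg y k ->
  forall i, ae_eq lam Omega (fun x => g x ord0 i) (fun x => k x ord0 i).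
Proof.
move=> [_ lg gP] [_ lk kP] i.
have lgk : locally_integrable_on Omega (fun x => -1 * k x ord0 i + g x ord0 i).
  exact: locally_integrable_lin.
have := @test_integral_eq0 R n Omega oOmega _ lgk.
move=> H; have {}H : {ae lam, forall x, Omega x -> -1 * k x ord0 i + g x ord0 i = 0}.
  apply: H => phi tphi.
  have ig := integrable_mul_test (lg i) tphi; have ik := integrable_mul_test (lk i) tphi.
  rewrite (@eq_Rintegral _ _ _ _ _ (fun x => g x ord0 i * phi x - k x ord0 i * phi x)); last first.
    by move=> x _; rewrite mulN1r mulrDl mulNr addrC.
  rewrite RintegralB//; apply/eqP; rewrite subr_eq0 -eqr_opp.
  by rewrite -gP// -kP.
by apply: filterS H => x H Ox; have /eqP := H Ox; rewrite mulN1r addrC subr_eq0 => /eqP.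
Qed.

Lemma wgradP y g : is_wg y g -> is_wg y (wgrad Omega y).
Proof. by move=> yg; apply: (@getPex _ [set g | is_wg y g]); exists g. Qed.

(** [wgrad] is a choice, so a known weak gradient may replace it only almost everywhere. *)
Lemma wgradE y g i : is_wg y g ->
  ae_eq lam Omega (fun x => wgrad Omega y x ord0 i) (fun x => g x ord0 i).
Proof. by move=> yg; exact: (weak_gradient_uniq (wgradP yg) yg i). Qed.

Lemma testM phi psi : test_function Omega phi -> test_function Omega psi ->
  test_function Omega (fun x => phi x * psi x).
Proof.
move=> t1 t2; have [df cf] := C1M (test_C1 t1) (test_C1 t2).
split=> //; case: t1 => _ _ [K [cK KO phi0]]; exists K; split=> // x nK.
by rewrite phi0// mul0r.
Qed.

Lemma test_lin (a : R) phi psi : test_function Omega phi -> test_function Omega psi ->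
  test_function Omega (fun x => a * phi x + psi x).
Proof.
move=> t1 t2; have [df cf] := C1D (C1Z a (test_C1 t1)) (test_C1 t2).
split=> //; case: t1 => _ _ [K [cK KO phi0]]; case: t2 => _ _ [K' [cK' KO' psi0]].
exists (K `|` K'); split; first exact: compactU.
  by move=> x [/KO|/KO'].
by move=> x /not_orP[nK nK']; rewrite phi0// psi0// mulr0 addr0.
Qed.

(** The partial derivatives of the compactly supported product [phi * psi] integrate to zero, and
    the product rule turns this into integration by parts. *)
Lemma test_weak_gradient phi : test_function Omega phi -> is_wg phi (grad phi).
Proof.
move=> tphi; have [dphi cg _] := tphi.
have lphi : locally_integrable_on Omega phi.
  by apply: continuous_locally_integrable; exact: test_continuous.
have lg i : locally_integrable_on Omega (fun x => grad phi x ord0 i).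
  by apply: continuous_locally_integrable; exact: coord_comp_continuous.
split=> // psi tpsi i.
have i1 := integrable_mul_grad i lphi tpsi; have i2 := integrable_mul_test (lg i) tpsi.
apply/eqP; rewrite -subr_eq0 opprK -RintegralD//.
rewrite (@eq_Rintegral _ _ _ _ _ (fun x => grad (fun x => phi x * psi x) x ord0 i)); last first.
  move=> x _; rewrite gradM ?mxE; [by rewrite mulrC [psi x * _]mulrC [_ * phi x]mulrC|by case: tphi|by case: tpsi].
have [dt ct [K [cK KO t0]]] := testM tphi tpsi.
rewrite Rintegral_mkcond (@patch_support _ _ _ K)//; last first.
  by move=> x nK; rewrite (grad_support cK t0 nK) mxE.
rewrite -(@patch_support _ _ setT K)//; last first.
  by move=> x nK; rewrite (grad_support cK t0 nK) mxE.
rewrite patch_setT /Rintegral (integral_partial_eq0 _ (conj dt ct) cK t0).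
by [].
Qed.

End weak_gradient.

Section Lp.
Context (R : realType) (n : nat) (Omega : set 'rV[R]_n).
Hypothesis oOmega : open Omega.
Local Notation V := 'rV[R]_n.
Local Notation lam := (lebesgue_rV R n).
Local Notation in_Lp := (in_Lp Omega).
Local Notation Lp_norm := (Lp_norm Omega).
Implicit Types (x : V) (f g h : V -> R) (p : R).

Let mOmega : measurable Omega := open_rV_measurable oOmega.

(** For [p] nonzero, 0 to the power [p] is 0, so the extension by zero contributes nothing outside
    Omega. At [p = 0] that power would be 1. *)
Lemma Lp_normE p h : Lp_norm p h =
  ((\int[lam]_(x in Omega) (`|h x| `^ p)%:E) `^ p^-1)%E \/ p = 0.
Proof.
have [->|p0] := eqVneq p 0; [by right|left].
rewrite /Lp_norm unlock [in RHS]integral_mkcond; congr ((integral _ _ _) `^ _)%E.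
apply/funext => x /=; rewrite /patch; case: ifPn => // _.
by rewrite normr0 powR0.
Qed.

Lemma Lp_norm_ge0 p h : (0 <= Lp_norm p h)%E. Proof. exact: Lnorm_ge0. Qed.

Lemma measurable_patch h : measurable_fun Omega h -> measurable_fun setT (h \_ Omega).
Proof. by move=> mh; apply/(measurable_restrict _ mOmega measurableT); rewrite setTI. Qed.

Lemma measurable_norm_powR p h : measurable_fun Omega h ->
  measurable_fun Omega (fun x => (`|h x| `^ p)%:E).
Proof.
move=> mh; apply/measurable_EFinP.
by apply: (measurableT_comp (measurable_powR p)); exact: measurableT_comp.
Qed.

Lemma Lp_norm_ae p f g : 1 <= p -> measurable_fun Omega f -> measurable_fun Omega g ->
  ae_eq lam Omega f g -> Lp_norm p f = Lp_norm p g.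
Proof.
move=> p1 mf mg fg; have p0 : p != 0 by rewrite gt_eqF// (lt_le_trans ltr01).
have [->|/eqP] := Lp_normE p f; last by rewrite (negbTE p0).
have [->|/eqP] := Lp_normE p g; last by rewrite (negbTE p0).
congr (_ `^ _)%E; apply: ae_eq_integral.
- exact: mOmega.
- exact: measurable_norm_powR.
- exact: measurable_norm_powR.
- by apply: filterS fg => x fg Ox; rewrite fg.
Qed.

Lemma Lp_normD p f g : 1 <= p -> measurable_fun Omega f -> measurable_fun Omega g ->
  (Lp_norm p (fun x => f x + g x)%R <= Lp_norm p f + Lp_norm p g)%E.
Proof.
move=> p1 mf mg; rewrite /Lp_norm.
rewrite (_ : (fun x => f x + g x) \_ Omega = ((f \_ Omega) \+ (g \_ Omega))).
  by apply: minkowski_EFin => //; exact: measurable_patch.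
by apply/funext => x; rewrite /patch/=; case: ifPn; rewrite ?addr0.
Qed.

Lemma Lp_normZ p (a : R) f : 1 <= p -> measurable_fun Omega f ->
  Lp_norm p (fun x => a * f x) = (`|a|%:E * Lp_norm p f)%E.
Proof.
move=> p1 mf; have p0 : p != 0 by rewrite gt_eqF// (lt_le_trans ltr01).
have [->|/eqP] := Lp_normE p (fun x => a * f x); last by rewrite (negbTE p0).
have [->|/eqP] := Lp_normE p f; last by rewrite (negbTE p0).
under eq_integral do rewrite normrM powRM// EFinM.
rewrite ge0_integralZl//.
- rewrite poweRM ?lee_fin ?powR_ge0//; last by apply: integral_ge0 => x _; rewrite lee_fin powR_ge0.
  by rewrite -poweR_EFin/= -powRrM mulfV// powRr1.
- exact: measurable_norm_powR.
Qed.

Lemma in_Lp_lin p (a : R) f g : 1 <= p -> in_Lp p f -> in_Lp p g ->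
  in_Lp p (fun x => a * f x + g x).
Proof.
move=> p1 [mf nf] [mg ng]; have maf : measurable_fun Omega (fun x => a * f x).
  exact: measurable_funM.
split; first exact: measurable_funD.
rewrite (le_lt_trans (Lp_normD p1 maf mg))// lte_add_pinfty//.
by rewrite Lp_normZ// lte_mul_pinfty.
Qed.

Lemma in_Lp_ae p f g : 1 <= p -> measurable_fun Omega g -> ae_eq lam Omega f g ->
  in_Lp p f -> in_Lp p g.
Proof. by move=> p1 mg fg [mf nf]; split=> //; rewrite -(Lp_norm_ae p1 mf mg fg). Qed.

Lemma Lp_mul_integrable p q f g : 0 < p -> 0 < q -> p^-1 + q^-1 = 1 ->
  in_Lp p f -> in_Lp q g -> lam.-integrable Omega (EFin \o (fun x => f x * g x)).
Proof.
move=> p0 q0 pq [mf nf] [mg ng].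
have mfg : measurable_fun Omega (fun x => f x * g x) by exact: measurable_funM.
have := hoelder lam (measurable_patch mf) (measurable_patch mg) p0 q0 pq.
rewrite Lnorm1 => H; apply/integrableP; split; first exact/measurable_EFinP.
have fp : Lp_norm p f \is a fin_num by rewrite ge0_fin_numE// Lp_norm_ge0.
rewrite integral_mkcond; apply: le_lt_trans (lte_mul_pinfty (Lp_norm_ge0 _ _) fp ng).
apply: le_trans H; rewrite le_eqVlt; apply/orP; left; apply/eqP.
apply: eq_integral => x _; rewrite /patch/=; case: ifPn => // _.
by rewrite mul0r normr0.
Qed.

Lemma compact_support_in_Lp p f K : 1 <= p -> compact K -> K `<=` Omega ->
  continuous f -> (forall x, ~ K x -> f x = 0) -> in_Lp p f.
Proof.
move=> p1 cK KO cf f0; have p0 : 0 < p by rewrite (lt_le_trans ltr01).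
have mf : measurable_fun Omega f by apply: measurable_funTS; exact: continuous_measurable_rV_real.
split=> //; have [->|/eqP] := Lp_normE p f; last by rewrite gt_eqF.
rewrite poweR_lty//; have [M [M0 fM]] := continuous_bounded_on cf cK.
have mK := compact_rV_measurable cK.
apply: (@le_lt_trans _ _ (\int[lam]_(x in Omega) ((M `^ p)%:E * (\1_K x)%:E))%E).
  apply: ge0_le_integral => //.
  - exact: measurable_norm_powR.
  - by apply/measurable_EFinP; apply: measurable_funM => //; exact: measurable_indic.
  - move=> x _; rewrite -EFinM lee_fin indicE; have [Kx|nK] := pselect (K x).
      by rewrite mem_set// mulr1 ge0_ler_powR ?nnegrE ?(ltW p0)//; exact: fM.
    by rewrite f0// normr0 powR0 ?gt_eqF// mulr_ge0 ?powR_ge0.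
rewrite ge0_integralZl//; last 2 first.
- by apply/measurable_EFinP; exact: measurable_indic.
- by rewrite lee_fin powR_ge0.
rewrite integral_indic// lte_mul_pinfty ?lee_fin ?powR_ge0//.
apply: le_lt_trans (compact_rV_finite cK); apply: le_measure; rewrite ?inE//.
exact: measurableI.
Qed.

End Lp.

(** * Sobolev spaces *)

Section sobolev_theory.
Context (R : realType) (n : nat) (Omega : set 'rV[R]_n).
Hypothesis oOmega : open Omega.
Local Notation V := 'rV[R]_n.
Local Notation lam := (lebesgue_rV R n).
Local Notation W1p := (W1p Omega).
Local Notation W1p0 := (W1p0 Omega).
Local Notation W1p_norm := (W1p_norm Omega).
Local Notation wgrad := (wgrad Omega).
Local Notation is_wg := (is_weak_gradient Omega).
Implicit Types (x : V) (y v h phi : V -> R) (g k : V -> V) (p : R).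

Let mOmega : measurable Omega := open_rV_measurable oOmega.

Lemma weak_gradient_measurable y g i : is_wg y g ->
  measurable_fun Omega (fun x => g x ord0 i).
Proof. by move=> [_ lg _]; exact: locally_integrable_measurable. Qed.

(** [W1p] provides some weak gradient with p-integrable coordinates; uniqueness carries the
    integrability over to the chosen one. *)
Lemma W1p_wgrad p y : 1 <= p -> W1p p y ->
  is_wg y (wgrad y) /\ forall i, in_Lp Omega p (fun x => wgrad y x ord0 i).
Proof.
move=> p1 [_ [g yg gp]]; have wg := wgradP yg; split=> // i.
apply: (in_Lp_ae oOmega p1 _ _ (gp i)); first exact: weak_gradient_measurable wg.
exact: (weak_gradient_uniq oOmega yg wg).
Qed.

Lemma W1p_lin p (a : R) y v : 1 <= p -> W1p p y -> W1p p v ->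
  W1p p (fun x => a * y x + v x).
Proof.
move=> p1 Wy Wv; have [yg gp] := W1p_wgrad p1 Wy; have [vk kp] := W1p_wgrad p1 Wv.
split; first by apply: in_Lp_lin => //; [case: Wy|case: Wv].
exists (fun x => a *: wgrad y x + wgrad v x); first exact: weak_gradient_lin.
move=> i; rewrite (_ : (fun x => _) = fun x => a * wgrad y x ord0 i + wgrad v x ord0 i).
  exact: in_Lp_lin.
by apply/funext => x; rewrite !mxE.
Qed.

Lemma W1p_norm_ge0 p y : (0 <= W1p_norm p y)%E.
Proof. by rewrite adde_ge0 ?Lp_norm_ge0// sume_ge0// => i _; exact: Lp_norm_ge0. Qed.

Lemma W1p_norm_lty p y : 1 <= p -> W1p p y -> (W1p_norm p y < +oo)%E.
Proof.
move=> p1 Wy; have [_ gp] := W1p_wgrad p1 Wy.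
apply: lte_add_pinfty; first by case: Wy => -[].
by apply: lte_sum_pinfty => i _; case: (gp i).
Qed.

Lemma wgrad_lin p (a : R) y v i : 1 <= p -> W1p p y -> W1p p v ->
  ae_eq lam Omega (fun x => wgrad (fun x => a * y x + v x) x ord0 i)
    (fun x => a * wgrad y x ord0 i + wgrad v x ord0 i).
Proof.
move=> p1 Wy Wv; have [yg _] := W1p_wgrad p1 Wy; have [vk _] := W1p_wgrad p1 Wv.
have := wgradE oOmega i (weak_gradient_lin oOmega a yg vk).
by apply: filterS => x H Ox; rewrite H// !mxE.
Qed.

Lemma W1p_norm_lin p (a : R) y v : 1 <= p -> W1p p y -> W1p p v ->
  (W1p_norm p (fun x => a * y x + v x)%R <= `|a|%:E * W1p_norm p y + W1p_norm p v)%E.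
Proof.
move=> p1 Wy Wv; have [yg gp] := W1p_wgrad p1 Wy; have [vk kp] := W1p_wgrad p1 Wv.
have H (f h : V -> R) : measurable_fun Omega f -> measurable_fun Omega h ->
    (Lp_norm Omega p (fun x => a * f x + h x)%R <=
     `|a|%:E * Lp_norm Omega p f + Lp_norm Omega p h)%E.
  move=> mf mh; rewrite -(Lp_normZ oOmega a p1 mf); apply: Lp_normD => //.
  exact: measurable_funM.
rewrite /W1p_norm muleDr//; last first.
  by rewrite ge0_adde_def// inE ?Lp_norm_ge0// sume_ge0// => i _; exact: Lp_norm_ge0.
rewrite addeACA leeD//.
  by apply: H; [case: Wy => -[]|case: Wv => -[]].
rewrite ge0_sume_distrr; last by move=> i _; exact: Lp_norm_ge0.
rewrite -big_split/=; apply: lee_sum => i _.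
have my := weak_gradient_measurable i yg; have mv := weak_gradient_measurable i vk.
apply: le_trans (H _ _ my mv); rewrite le_eqVlt; apply/orP; left; apply/eqP.
apply: Lp_norm_ae => //.
- exact: weak_gradient_measurable (wgradP (weak_gradient_lin oOmega a yg vk)).
- by apply: measurable_funD => //; exact: measurable_funM.
- exact: wgrad_lin Wy Wv.
Qed.

Lemma W1p_norm_ae0 p h : 1 <= p -> W1p p h -> ae_eq lam Omega h (cst 0) ->
  W1p_norm p h = 0%E.
Proof.
move=> p1 Wh h0; have [hg _] := W1p_wgrad p1 Wh.
have lh : locally_integrable_on Omega h by case: hg.
have H (f : V -> R) : measurable_fun Omega f -> ae_eq lam Omega f (cst 0) -> Lp_norm Omega p f = 0%E.
  move=> mf f0; rewrite (Lp_norm_ae oOmega p1 mf _ f0)//.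
  rewrite /Lp_norm (_ : (cst 0) \_ Omega = cst 0).
    by rewrite (_ : EFin \o cst 0 = cst 0%E)// Lnorm0// eqe gt_eqF// (lt_le_trans ltr01).
  by apply/funext => x; rewrite /patch; case: ifP.
rewrite /W1p_norm H ?add0e//; last by case: Wh => -[].
rewrite big1// => i _; apply: H; first exact: weak_gradient_measurable hg.
have := wgradE oOmega i (weak_gradient_ae0 oOmega lh h0).
by apply: filterS => x H Ox; rewrite H// mxE.
Qed.

Lemma test_W1p p phi : 1 <= p -> test_function Omega phi -> W1p p phi.
Proof.
move=> p1 tphi; have cphi := test_continuous tphi.
have [dphi cg [K [cK KO phi0]]] := tphi.
split; first exact: compact_support_in_Lp cK KO cphi phi0.
exists (grad phi); first exact: test_weak_gradient.
move=> i; apply: (compact_support_in_Lp oOmega p1 cK KO).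
  exact: coord_comp_continuous.
by move=> x nK; rewrite (grad_support cK phi0 nK) mxE.
Qed.

Lemma subfE y v : y \- v = (fun x => -1 * v x + y x).
Proof. by apply/funext => x; rewrite /= mulN1r addrC. Qed.

Lemma W1p_sub p y v : 1 <= p -> W1p p y -> W1p p v -> W1p p (y \- v).
Proof. by move=> p1 Wy Wv; rewrite subfE; exact: W1p_lin. Qed.

Lemma W1p0_W1p p y : W1p0 p y -> W1p p y. Proof. by case. Qed.

Lemma W1p0_lin p (a : R) y v : 1 <= p -> W1p0 p y -> W1p0 p v ->
  W1p0 p (fun x => a * y x + v x).
Proof.
move=> p1 [Wy [phi tphi cphi]] [Wv [psi tpsi cpsi]].
split; first exact: W1p_lin.
exists (fun (k : nat) x => a * phi k x + psi k x); first by move=> k; exact: test_lin.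
have c0 : (`|a|%:E * W1p_norm p (y \- phi k)%R + W1p_norm p (v \- psi k)%R)%E
    @[k --> \oo] --> 0%E.
  rewrite -[X in _ --> X](adde0 0%E) -{1}(mule0 `|a|%:E).
  apply: cvgeD; [exact: fin_num_adde_defl| |exact: cpsi].
  by apply: cvgeZl; [|exact: cphi].
apply: (squeeze_cvge _ (cvg_cst 0%E) c0); apply: nearW => k.
rewrite W1p_norm_ge0/=.
have -> : (fun x => a * y x + v x) \- (fun x => a * phi k x + psi k x) =
    fun x => a * (y \- phi k) x + (v \- psi k) x.
  by apply/funext => x /=; ring.
by apply: W1p_norm_lin => //; apply: W1p_sub => //; exact: test_W1p.
Qed.

Section pairing.
Variables (p q : R).
Hypotheses (p1 : 1 < p) (q1 : 1 < q) (pq : p^-1 + q^-1 = 1).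

(** The Dirichlet form; the conjugate exponents make it finite on W^{1,p} times W^{1,q}. *)
Definition pairing y v : R := \int[lam]_(x in Omega) edot (wgrad y x) (wgrad v x).

Lemma pairing_integrable y v : W1p p y -> W1p q v ->
  lam.-integrable Omega (EFin \o (fun x => edot (wgrad y x) (wgrad v x))).
Proof.
move=> Wy Wv; have [_ gp] := W1p_wgrad (ltW p1) Wy; have [_ kp] := W1p_wgrad (ltW q1) Wv.
rewrite (_ : EFin \o _ = fun x => (\sum_(i < n) (wgrad y x ord0 i * wgrad v x ord0 i)%:E)%E).
  apply: integrable_sum => // i _; apply: (Lp_mul_integrable oOmega _ _ pq (gp i) (kp i)).
    exact: lt_trans p1.
  exact: lt_trans q1.
by apply/funext => x; rewrite /= sumEFin.
Qed.

Lemma pairing_linl (a : R) y z v : W1p p y -> W1p p z -> W1p q v ->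
  pairing (fun x => a * y x + z x) v = a * pairing y v + pairing z v.
Proof.
move=> Wy Wz Wv.
have iy := pairing_integrable Wy Wv; have iz := pairing_integrable Wz Wv.
have iyz := pairing_integrable (W1p_lin a (ltW p1) Wy Wz) Wv.
rewrite /pairing -RintegralZl// -RintegralD//; last exact: (integrableZl mOmega a iy).
rewrite /Rintegral; congr fine.
apply: ae_eq_integral => //; first exact: measurable_int iyz.
  exact: measurable_int (integrableD mOmega (integrableZl mOmega a iy) iz).
have : {ae lam, forall x i, Omega x -> wgrad (fun x => a * y x + z x) x ord0 i =
    a * wgrad y x ord0 i + wgrad z x ord0 i}.
  by apply: filter_forall => i; exact: wgrad_lin (ltW p1) Wy Wz.
apply: filterS => x H Ox; congr (_%:E).
rewrite /edot mulr_sumr -big_split/=; apply: eq_bigr => i _.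
by rewrite H// mulrDl mulrA.
Qed.

End pairing.
End sobolev_theory.

(** * Morrey's inequality *)

Section morrey.
Context (R : realType) (n : nat).
Local Notation V := 'rV[R]_n.
Local Notation lam := (lebesgue_rV R n).
Local Notation leb := (@lebesgue_measure R).
Implicit Types (x z c : V) (g phi : V -> R) (r : R).

Lemma continuous_measurable_prod (f : R * V -> R) :
  continuous f -> measurable_fun setT f.
Proof.
move=> cf; apply: (measurability _ (RGenOpens.measurableE R)).
move=> _ [_ [a [b ->]] <-]; rewrite setTI; apply: open_prod_measurable.
by move/continuousP: cf; apply; exact: interval_open.
Qed.

(** Hoelder's inequality against the indicator of the ball: the first constant is the s-norm of that
    indicator, the ball having volume [2 ^+ n]. The second is the scaling of the r-norm under z -> x
    + t z, and it blows up as t tends to 0. *)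
Lemma hoelder_ball g x c (t r s : R) : continuous g -> 0 < t ->
  1 < r -> 0 < s -> r^-1 + s^-1 = 1 ->
  (\int[lam]_(z in ball c 1) (`|g (x + t *: z)%R|)%:E <=
   ((2 ^+ n) `^ s^-1)%:E * (((t ^+ n) `^ (- r^-1))%:E * Lnorm lam r%:E (EFin \o g)))%E.
Proof.
move=> cg t0 r1 s0 rs; have r0 : 0 < r by exact: lt_trans r1.
have mb : measurable (ball c 1 : set V) by apply: open_rV_measurable; exact: ball_open.
have mg := continuous_measurable_rV_real cg.
have mgt : measurable_fun setT (fun z : V => g (x + t *: z)).
  apply: continuous_measurable_rV_real => z.
  apply: (@continuous_comp _ _ _ (fun z : V => x + t *: z) g); last exact: cg.
  exact: continuous_affine_rV.
have m1 : measurable_fun setT (\1_(ball c 1) : V -> R) by exact: measurable_indic.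
have tn0 : 0 < t ^+ n by exact: exprn_gt0.
have H := hoelder lam mgt m1 r0 s0 rs.
have <- : (Lnorm lam 1 (EFin \o ((fun z : V => g (x + t *: z)) \* \1_(ball c 1))%R) =
    \int[lam]_(z in ball c 1) (`|g (x + t *: z)%R|)%:E)%E.
  rewrite Lnorm1 [RHS]integral_mkcond; apply: eq_integral => z _.
  rewrite /patch/= indicE; case: ifPn => zb; first by rewrite mulr1.
  by rewrite mulr0 normr0.
apply: (le_trans H); rewrite muleC le_eqVlt; apply/orP; left; apply/eqP.
have Ns : Lnorm lam s%:E (EFin \o (\1_(ball c 1) : V -> R)) = ((2 ^+ n) `^ s^-1)%:E.
  rewrite unlock (_ : (fun x => _) = (fun z : V => (\1_(ball c 1) z)%:E)).
    rewrite -poweR_EFin; congr (_ `^ _)%E; rewrite integral_indic// setIT.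
    exact: lebesgue_rV_ball.
  apply/funext => z; rewrite /= indicE; case: (_ \in _) => /=.
    by rewrite normr1 powR1.
  by rewrite normr0 powR0// gt_eqF.
rewrite Ns; congr (_ * _)%E.
have mgr : measurable_fun setT (fun z : V => (`|g z| `^ r)%:E).
  apply/measurable_EFinP; apply: (measurableT_comp (measurable_powR r)).
  exact: measurableT_comp.
have gr0 z : (0 <= (`|g z| `^ r)%:E)%E by rewrite lee_fin powR_ge0.
have A := ge0_integral_affine x t0 mgr gr0.
rewrite unlock /=; rewrite -A poweRM ?lee_fin ?(ltW tn0)//; last first.
  by apply: integral_ge0 => z _; rewrite lee_fin powR_ge0.
rewrite poweR_EFin muleA -EFinM -powRD; last by apply/implyP => _; rewrite gt_eqF.
by rewrite addNr powRr0 mul1e.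
Qed.

(** The left side is a power of s with exponent k - 1 - k n a, which the last hypothesis makes
    nonnegative. With a = 1 / r such a k exists because n < r. *)
Lemma power_exchange (k : nat) (s a : R) : (1 < k)%N -> 0 < s <= 1 -> 0 < a ->
  1 <= k%:R * (1 - n%:R * a) ->
  s ^+ k.-1 * ((s ^+ k) ^+ n) `^ (- a) <= 1.
Proof.
move=> k1 /andP[s0 s1] a0 ka.
have k0 : (0 < k)%N by exact: ltn_trans k1.
rewrite -exprM -!powR_mulrn ?(ltW s0)// -powRrM -powRD; last by apply/implyP => _; rewrite gt_eqF.
rewrite [leRHS](_ : 1 = s `^ 0); last by rewrite powRr0.
apply: ger_powR; first by rewrite s0.
rewrite -subn1 natrB// natrM; nra.
Qed.

Variables (Omega : set V) (B : R).
Hypotheses (oOmega : open Omega) (n0 : (0 < n)%N) (B0 : 0 < B)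
  (OB : forall x, Omega x -> `|x| <= B).

Let mOmega : measurable Omega := open_rV_measurable oOmega.

(** The coordinates of a point z of the unit ball around [c] lie between 2 B + 1 and [D]. If x and x
    + z were both in Omega, then |z| <= 2 B: translation by z pushes every point of Omega out of
    Omega. *)
Let c : V := const_mx (2 * B + 2).
Let D : R := 2 * B + 3.

Let ball_coord z i : ball c 1 z -> 2 * B + 1 < z ord0 i < D.
Proof.
by move=> [_ /(_ ord0 i)]; rewrite !mxE /ball/= ltr_norml /D => /andP[h1 h2]; lra.
Qed.

Let ball_out x z : Omega x -> ball c 1 z -> ~ Omega (x + z).
Proof.
move=> Ox zb Oxz; have /andP[h1 _] := ball_coord (Ordinal n0) zb.
have := norm_rV_le z (ltW (addr_gt0 B0 B0)).
have : `|z| <= B + B.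
  rewrite -(addrK x z) [z + x]addrC (le_trans (ler_normB _ _))// lerD//; exact: OB.
move=> zB [/(_ zB (Ordinal n0)) h _]; move: h1; rewrite ltNge => /negP; apply.
by rewrite (le_trans (ler_norm _))// (le_trans h)//; lra.
Qed.

Lemma continuous_path_integrand (k : nat) x g : continuous g ->
  continuous (fun p : R * V => p.1 ^+ k.-1 * `|g (x + p.1 ^+ k *: p.2)|).
Proof.
move=> cg; have cX m : continuous (fun p : R * V => p.1 ^+ m).
  elim: m => [|m IH] p; first exact: cst_continuous.
  rewrite (_ : (fun p : R * V => p.1 ^+ m.+1) = (fun p => p.1 * p.1 ^+ m)); last first.
    by apply/funext => q; rewrite exprS.
  by apply: (cvgM (@cvg_fst _ _ (nbhs p.1) (nbhs p.2) _) (IH p)).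
move=> p; apply: (cvgM (cX k.-1 p)); apply: cvg_norm.
apply: (@continuous_comp _ _ _ (fun p : R * V => x + p.1 ^+ k *: p.2) g); last exact: cg.
by apply: (cvgD (cvg_cst x) (cvgZ (cX k p) (@cvg_snd _ _ (nbhs p.1) (nbhs p.2) _))).
Qed.

(* As x + z lies outside Omega, phi x is minus the integral over s of the
   derivative of s |-> phi (x + s^k z); for k large the factor k s^(k-1) beats
   the singularity of hoelder_ball at s = 0 when averaging over z. *)
Lemma path_bound (k : nat) phi x z : (0 < k)%N -> test_function Omega phi -> Omega x ->
  ball c 1 z ->
  (`|phi x|%:E <= \int[leb]_(s in `[0%R, 1%R])
    (k%:R * D * \sum_i s ^+ k.-1 * `|grad phi (x + s ^+ k *: z) ord0 i|)%:E)%E.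
Proof.
move=> k0 tphi Ox zb; have [dphi cg [K [cK KO phi0]]] := tphi.
have D0 : 0 < D by rewrite /D addr_gt0// mulr_gt0.
pose F (s : R) := phi (x + s ^+ k *: z).
pose f (s : R) := edot (grad phi (x + s ^+ k *: z)) z * (k%:R * s ^+ k.-1).
have dF (s : R) : is_derive s 1 F (f s).
  have H1 := is_derive_line (x := x) (v := z) (t := s ^+ k) (dphi _).
  have H2 : is_derive s 1 (fun s : R => s ^+ k) (k%:R * s ^+ k.-1).
    apply: DeriveDef; first exact: exprn_derivable.
    by rewrite exp_derive -[LHS]/(_ * 1) mulr1.
  exact: (@is_derive1_comp _ (fun t : R => phi (x + t *: z)) (fun s : R => s ^+ k) s _ _ H1 H2).
have cX m : continuous (fun s : R => s ^+ m) by move=> s; exact: exprn_continuous.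
have cpath : continuous (fun s : R => x + s ^+ k *: z).
  by move=> s; apply: (cvgD (cvg_cst x) (cvgZ (cX k s) (cvg_cst z))).
have cgi i : continuous (fun s : R => grad phi (x + s ^+ k *: z) ord0 i).
  move=> s; apply: (@continuous_comp _ _ _ (fun s : R => x + s ^+ k *: z)
    (fun y : V => grad phi y ord0 i)); first exact: cpath.
  exact: coord_comp_continuous.
have cedot : continuous (fun s : R => edot (grad phi (x + s ^+ k *: z)) z).
  move=> s; apply: (cvg_big add_continuous) => i _.
  by apply: (cvgM (cgi i s) (cvg_cst _)).
have cf : continuous f.
  by move=> s; apply: (cvgM (cedot s) (cvgM (cvg_cst _) (cX _ s))).
have cF : continuous F.
  move=> s; apply: differentiable_continuous; apply/derivable1_diffP.
  by have [] := dF s.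
have FTC : (\int[leb]_(s in `[0%R, 1%R]) (f s)%:E = (F 1)%:E - (F 0)%:E)%E.
  apply: continuous_FTC2 => //.
  - exact: continuous_subspaceT.
  - split; first by move=> s _; have [] := dF s.
    + exact/cvg_at_right_filter/cF.
    + exact/cvg_at_left_filter/cF.
  - by move=> s _; rewrite derive1E; have [_ ->] := dF s.
have F1 : F 1 = 0.
  rewrite /F expr1n scale1r phi0// => /KO.
  exact: ball_out.
have F0 : F 0 = phi x by rewrite /F expr0n gtn_eqF// scale0r addr0.
rewrite F1 F0 sub0e -EFinN in FTC.
have mleb m (h : R -> R) : measurable (m : set R) -> continuous h ->
    measurable_fun m (fun s : R => (h s)%:E).
  by move=> mm ch; apply/measurable_EFinP; apply: measurable_funTS; exact: continuous_measurable_fun.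
rewrite -normrN -abse_EFin -FTC.
apply: (le_trans (le_abse_integral leb _ _)) => //; first exact: mleb.
apply: ge0_le_integral => //.
- by apply: measurableT_comp => //; exact: mleb.
- apply/measurable_EFinP; apply: measurable_funM => //; apply: measurable_sum => i.
  apply: measurable_funTS; apply: continuous_measurable_fun => s.
  by apply: (cvgM (cX _ s) (cvg_norm (cgi i s))).
move=> s /=; rewrite in_itv/= => /andP[s0 s1].
have sk0 : 0 <= k%:R * s ^+ k.-1 by rewrite mulr_ge0// exprn_ge0.
rewrite lee_fin /f normrM (ger0_norm sk0).
have -> : k%:R * D * \sum_i s ^+ k.-1 * `|grad phi (x + s ^+ k *: z) ord0 i| =
    (\sum_i `|grad phi (x + s ^+ k *: z) ord0 i| * D) * (k%:R * s ^+ k.-1).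
  by rewrite -mulr_sumr -mulr_suml; ring.
apply: ler_wpM2r => //; apply: (le_trans (ler_norm_sum _ _ _)); apply: ler_sum => i _.
rewrite normrM ler_wpM2l// ger0_norm.
  by have /andP[_ /ltW] := ball_coord i zb.
by have /andP[/ltW h _] := ball_coord i zb; apply: le_trans h; rewrite addr_ge0// mulr_ge0// ltW.
Qed.

(** [path_bound] is integrated over z in a unit ball, whose volume is [2 ^+ n]. After exchanging the
    two integrals, [hoelder_ball] with t = s^k applies for each s; [power_exchange] absorbs its
    singularity into the factor s^(k-1). *)
Lemma test_sup_bound r : n%:R < r -> exists2 C : R, 0 <= C &
  forall phi, test_function Omega phi -> forall x,
    (`|phi x|%:E <= C%:E * \sum_(i < n) Lp_norm Omega r (fun y => grad phi y ord0 i))%E.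
Proof.
move=> nr; have n1 : 1 <= n%:R :> R by rewrite ler1n.
have r1 : 1 < r by exact: le_lt_trans nr.
have r0 : 0 < r by exact: lt_trans r1.
have nr1 : n%:R / r < 1 by rewrite ltr_pdivrMr// mul1r.
pose s : R := (1 - r^-1)^-1.
have s0 : 0 < s by rewrite invr_gt0 subr_gt0 invf_lt1.
have rs : r^-1 + s^-1 = 1 by rewrite invrK addrC subrK.
(* Any integer above 1 / (1 - n / r) satisfies the inequality; the shift by two also forces 1 <
   k. *)
have [k k1 kr] : exists2 k : nat, (1 < k)%N & 1 <= k%:R * (1 - n%:R * r^-1).
  have e0 : 0 < 1 - n%:R * r^-1 by rewrite subr_gt0.
  exists (Num.truncn (1 - n%:R * r^-1)^-1).+2 => //.
  rewrite -ler_pdivrMr// mul1r; apply/ltW; apply: (lt_le_trans (truncnS_gt _)).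
  by rewrite ler_nat.
have k0 : (0 < k)%N by exact: ltn_trans k1.
have D0 : 0 < D by rewrite /D addr_gt0// mulr_gt0.
pose kap : R := (2 ^+ n) `^ s^-1.
exists ((2 ^+ n)^-1 * (k%:R * D * kap)).
  by rewrite !mulr_ge0// ?invr_ge0 ?exprn_ge0// ?powR_ge0// ltW.
move=> phi tphi x; have [dphi cg [K [cK KO phi0]]] := tphi.
have sumN0 : (0 <= \sum_(i < n) Lp_norm Omega r (fun y => grad phi y ord0 i))%E.
  by apply: sume_ge0 => i _; exact: Lp_norm_ge0.
have [Ox|nO] := pselect (Omega x); last first.
  rewrite phi0 ?normr0; last by move=> /KO.
  rewrite mule_ge0// lee_fin.
  by rewrite !mulr_ge0// ?invr_ge0 ?exprn_ge0// ?powR_ge0// ltW.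
have cgi i : continuous (fun x => grad phi x ord0 i) by exact: coord_comp_continuous.
have NE i : Lnorm lam r%:E (EFin \o (fun y => grad phi y ord0 i)) =
    Lp_norm Omega r (fun y => grad phi y ord0 i).
  have gr0 y : ~ K y -> grad phi y ord0 i = 0.
    by move=> nK; rewrite (grad_support cK phi0 nK) mxE.
  by rewrite /Lp_norm (patch_support KO gr0) -(patch_support (@subsetT _ _) gr0) patch_setT.
pose Q := ball c 1 : set V.
have mQ : measurable Q by apply: open_rV_measurable; exact: ball_open.
have lamQ : lam Q = (2 ^+ n)%:E by exact: lebesgue_rV_ball.
pose g i (p : R * V) := p.1 ^+ k.-1 * `|grad phi (x + p.1 ^+ k *: p.2) ord0 i|.
pose G (p : R * V) := \sum_i g i p.
have mG : measurable_fun setT G.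
  apply: measurable_sum => i; apply: continuous_measurable_prod.
  exact: (@continuous_path_integrand k x _ (cgi i)).
pose I01 := `[0%R, 1%R]%classic : set R.
(* Extension by zero to the whole product space, where Tonelli's theorem is applied. *)
pose f := (EFin \o G) \_ (I01 `*` Q).
have mI01 : measurable I01 by exact: measurable_itv.
have mIQ : measurable (I01 `*` Q) by exact: measurableX.
have mf : measurable_fun setT f.
  apply/(measurable_restrict _ mIQ measurableT); rewrite setTI.
  by apply: measurable_funTS; exact/measurable_EFinP.
have G0 p : I01 p.1 -> 0 <= G p.
  rewrite /I01/= in_itv/= => /andP[p0 _]; apply: sumr_ge0 => i _.
  by rewrite mulr_ge0// exprn_ge0.
have f0 p : (0 <= f p)%E.
  by rewrite /f /patch; case: ifPn => //; rewrite inE => -[/G0]; rewrite lee_fin.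
have kD0 : 0 <= k%:R * D by rewrite mulr_ge0// ltW.
have mGz z : measurable_fun I01 (fun s : R => (G (s, z))%:E).
  by apply/measurable_EFinP; apply: measurable_funTS; exact: measurableT_comp mG _.
have mGs t : measurable_fun Q (fun z : V => (G (t, z))%:E).
  by apply/measurable_EFinP; apply: measurable_funTS; exact: measurableT_comp mG _.
have fz z : (\int[leb]_t f (t, z) = (\int[leb]_(t in I01) (G (t, z))%:E) * (\1_Q z)%:E)%E.
  rewrite [in RHS]integral_mkcond indicE; case: (boolP (z \in Q)) => zQ.
    rewrite mule1; apply: eq_integral => t _; rewrite /f /patch in_setX/= zQ andbT.
    by case: ifP.
  rewrite mule0; apply: integral0_eq => t _.
  by rewrite /f /patch in_setX/= (negbTE zQ) andbF.
have ft t : (\int[lam]_z f (t, z) = (\int[lam]_(z in Q) (G (t, z))%:E) * (\1_I01 t)%:E)%E.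
  rewrite [in RHS]integral_mkcond indicE; case: (boolP (t \in I01)) => tI.
    rewrite mule1; apply: eq_integral => z _; rewrite /f /patch in_setX/= tI/=.
    by case: ifP.
  rewrite mule0; apply: integral0_eq => z _.
  by rewrite /f /patch in_setX/= (negbTE tI).
pose S := (\sum_(i < n) Lp_norm Omega r (fun y => grad phi y ord0 i))%E.
have slice t : I01 t -> (\int[lam]_(z in Q) (G (t, z))%:E <= kap%:E * S)%E.
  rewrite /I01/= in_itv/= => /andP[t0 t1].
  have S0 : (0 <= kap%:E * S)%E by rewrite mule_ge0// lee_fin powR_ge0.
  (* The change of variables is degenerate at t = 0, but there the integrand vanishes since k >
     1. *)
  have [t00|tn0] := eqVneq t 0.
    rewrite integral0_eq// => z _; rewrite /G big1// => i _.
    by rewrite /g/= t00 expr0n -subn1 subn_eq0 leqNgt k1 mul0r.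
  have tp : 0 < t by rewrite lt_neqAle eq_sym tn0.
  have tk0 : 0 < t ^+ k by rewrite exprn_gt0.
  have mni i : measurable_fun Q (fun z : V => `|grad phi (x + t ^+ k *: z) ord0 i|).
    have cc : continuous (fun z : V => grad phi (x + t ^+ k *: z) ord0 i).
      move=> z; apply: (@continuous_comp _ _ _ (fun z : V => x + t ^+ k *: z)
        (fun y : V => grad phi y ord0 i)); last exact: cgi.
      exact: continuous_affine_rV.
    apply: measurable_funTS; apply: continuous_measurable_rV_real => z.
    exact: (cvg_norm (cc z)).
  under eq_integral do rewrite -sumEFin.
  rewrite ge0_integral_sum//; last 2 first.
  - by move=> i; apply/measurable_EFinP; exact: (measurable_funM (measurable_cst (t ^+ k.-1)) (mni i)).
  - by move=> i z _; rewrite lee_fin mulr_ge0// exprn_ge0.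
  rewrite ge0_sume_distrr; last by move=> i _; exact: Lp_norm_ge0.
  apply: lee_sum => i _.
  rewrite (_ : integral _ _ _ = \int[lam]_(z in Q)
    ((t ^+ k.-1)%:E * (`|grad phi (x + t ^+ k *: z)%R ord0 i|)%:E))%E; last first.
    by apply: eq_integral => z _; rewrite -EFinM.
  rewrite ge0_integralZl//; last 2 first.
  - by apply/measurable_EFinP.
  - by rewrite lee_fin exprn_ge0.
  have H := hoelder_ball x c (cgi i) tk0 r1 s0 rs.
  apply: (le_trans (lee_wpmul2l _ H)); first by rewrite lee_fin exprn_ge0.
  rewrite NE -/kap muleCA lee_wpmul2l ?lee_fin ?powR_ge0// muleA -EFinM.
  rewrite -[leRHS]mul1e lee_wpmul2r ?Lp_norm_ge0// lee_fin.
  apply: power_exchange => //; first by rewrite tp.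
  by rewrite invr_gt0.
have key : (`|phi x|%:E * (2 ^+ n)%:E <= (k%:R * D)%:E * (kap%:E * S))%E.
  apply: (@le_trans _ _ (\int[lam]_z ((k%:R * D)%:E * \int[leb]_t f (t, z)))%E).
    rewrite -lamQ -integral_cst//.
    rewrite integral_mkcond; apply: ge0_le_integral => //.
    + by move=> z _; rewrite /patch; case: ifP => //= _; rewrite lee_fin.
    + by apply/(measurable_restrict _ mQ measurableT); exact: measurable_cst.
    + apply: measurable_funeM; exact: measurable_fun_fubini_tonelli_G.
    move=> z _; rewrite fz /patch indicE; case: ifPn => zQ; last by rewrite !mule0.
    rewrite mule1; have := path_bound k0 tphi Ox (set_mem zQ).
    move=> /le_trans; apply; rewrite le_eqVlt; apply/orP; left; apply/eqP.
    under eq_integral do rewrite EFinM.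
    rewrite ge0_integralZl//; first exact: mGz.
    by move=> t It; rewrite lee_fin; exact: (G0 (t, z)).
  rewrite ge0_integralZl//; last 2 first.
  - exact: measurable_fun_fubini_tonelli_G.
  - by move=> z _; apply: integral_ge0 => t _.
  rewrite lee_wpmul2l ?lee_fin//.
  have -> : (\int[lam]_z \int[leb]_t f (t, z) = \int[leb]_t \int[lam]_z f (t, z))%E.
    by apply/esym; exact: (@fubini_tonelli _ _ _ _ _ leb lam f mf f0).
  apply: (@le_trans _ _ (\int[leb]_(t in I01) (kap%:E * S))%E).
    rewrite [leRHS]integral_mkcond; apply: ge0_le_integral => //.
    + by move=> t _; apply: integral_ge0 => z _.
    + exact: measurable_fun_fubini_tonelli_F.
    + apply/(measurable_restrict _ _ measurableT) => //.
    move=> t _; rewrite ft /patch indicE; case: ifPn => tI; last by rewrite mule0.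
    by rewrite mule1 slice//; exact: set_mem.
  have I1 : lebesgue_measure (`[0%R, 1%R]%classic : set R) = 1%E.
    by rewrite lebesgue_measure_itv/= lte_fin ltr01 -EFinB subr0.
  by rewrite integral_cst// [X in (_ * X)%E](_ : _ = 1%E) ?mule1.
have e0 : 0 < 2 ^+ n :> R by rewrite exprn_gt0.
have i0 : (0 <= ((2 ^+ n)^-1 : R)%:E)%E by rewrite lee_fin invr_ge0 ltW.
have := lee_wpmul2l i0 key; rewrite muleCA -EFinM mulVf ?gt_eqF// mulr1.
by rewrite -/S !EFinM !muleA.
Qed.

End morrey.

(** * Embedding of W^{1,r}_0 into C_0 for r > n *)

Section sobolev_embedding.
Context (R : realType) (n : nat) (Omega : set 'rV[R]_n).
Local Notation V := 'rV[R]_n.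
Local Notation lam := (lebesgue_rV R n).
Hypotheses (oOmega : open Omega) (bOmega : bounded_set Omega) (n0 : (0 < n)%N).
Variable r : R.
Hypothesis nr : n%:R < r.
Local Notation W1p0 := (W1p0 Omega r).
Local Notation W1p_norm := (W1p_norm Omega r).
Implicit Types (x : V) (v w phi : V -> R).

Let mOmega : measurable Omega := open_rV_measurable oOmega.
Let r1 : 1 < r. Proof. by apply: le_lt_trans nr; rewrite ler1n. Qed.
Let r0 : 0 < r. Proof. exact: lt_trans r1. Qed.

Lemma test_sup_le_norm : exists2 C : R, 0 <= C &
  forall phi, test_function Omega phi -> forall x, (`|phi x|%:E <= C%:E * W1p_norm phi)%E.
Proof.
have [M [_ /(_ (`|M| + 1)) bM]] := bOmega.
have {}bM x : Omega x -> `|x| <= `|M| + 1 by apply: bM; rewrite ltr_pwDr// ler_norm.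
have B0 : 0 < `|M| + 1 by rewrite ltr_wpDl.
have [C C0 CP] := test_sup_bound n0 B0 bM nr.
exists C => // phi tphi x; apply: (le_trans (CP _ tphi x)).
rewrite lee_wpmul2l ?lee_fin// /W1p_norm -[leLHS]add0e leeD ?Lp_norm_ge0//.
apply: lee_sum => i _; rewrite le_eqVlt; apply/orP; left; apply/eqP.
have wg := test_weak_gradient oOmega tphi.
apply: (Lp_norm_ae oOmega (ltW r1)).
- exact: weak_gradient_measurable wg.
- by apply: weak_gradient_measurable (wgradP wg).
- exact: weak_gradient_uniq wg (wgradP wg) i.
Qed.

(** If they differed at a point of Omega, they would differ on a nonempty open subset, which has
    positive measure. *)
Lemma C0_ae_eq w w' : C0 Omega w -> C0 Omega w' -> ae_eq lam Omega w w' -> w = w'.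
Proof.
move=> [cw w0] [cw' w'0] ww'; apply/funext => x.
have [Ox|nO] := pselect (Omega x); last by rewrite w0// w'0.
apply/eqP; apply: contrapT => /negP; rewrite -subr_eq0 => neq.
pose h y := w y - w' y.
have ch : continuous h by move=> y; apply: (cvgB (cw y) (cw' y)).
pose U := Omega `&` (h @^-1` [set y : R | y != 0]).
have oU : open U.
  apply: openI => //; move/continuousP : ch; apply.
  exact: open_neq.
have mU : measurable U by exact: open_rV_measurable.
have := lebesgue_rV_open_gt0 oU (ex_intro _ x (conj Ox neq)).
have [N [mN N0 NP]] := ww'.
suff -> : lam U = 0%E by rewrite ltxx.
apply/eqP; rewrite eq_le measure_ge0 andbT -N0; apply: le_measure; rewrite ?inE//.
move=> y [Oy hy]; apply: NP => /= /(_ Oy) wy.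
by move: hy; rewrite /h/= wy subrr eqxx.
Qed.

Lemma Lp_norm_le_sup (h : V -> R) (M : R) : 0 <= M -> measurable_fun Omega h ->
  (forall x, Omega x -> `|h x| <= M) ->
  (Lp_norm Omega r h <= M%:E * (lam Omega `^ r^-1))%E.
Proof.
move=> M0 mh hM; have [->|/eqP] := Lp_normE Omega r h; last by rewrite gt_eqF.
have -> : M%:E = ((M `^ r)%:E `^ r^-1)%E.
  by rewrite poweR_EFin -powRrM mulfV ?gt_eqF// powRr1.
rewrite -poweRM ?lee_fin ?powR_ge0//.
apply: gt0_ler_poweR; rewrite ?invr_ge0 ?(ltW r0)// ?in_itv/= ?andbT ?leey ?andbT.
- by apply: integral_ge0 => x _; rewrite lee_fin powR_ge0.
- by rewrite mule_ge0// lee_fin powR_ge0.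
rewrite -integral_cst//; apply: ge0_le_integral => //.
- exact: measurable_norm_powR.
- move=> x Ox; rewrite lee_fin ge0_ler_powR ?nnegrE ?(ltW r0)//; exact: hM.
Qed.

(** Test functions converging to v in the Sobolev norm are uniformly Cauchy by [test_sup_le_norm].
    Their uniform limit w is continuous and vanishes outside Omega; as Omega has finite measure,
    they also converge to w in L^r, which identifies w with v almost everywhere. *)
Lemma C0_representative_exists : exists2 C : R, 0 <= C & forall v, W1p0 v ->
  exists w, [/\ C0 Omega w, ae_eq lam Omega w v &
    forall x, (`|w x|%:E <= C%:E * W1p_norm v)%E].
Proof.
have [C C0 CP] := test_sup_le_norm; exists C => // v Wv.
have p1 := ltW r1.
have Wv1 := W1p0_W1p Wv; have [_ [phi tphi cphi]] := Wv.
have Wd k : W1p Omega r (v \- phi k) by apply: W1p_sub => //; exact: test_W1p.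
pose e k := fine (W1p_norm (v \- phi k)).
have eE k : W1p_norm (v \- phi k) = (e k)%:E.
  by rewrite fineK// ge0_fin_numE ?W1p_norm_ge0// W1p_norm_lty.
have e0 k : 0 <= e k by rewrite -lee_fin -eE W1p_norm_ge0.
have /fine_cvgP[_ ce] : W1p_norm (v \- phi k) @[k --> \oo] --> (0 : R)%:E by exact: cphi.
pose nv := fine (W1p_norm v).
have nvE : W1p_norm v = nv%:E by rewrite fineK// ge0_fin_numE ?W1p_norm_ge0// W1p_norm_lty.
have dphi k l x : `|phi k x - phi l x| <= C * (e k + e l).
  have td : test_function Omega (fun x => -1 * phi l x + phi k x) by exact: test_lin.
  have := CP _ td x; rewrite mulN1r addrC -lee_fin => /le_trans; apply.
  rewrite EFinM lee_wpmul2l ?lee_fin// EFinD -!eE.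
  rewrite (_ : (fun x => -1 * phi l x + phi k x) =
    (fun x => -1 * (v \- phi k) x + (v \- phi l) x)); last first.
    by apply/funext => y /=; ring.
  have := W1p_norm_lin oOmega (-1) p1 (Wd k) (Wd l).
  by rewrite normrN1 mul1e.
have phib k x : `|phi k x| <= C * (e k + nv).
  have := CP _ (tphi k) x; rewrite -lee_fin => /le_trans; apply.
  rewrite EFinM lee_wpmul2l ?lee_fin// EFinD -eE -nvE.
  rewrite [in leLHS](_ : phi k = (fun x => -1 * (v \- phi k) x + v x)); last first.
    by apply/funext => y /=; ring.
  have := W1p_norm_lin oOmega (-1) p1 (Wd k) Wv1.
  by rewrite normrN1 mul1e.
have Ce (eps : R) : 0 < eps -> \forall k \near \oo, C * (e k) < eps.
  move=> eps0; have C1 : 0 < C + 1 by rewrite ltr_wpDl.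
  have /cvgrPdist_lt/(_ (eps / (C + 1))) := ce.
  rewrite divr_gt0// => /(_ isT); apply: filterS => k.
  rewrite sub0r normrN ger0_norm// ltr_pdivlMr// => h; apply: le_lt_trans h.
  by rewrite mulrC ler_wpM2l// lerDl.
have cv x : cvg ((fun k => phi k x) @ \oo).
  apply/cauchy_cvgP; apply: cauchy_exP => eps eps0.
  have [N _ NP] := Ce _ (divr_gt0 eps0 (ltr0n R 2)).
  exists (phi N x); exists N => // k /= Nk; rewrite -ball_normE /ball_/=.
  have := NP N (leqnn N); have := NP k Nk; have := dphi N k x; rewrite /= mulrDr; lra.
pose w x := lim ((fun k => phi k x) @ \oo).
(* Let l tend to infinity in [dphi l k x]: [e l] disappears, and the bound is uniform in x. *)
have wphi k x : `|w x - phi k x| <= C * e k.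
  apply/ler_addgt0Pr => eps eps0; have e2 := divr_gt0 eps0 (ltr0n R 2).
  have /cvgrPdist_lt/(_ _ e2)[N1 _ N1P] := cv x; have [N2 _ N2P] := Ce _ e2.
  pose l := maxn N1 N2.
  have := N1P l (leq_maxl _ _); have := N2P l (leq_maxr _ _) => /=.
  have := dphi l k x; rewrite mulrDr.
  have : `|w x - phi k x| <= `|w x - phi l x| + `|phi l x - phi k x|.
    by rewrite -[X in `|X|](subrKA (phi l x)) ler_normD.
  rewrite -/(w x); lra.
have cw : continuous w.
  move=> x; apply/(@cvgrPdist_lt _ _ _ (nbhs x) (nbhs_filter x)) => eps eps0; have e3 := divr_gt0 eps0 (ltr0n R 3).
  have [N _ /(_ N (leqnn N))/= NP] := Ce _ e3.
  have := test_continuous (tphi N) (x := x) => /(@cvgrPdist_lt _ _ _ (nbhs x) (nbhs_filter x))/(_ _ e3).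
  apply: (@filterS _ (nbhs x) (nbhs_filter x)) => y /= xy.
  have := wphi N x; have := wphi N y.
  have : `|w x - w y| <= `|w x - phi N x| + (`|phi N x - phi N y| + `|w y - phi N y|).
    rewrite -[X in `|X|](subrKA (phi N x)) (le_trans (ler_normD _ _))// lerD2l.
    rewrite -[X in `|X|](subrKA (phi N y)) (le_trans (ler_normD _ _))// lerD2l.
    by rewrite distrC.
  lra.
have w0 x : ~ Omega x -> w x = 0.
  move=> nO; rewrite /w (_ : (fun k => phi k x) = cst 0) ?lim_cst//.
  by apply/funext => k; have [_ _ [K [_ KO]]] := tphi k; apply => /KO.
have mv : measurable_fun Omega v by case: Wv1 => -[].
have mw : measurable_fun Omega w by apply: measurable_funTS; exact: continuous_measurable_rV_real.
have mphi k : measurable_fun Omega (phi k).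
  by apply: measurable_funTS; apply: continuous_measurable_rV_real; exact: test_continuous.
have lO : (lam Omega `^ r^-1 < +oo)%E by apply: poweR_lty; exact: lebesgue_rV_bounded.
pose m := fine (lam Omega `^ r^-1).
have mE : (lam Omega `^ r^-1)%E = m%:E by rewrite fineK// ge0_fin_numE// poweR_ge0.
have m0 : 0 <= m by rewrite -lee_fin -mE poweR_ge0.
have wv0 : Lp_norm Omega r (w \- v) = 0%E.
  apply/eqP; rewrite eq_le Lp_norm_ge0 andbT; apply/lee_addgt0Pr => eps eps0.
  have e2 := divr_gt0 eps0 (ltr0n R 2).
  have em : 0 < eps / 2 / (m + 1) by rewrite divr_gt0// ltr_wpDl.
  have /cvgrPdist_lt/(_ _ e2)[N1 _ N1P] := ce; have [N2 _ N2P] := Ce _ em.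
  pose k := maxn N1 N2.
  have ek := N1P k (leq_maxl _ _); have Cek := N2P k (leq_maxr _ _).
  rewrite (_ : w \- v = (fun x => (w x - phi k x) + (phi k x - v x))); last first.
    by apply/funext => x /=; ring.
  have m1 : measurable_fun Omega (fun x => w x - phi k x) by exact: measurable_funB.
  have m2 : measurable_fun Omega (fun x => phi k x - v x) by exact: measurable_funB.
  apply: (le_trans (Lp_normD oOmega p1 m1 m2)); rewrite add0e (splitr eps) EFinD leeD//.
    have M0 : 0 <= C * e k by rewrite mulr_ge0.
    apply: (le_trans (Lp_norm_le_sup M0 m1 (fun x _ => wphi k x))).
    rewrite mE -EFinM lee_fin; move: Cek; rewrite /= ltr_pdivlMr ?ltr_wpDl// => Cek.
    by rewrite (le_trans _ (ltW Cek))// ler_wpM2l// lerDl.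
  have -> : Lp_norm Omega r (fun x => phi k x - v x) = Lp_norm Omega r (v \- phi k).
    rewrite (_ : (fun x => phi k x - v x) = (fun x => -1 * (v \- phi k) x)).
      by rewrite Lp_normZ// ?normrN1 ?mul1e//; exact: measurable_funB.
    by apply/funext => x /=; ring.
  apply: (@le_trans _ _ (W1p_norm (v \- phi k))).
    by rewrite /W1p_norm leeDl// sume_ge0// => i _; exact: Lp_norm_ge0.
  by move: ek; rewrite eE lee_fin /= sub0r normrN (ger0_norm (e0 k)); exact: ltW.
exists w; split=> //.
  have mwv : measurable_fun setT (EFin \o ((w \- v) \_ Omega)).
    by apply/measurable_EFinP; apply: measurable_patch => //; exact: measurable_funB.
  have r0e : (0 < r%:E)%E by rewrite lte_fin.
  have := Lnorm_eq0_eq0 mwv r0e wv0.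
  apply: filterS => x /= /(_ Logic.I) + Ox; rewrite /patch mem_set//= => /eqP.
  by rewrite eqe subr_eq0 => /eqP.
move=> x; rewrite nvE -EFinM lee_fin; apply/ler_addgt0Pr => eps eps0.
have e2 := divr_gt0 eps0 (ltr0n R 2).
have [N _ /(_ N (leqnn N))/= NP] := Ce _ e2.
have := wphi N x; have := phib N x; rewrite mulrDr.
have : `|w x| <= `|w x - phi N x| + `|phi N x|.
  by rewrite -[X in `|X|](subrK (phi N x)) ler_normD.
lra.
Qed.

Local Notation crep := (C0_representative Omega).

Lemma C0_representativeP : exists2 C : R, 0 <= C & forall v, W1p0 v ->
  [/\ C0 Omega (crep v), ae_eq lam Omega (crep v) v &
    forall x, (`|crep v x|%:E <= C%:E * W1p_norm v)%E].
Proof.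
have [C C_ge0 CP] := C0_representative_exists; exists C => // v Wv.
have [w [w1 w2 w3]] := CP v Wv.
have [c1 c2] : C0 Omega (crep v) /\ ae_eq lam Omega (crep v) v.
  apply: (@getPex _ [set w | (@C0 R n Omega w) /\ {ae lam, forall x, Omega x -> w x = v x}]).
  by exists w.
have -> : crep v = w.
  by apply: C0_ae_eq => //; exact: ae_eq_trans c2 (ae_eq_sym w2).
by split.
Qed.

Lemma C0_representative_id w : C0 Omega w -> crep w = w.
Proof.
move=> cw.
have [c1 c2] : C0 Omega (crep w) /\ ae_eq lam Omega (crep w) w.
  apply: (@getPex _ [set w' | C0 Omega w' /\ {ae lam, forall x, Omega x -> w' x = w x}]).
  by exists w; split=> //; exact: ae_eq_refl.
exact: C0_ae_eq.
Qed.

Lemma C0_representative_lin (a : R) v w : W1p0 v -> W1p0 w ->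
  crep (fun x => a * v x + w x) = (fun x => a * crep v x + crep w x).
Proof.
move=> Wv Ww; have [C _ CP] := C0_representativeP.
have [[c1 z1] a1 _] := CP v Wv; have [[c2 z2] a2 _] := CP w Ww.
have [C3 a3 _] := CP _ (W1p0_lin oOmega a (ltW r1) Wv Ww).
apply: C0_ae_eq => //.
  split; first by move=> x; apply: (cvgD (cvgM (cvg_cst a) (c1 x)) (c2 x)).
  by move=> x nO; rewrite z1// z2// mulr0 addr0.
move: a1 a2 a3; apply: filterS3 => x h1 h2 h3 Ox.
by rewrite h3// h1// h2.
Qed.

End sobolev_embedding.

(** * The state equation and its adjoint *)

Section finite_measures.
Context d (T : measurableType d) (R : realType).
Implicit Types (m : {finite_measure set T -> \bar R}) (u v : {charge set T -> \bar R}).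

Lemma integrable_bounded m (X : set T) (f : T -> R) (M : R) : measurable X ->
  measurable_fun X f -> (forall x, X x -> `|f x| <= M) -> m.-integrable X (EFin \o f).
Proof.
move=> mX mf fM; apply: measurable_bounded_integrable => //.
  by rewrite ltey_eq fin_num_measure.
exists M; split; first exact: num_real.
by move=> N MN x Xx; rewrite /= (le_trans (fM _ Xx))// ltW.
Qed.

(** [charge_integral] refers to a chosen Hahn decomposition. For a charge that agrees with a measure
    m, the positive part is the sum of the negative part and m, so the choice cancels. *)
Lemma charge_integralE m u (X : set T) (f : T -> R) (M : R) : measurable X ->
  measurable_fun X f -> (forall x, X x -> `|f x| <= M) ->
  (forall A, measurable A -> u A = m A) ->
  charge_integral u X f = \int[m]_(x in X) f x.
Proof.
move=> mX mf fM um; rewrite /charge_integral.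
have ifp := integrable_bounded (jordan_pos (hahnP u)) mX mf fM.
have ifn := integrable_bounded (jordan_neg (hahnP u)) mX mf fM.
have ifm := integrable_bounded m mX mf fM.
have E : (\int[jordan_pos (hahnP u)]_(x in X) (f x)%:E =
    \int[jordan_neg (hahnP u)]_(x in X) (f x)%:E + \int[m]_(x in X) (f x)%:E)%E.
  rewrite -integral_measure_add//; apply: eq_measure_integral => A mA _.
  transitivity (jordan_neg (hahnP u) A + m A)%E; last exact/esym/measure_addE.
  rewrite -um// (jordan_decomp (hahnP u) mA).
  have cE : cscale (-1) (jordan_neg (hahnP u)) A = (- jordan_neg (hahnP u) A)%E by rewrite cscaleN1.
  rewrite /= [X in (_ + (_ + X))%E]cE addeCA subee ?adde0//; exact: fin_num_measure.
rewrite /Rintegral E fineD ?integrable_fin_num//.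
by rewrite addrAC subrr add0r.
Qed.

(** v - u equals t (m' - m). On each of the two Hahn sets its absolute value is at most t times the
    sum of the total masses, whence the factor 2. *)
Lemma tv_dist_convex m m' u v (t : R) : 0 <= t -> t <= 1 ->
  (forall A, measurable A -> u A = m A) ->
  (forall A, measurable A -> v A = ((1 - t)%:E * m A + t%:E * m' A)%E) ->
  (tv_dist v u <= (2 * t * fine (m setT + m' setT))%:E)%E.
Proof.
move=> t0 t1 um vm; rewrite /tv_dist /tv_norm /charge_variation.
set nu := cadd v (copp u).
have fm A : measurable A -> m A = (fine (m A))%:E by move=> mA; rewrite fineK// fin_num_measure.
have fm' A : measurable A -> m' A = (fine (m' A))%:E by move=> mA; rewrite fineK// fin_num_measure.
have mle A : measurable A -> fine (m A) <= fine (m setT).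
  by move=> mA; rewrite -lee_fin -fm// -fm//; apply: le_measure; rewrite ?inE.
have m'le A : measurable A -> fine (m' A) <= fine (m' setT).
  by move=> mA; rewrite -lee_fin -fm'// -fm'//; apply: le_measure; rewrite ?inE.
have nuE A : measurable A -> nu A = (t * (fine (m' A) - fine (m A)))%:E.
  move=> mA; rewrite /nu /cadd/= /copp/= um// vm// fm// fm'// -!EFinM -EFinN -!EFinD.
  by congr (_%:E); ring.
have fge A : measurable A -> 0 <= fine (m A) by move=> mA; rewrite fine_ge0.
have fge' A : measurable A -> 0 <= fine (m' A) by move=> mA; rewrite fine_ge0.
have [[mP _] [mN _] _ _] := hahnP nu.
rewrite /= jordan_posE cjordan_posE jordan_negE cjordan_negE /crestr0 !mem_set// /crestr/= !setTI.
rewrite (nuE _ mP : cadd v (copp u) _ = _) (nuE _ mN : cadd v (copp u) _ = _).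
rewrite -EFinN -EFinD lee_fin fineD ?fin_num_measure//.
have h1 := mle _ mP; have h2 := mle _ mN; have h3 := m'le _ mP; have h4 := m'le _ mN.
have h5 := fge _ mP; have h6 := fge _ mN; have h7 := fge' _ mP; have h8 := fge' _ mN.
nra.
Qed.

End finite_measures.

Section state_equation.
Context (R : realType) (n : nat) (Omega omega1 : set 'rV[R]_n).
Local Notation V := 'rV[R]_n.
Local Notation lam := (lebesgue_rV R n).
Hypotheses (oOmega : open Omega) (bOmega : bounded_set Omega) (n0 : (0 < n)%N).
Hypothesis comega1 : compact omega1.
Variable q : R.
Hypotheses (q1 : 1 < q) (nq : n%:R < conjugate q).
Hypothesis wp : poisson_well_posed Omega q.
Implicit Types (m : {finite_measure set V -> \bar R}) (u : {charge set V -> \bar R}).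
Implicit Types (y v w : V -> R).
Local Notation W1p0 := (W1p0 Omega).
Local Notation crep := (C0_representative Omega).
Local Notation S := (solution_operator Omega omega1 q).
Local Notation pair := (pairing Omega).

Let q'1 : 1 < conjugate q. Proof. by apply: le_lt_trans nq; rewrite ler1n. Qed.
Let qq' : q^-1 + (conjugate q)^-1 = 1.
Proof. by rewrite /conjugate; field; rewrite !gt_eqF ?subr_gt0// (lt_trans _ q1). Qed.
Let qK : conjugate (conjugate q) = q.
Proof.
have q10 : q - 1 != 0 by rewrite subr_eq0 gt_eqF.
rewrite /conjugate; field; rewrite q10/= mulN1r opprB addrC subrK; exact: oner_neq0.
Qed.
Let mo1 : measurable omega1. Proof. exact: compact_rV_measurable. Qed.

Lemma C0_bounded w : C0 Omega w -> exists M, 0 <= M /\ forall x, omega1 x -> `|w x| <= M.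
Proof. by move=> [cw _]; exact: continuous_bounded_on. Qed.

Lemma C0_integrable m w : C0 Omega w -> m.-integrable omega1 (EFin \o w).
Proof.
move=> cw; have [M [_ wM]] := C0_bounded cw; apply: (integrable_bounded m mo1 _ wM).
by apply: measurable_funTS; apply: continuous_measurable_rV_real; case: cw.
Qed.

Lemma crepC0 v : W1p0 (conjugate q) v -> C0 Omega (crep v).
Proof.
by move=> Wv; have [C _ /(_ v Wv)[]] := C0_representativeP oOmega bOmega n0 nq.
Qed.

Lemma EstarE m u v : (forall A, measurable A -> u A = m A) ->
  W1p0 (conjugate q) v -> Estar Omega omega1 u v = \int[m]_(x in omega1) crep v x.
Proof.
move=> um Wv; have Cv := crepC0 Wv; have [M [_ wM]] := C0_bounded Cv.
apply: (charge_integralE mo1 _ wM um).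
by apply: measurable_funTS; apply: continuous_measurable_rV_real; case: Cv.
Qed.

(** The dual bound is the constant of the embedding into C_0 times the mass of [omega1]; this is
    what makes the state equation solvable for measures. *)
Lemma Estar_dual m u : (forall A, measurable A -> u A = m A) ->
  Wm1p Omega q (Estar Omega omega1 u).
Proof.
move=> um; split.
  move=> a y v Wy Wv; have Wyv := W1p0_lin oOmega a (ltW q'1) Wy Wv.
  rewrite !(EstarE um)// (C0_representative_lin oOmega bOmega n0 nq)//.
  have iy := C0_integrable m (crepC0 Wy); have iv := C0_integrable m (crepC0 Wv).
  by rewrite RintegralD// ?RintegralZl//; exact: (integrableZl mo1 a iy).
have [C C_ge0 CP] := C0_representativeP oOmega bOmega n0 nq.
exists (C * fine (m omega1)) => y Wy; rewrite (EstarE um)//.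
have [_ _ yC] := CP y Wy.
have W1 := W1p0_W1p Wy.
set N := W1p_norm Omega (conjugate q) y in yC *.
have NE : N = (fine N)%:E by rewrite fineK// ge0_fin_numE ?W1p_norm_ge0// W1p_norm_lty// ltW.
have iy := C0_integrable m (crepC0 Wy).
rewrite NE -EFinM lee_fin mulrAC.
apply: (le_trans (le_normr_Rintegral mo1 iy)).
rewrite -Rintegral_cst//; apply: le_Rintegral => //.
- by have := integrable_abse iy.
- exact: finite_measure_integrable_cst.
- by move=> x _; have := yC x; rewrite NE -EFinM lee_fin.
Qed.

Lemma solution_operatorP m u : (forall A, measurable A -> u A = m A) ->
  poisson_solution Omega q (Estar Omega omega1 u) (S u).
Proof.
move=> um; have [y ys _] := wp (Estar_dual um).
by apply: (@getPex _ [set y | poisson_solution Omega q (Estar Omega omega1 u) y]); exists y.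
Qed.

(** The difference has Sobolev norm zero, below every [delta]. States are determined only almost
    everywhere, so values of [J] at states are handled through this lemma. *)
Lemma continuous_on_W1p0_ae (J : (V -> R) -> R) y z : continuous_on_W1p0 Omega q J ->
  W1p0 q y -> W1p0 q z -> ae_eq lam Omega z y -> J z = J y.
Proof.
move=> cJ Wy Wz zy; apply/eqP; rewrite -subr_eq0 -normr_le0.
apply/ler_addgt0Pr => e e0; rewrite add0r; apply: ltW.
have [delta delta0 JP] := cJ y Wy e e0; apply: JP => //.
rewrite W1p_norm_ae0 ?lte_fin//.
- exact: ltW.
- by apply: W1p_sub => //; [exact: ltW|exact: W1p0_W1p|exact: W1p0_W1p].
- by apply: filterS zy => x zy Ox /=; rewrite zy// subrr.
Qed.

Lemma pairingC y v : pair y v = pair v y.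
Proof. by apply: eq_Rintegral => x _; rewrite edotC. Qed.

(** The affine combination of the two states solves the equation for [ut], and solutions are unique
    almost everywhere. Only integrals of C_0 functions enter, which is why the combination of
    measures is expressed through them. *)
Lemma solution_segment m m' (mt : {finite_measure set V -> \bar R}) u u' (ut : {charge set V -> \bar R}) (t : R) :
  (forall A, measurable A -> u A = m A) -> (forall A, measurable A -> u' A = m' A) ->
  (forall A, measurable A -> ut A = mt A) ->
  (forall f : V -> R, C0 Omega f -> \int[mt]_(x in omega1) f x =
     (1 - t) * \int[m]_(x in omega1) f x + t * \int[m']_(x in omega1) f x) ->
  ae_eq lam Omega (S ut) (fun x => S u x + t * (S u' x - S u x)).
Proof.
move=> um um' umt mtE.
have [Wu uP] := solution_operatorP um; have [Wu' uP'] := solution_operatorP um'.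
have [y _ yuniq] := wp (Estar_dual umt).
have H := yuniq _ (solution_operatorP umt).
suff H' : poisson_solution Omega q (Estar Omega omega1 ut)
    (fun x => S u x + t * (S u' x - S u x)).
  by apply: ae_eq_trans H (ae_eq_sym _); exact: yuniq.
have q1' := ltW q1.
have Wd : W1p0 q (fun x => -1 * S u x + S u' x) by exact: W1p0_lin.
have -> : (fun x => S u x + t * (S u' x - S u x)) =
    (fun x => t * (-1 * S u x + S u' x) + S u x) by apply/funext => x; ring.
split; first exact: W1p0_lin.
move=> v Wv; have [Wu1 Wu'1 Wd1 Wv1] := And4 (W1p0_W1p Wu) (W1p0_W1p Wu') (W1p0_W1p Wd) (W1p0_W1p Wv).
rewrite -/(pair _ v) (pairing_linl oOmega q1 q'1 qq')// (pairing_linl oOmega q1 q'1 qq')//.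
have E : pair (S u) v = \int[m]_(x in omega1) crep v x by rewrite [LHS](uP v Wv) (EstarE um).
have E' : pair (S u') v = \int[m']_(x in omega1) crep v x by rewrite [LHS](uP' v Wv) (EstarE um').
by rewrite E E' (EstarE umt Wv) (mtE _ (crepC0 Wv)); ring.
Qed.

(** Symmetry of the Dirichlet form: the adjoint equation tested with the difference of states equals
    the difference of the two state equations tested with [p]. Since [p] lies in C_0, it is its own
    continuous representative. *)
Lemma adjoint_derivative m m' u u' (dJ : (V -> R) -> (V -> R) -> R) (p : V -> R) :
  (forall A, measurable A -> u A = m A) -> (forall A, measurable A -> u' A = m' A) ->
  adjoint_state Omega omega1 q dJ u p ->
  dJ (S u) (fun x => S u' x - S u x) =
  \int[m']_(x in omega1) p x - \int[m]_(x in omega1) p x.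
Proof.
move=> um um' [Cp [Wp pP]].
have [Wu uP] := solution_operatorP um; have [Wu' uP'] := solution_operatorP um'.
have q1' := ltW q1.
have Wd : W1p0 q (fun x => -1 * S u x + S u' x) by exact: W1p0_lin.
have -> : (fun x => S u' x - S u x) = (fun x => -1 * S u x + S u' x).
  by apply/funext => x; ring.
have [Wu1 Wu'1 Wd1 Wp1] := And4 (W1p0_W1p Wu) (W1p0_W1p Wu') (W1p0_W1p Wd) (W1p0_W1p Wp).
rewrite -pP ?qK// -/(pair p _) pairingC (pairing_linl oOmega q1 q'1 qq')//.
have E : pair (S u) p = \int[m]_(x in omega1) p x.
  by rewrite [LHS](uP p Wp) (EstarE um Wp) (C0_representative_id oOmega Cp).
have E' : pair (S u') p = \int[m']_(x in omega1) p x.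
  by rewrite [LHS](uP' p Wp) (EstarE um' Wp) (C0_representative_id oOmega Cp).
by rewrite E E'; ring.
Qed.

End state_equation.

(** * Transport plans and the variational inequality *)

Section convex_combination.
Context d (T : measurableType d) (R : realType).
Variables (a b : {nonneg R}) (m1 m2 : {finite_measure set T -> \bar R}).

Definition mconv : set T -> \bar R := measure_add (mscale a m1) (mscale b m2).

HB.instance Definition _ := Measure.on mconv.

Lemma mconvE A : mconv A = (a%:num%:E * m1 A + b%:num%:E * m2 A)%E.
Proof. by rewrite /mconv measure_addE. Qed.

Let mconv_fin : fin_num_fun mconv.
Proof.
by move=> A mA; rewrite mconvE fin_numD !fin_numM// fin_num_measure.
Qed.

HB.instance Definition _ := Measure_isFinite.Build _ _ _ mconv mconv_fin.

Lemma ge0_integral_mconv (D : set T) (f : T -> \bar R) : measurable D ->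
  measurable_fun D f -> (forall x, D x -> (0 <= f x)%E) ->
  (\int[mconv]_(x in D) f x =
   a%:num%:E * \int[m1]_(x in D) f x + b%:num%:E * \int[m2]_(x in D) f x)%E.
Proof. by move=> mD mf f0; rewrite ge0_integral_measure_add// !ge0_integral_mscale. Qed.

Lemma Rintegral_mconv (D : set T) (f : T -> R) (M : R) : measurable D ->
  measurable_fun D f -> (forall x, D x -> `|f x| <= M) ->
  \int[mconv]_(x in D) f x =
  a%:num * \int[m1]_(x in D) f x + b%:num * \int[m2]_(x in D) f x.
Proof.
move=> mD mf fM; have mc : measurable_fun D (fun=> M) by [].
have fM0 x : D x -> 0 <= f x + M by move=> /fM; rewrite ler_norml => /andP[]; lra.
(* Additivity in the measure is available for nonnegative integrands, so f is shifted by its bound M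
   and the shift is subtracted in terms of the masses. *)
have I (m : {finite_measure set T -> \bar R}) :
    \int[m]_(x in D) f x = \int[m]_(x in D) (f x + M) - M * fine (m D).
  rewrite RintegralD ?Rintegral_cst ?addrK//.
    exact: integrable_bounded mf fM.
  exact: finite_measure_integrable_cst.
have mfM : measurable_fun D (fun x => (f x + M)%:E).
  by apply/measurable_EFinP; exact: measurable_funD.
have fin (m : {finite_measure set T -> \bar R}) : (\int[m]_(x in D) (f x + M)%:E)%E \is a fin_num.
  apply: integrable_fin_num => //; apply: (@integrable_bounded _ _ _ m D _ (M + M)) => //.
    exact: measurable_funD.
  move=> x Dx; rewrite ger0_norm ?fM0// lerD2r.
  by have := fM x Dx; rewrite ler_norml => /andP[].
have mE : fine (mconv D) = a%:num * fine (m1 D) + b%:num * fine (m2 D).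
  by rewrite mconvE fineD ?fin_numM ?fin_num_measure// !fineM ?fin_num_measure.
have iE : fine (\int[mconv]_(x in D) (f x + M)%:E) = a%:num *
    fine (\int[m1]_(x in D) (f x + M)%:E) + b%:num * fine (\int[m2]_(x in D) (f x + M)%:E).
  by rewrite ge0_integral_mconv// fineD ?fin_numM// !fineM.
rewrite (I mconv) (I m1) (I m2) mE /Rintegral iE.
by ring.
Qed.

End convex_combination.

Section pushforward_finite.
Context d d' (T1 : measurableType d) (T2 : measurableType d') (R : realType).
Variables (m : {finite_measure set T1 -> \bar R}) (f : T1 -> T2).
Hypothesis mf : measurable_fun setT f.

Definition mimage : set T2 -> \bar R := pushforward m f.

Let mimage0 : mimage set0 = 0%E.
Proof. by rewrite /mimage /pushforward preimage_set0 measure0. Qed.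

Let mpre A : measurable A -> measurable (f @^-1` A).
Proof. by move=> mA; rewrite -[X in measurable X]setTI; exact: mf. Qed.

Let mimage_ge0 A : (0 <= mimage A)%E. Proof. exact: measure_ge0. Qed.

Let mimage_sigma_additive : semi_sigma_additive mimage.
Proof. exact: (@measure_semi_sigma_additive _ _ _ (image_measure m mf)). Qed.

HB.instance Definition _ := isMeasure.Build _ _ _ mimage
  mimage0 mimage_ge0 mimage_sigma_additive.

Let mimage_fin : fin_num_fun mimage.
Proof. by move=> A mA; apply: fin_num_measure; exact: mpre. Qed.

HB.instance Definition _ := Measure_isFinite.Build _ _ _ mimage mimage_fin.

Definition image_finite_measure : {finite_measure set T2 -> \bar R} := mimage.

Lemma image_finite_measureE A : image_finite_measure A = m (f @^-1` A).
Proof. by []. Qed.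

Lemma Rintegral_image (D : set T2) (g : T2 -> R) (M : R) : measurable D ->
  measurable_fun setT g -> (forall x, D x -> `|g x| <= M) ->
  \int[image_finite_measure]_(y in D) g y = \int[m]_(x in f @^-1` D) g (f x).
Proof.
move=> mD mg gM; rewrite /Rintegral; congr fine.
rewrite -(@integral_pushforward _ _ _ _ _ f mf m D (EFin \o g))//.
  exact/measurable_EFinP.
apply: (@integrable_bounded _ _ _ m _ _ M (mpre mD)).
  by apply: measurable_funTS; exact: measurableT_comp.
by move=> x; exact: gM.
Qed.

End pushforward_finite.

(** * The Euclidean norm and its relation to the max norm *)

Section euclidean_norm.
Context (R : realType) (n : nat).
Local Notation V := 'rV[R]_n.
Implicit Types (x y z : V).

Lemma edot_ge0 x : 0 <= edot x x.
Proof. by apply: sumr_ge0 => i _; rewrite -expr2 sqr_ge0. Qed.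

Lemma enorm_ge0 x : 0 <= enorm x. Proof. exact: sqrtr_ge0. Qed.

Lemma sqr_enorm x : enorm x ^+ 2 = edot x x.
Proof. by rewrite sqr_sqrtr// edot_ge0. Qed.

Lemma enorm_sub_sym x y : enorm (x - y) = enorm (y - x).
Proof.
by congr Num.sqrt; apply: eq_bigr => i _; rewrite !mxE; ring.
Qed.

Lemma enorm0 : enorm (0 : V) = 0.
Proof. by rewrite /enorm /edot big1 ?sqrtr0// => i _; rewrite mxE mul0r. Qed.

Lemma coord_le_enorm x i : `|x ord0 i| <= enorm x.
Proof.
rewrite -sqrtr_sqr ler_wsqrtr// /edot (bigD1 i)//= -expr2 lerDl.
by apply: sumr_ge0 => j _; rewrite -expr2 sqr_ge0.
Qed.

Lemma norm_le_enorm x : `|x| <= enorm x.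
Proof. by apply/norm_rV_le => [|j]; [exact: enorm_ge0|exact: coord_le_enorm]. Qed.

(** Expanding the squared length of B x - C y gives B (A B - C^2) >= 0. One divides by B; if B = 0,
    then y = 0 and C = 0. *)
Lemma cauchy_schwarz x y : edot x y ^+ 2 <= edot x x * edot y y.
Proof.
set A := edot x x; set B := edot y y; set C := edot x y.
have : 0 <= B * (A * B - C ^+ 2).
  have -> : B * (A * B - C ^+ 2) = \sum_i (B * x ord0 i - C * y ord0 i) ^+ 2.
    transitivity (\sum_i (B ^+ 2 * (x ord0 i * x ord0 i) - 2 * B * C * (x ord0 i * y ord0 i)
        + C ^+ 2 * (y ord0 i * y ord0 i))).
      rewrite big_split/= sumrB -!mulr_sumr -/(edot x x) -/(edot x y) -/(edot y y).
      by rewrite -/A -/B -/C; ring.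
    by apply: eq_bigr => i _; ring.
  by apply: sumr_ge0 => i _; exact: sqr_ge0.
have B0 : 0 <= B by exact: edot_ge0.
move: B0; rewrite le_eqVlt => /predU1P[B0 _|B0]; last by rewrite pmulr_rge0// subr_ge0.
suff -> : C = 0 by rewrite expr0n mulr_ge0 ?edot_ge0.
rewrite /C /edot big1// => i _.
have : enorm y = 0 by rewrite /enorm -/B -B0 sqrtr0.
by have := coord_le_enorm y i => /[swap] ->; rewrite normr_le0 => /eqP ->; rewrite mulr0.
Qed.

Lemma enorm_triangle x y : enorm (x + y) <= enorm x + enorm y.
Proof.
have h : 0 <= enorm x + enorm y by rewrite addr_ge0 ?enorm_ge0.
rewrite -(@ler_pXn2r _ 2)// ?nnegrE ?enorm_ge0// sqr_enorm sqrrD !sqr_enorm.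
have -> : edot (x + y) (x + y) = edot x x + edot x y *+ 2 + edot y y.
  rewrite mulr2n /edot -!big_split/=; apply: eq_bigr => i _; rewrite !mxE; ring.
rewrite lerD2r lerD2l lerMn2r/=.
rewrite (le_trans (ler_norm _))// -(@ler_pXn2r _ 2)// ?nnegrE ?mulr_ge0 ?enorm_ge0//.
by rewrite real_normK ?num_real// exprMn !sqr_enorm cauchy_schwarz.
Qed.

Lemma enorm_sub_triangle x y z : enorm (x - z) <= enorm (x - y) + enorm (y - z).
Proof. by rewrite -[x - z](subrKA y) enorm_triangle. Qed.

Lemma enorm_continuous : continuous (@enorm R n).
Proof.
move=> x; apply: (@continuous_comp _ _ _ (fun x : V => edot x x) Num.sqrt); last exact: sqrt_continuous.
apply: (@cvg_big _ _ _ _ _ add_continuous _ (nbhs x) _ _ _ (nbhs_filter x)) => i _.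
by apply: (cvgM (@coord_continuous R 1 n ord0 i x) (@coord_continuous R 1 n ord0 i x)).
Qed.

Lemma measurable_enorm_sub d (T : measurableType d) (D : set T) (f g : T -> V) :
  measurable_fun D f -> measurable_fun D g -> measurable_fun D (fun t => enorm (f t - g t)).
Proof.
move=> mf mg; have mc i (h : T -> V) : measurable_fun D h -> measurable_fun D (fun t => h t ord0 i).
  have := continuous_measurable_rV_real (@coord_continuous R 1 n ord0 i).
  exact: measurableT_comp.
apply: (measurableT_comp (continuous_measurable_fun (@sqrt_continuous R))).
apply: measurable_sum => i.
rewrite (_ : (fun t => _) = (fun t => (f t ord0 i - g t ord0 i) * (f t ord0 i - g t ord0 i))).
  by apply: measurable_funM; apply: measurable_funB; exact: mc.
by apply/funext => t; rewrite !mxE.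
Qed.

End euclidean_norm.

Section concentrated.
Context d (T : measurableType d) (R : realType).
Implicit Types (m : {finite_measure set T -> \bar R}) (X D : set T).

(** Pulling an integral over [omega0] or [omega1] back to a plan yields a cylinder as domain; this
    cuts it down to the product of the two sets. *)
Lemma concentrated_integral m X D (f : T -> \bar R) : concentrated_on X m ->
  measurable X -> measurable D -> X `<=` D -> measurable_fun D f ->
  m.-integrable X f -> (\int[m]_(x in D) f x = \int[m]_(x in X) f x)%E.
Proof.
move=> cX mX mD XD mf iX; have mDX : measurable (D `\` X) by exact: measurableD.
have m0 : m (D `\` X) = 0%E by apply: cX => //; apply/seteqP; split=> // x [[_ ?] ?].
have iD : m.-integrable D f.
  apply/(negligible_integrable mDX mD mf m0).
  by rewrite setDD setIidr.
by rewrite (negligible_integral mDX mD iD m0) setDD setIidr.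
Qed.

Lemma concentrated_setI m X A : concentrated_on X m -> measurable X -> measurable A ->
  m A = m (A `&` X).
Proof.
move=> cX mX mA; have mAX : measurable (A `\` X) by exact: measurableD.
rewrite -[in LHS](setUIDK A X) measureU//.
- by rewrite [X in (_ + X)%E]cX ?adde0//; apply/seteqP; split=> // x [[_ ?] ?].
- exact: measurableI.
- by apply/seteqP; split=> // x [[_ Xx] [_]]; apply.
Qed.

End concentrated.

(** * First order optimality along segments of measures *)

Section variational_inequality.
Context (R : realType) (n : nat) (Omega omega0 omega1 : set 'rV[R]_n).
Local Notation V := 'rV[R]_n.
Hypotheses (oOmega : open Omega) (bOmega : bounded_set Omega) (n0 : (0 < n)%N).
Hypotheses (comega0 : compact omega0) (comega1 : compact omega1).
Variable u0 : {finite_measure set V -> \bar R}.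
Variables (q alpha : R).
Hypotheses (q1 : 1 < q) (nq : n%:R < conjugate q) (alpha0 : 0 < alpha).
Hypothesis wp : poisson_well_posed Omega q.
Variables (J : (V -> R) -> R) (dJ : (V -> R) -> (V -> R) -> R).
Hypotheses (cJ : continuous_on_W1p0 Omega q J)
  (hdJ : gateaux_derivative_on_W1p0 Omega q J dJ).
Variables (ubar : {charge set V -> \bar R}) (p : V -> R).
Let cost (x xi : V) := enorm (x - xi).
Hypothesis hubar : local_minimizer omega1 (objective Omega omega1 omega0 cost u0 q J alpha) ubar.
Hypothesis hp : adjoint_state Omega omega1 q dJ ubar p.

Local Notation Z := (omega0 `*` omega1).
Local Notation plan := (transport_plan omega0 omega1 u0).

Let mo0 : measurable omega0. Proof. exact: compact_rV_measurable. Qed.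
Let mo1 : measurable omega1. Proof. exact: compact_rV_measurable. Qed.
Let mZ : measurable Z. Proof. exact: measurableX. Qed.

Let mcost : measurable_fun setT (fun z : V * V => cost z.1 z.2).
Proof. by apply: measurable_enorm_sub; [exact: measurable_fst|exact: measurable_snd]. Qed.

Lemma cost_bounded : exists M, forall z, Z z -> `|cost z.1 z.2| <= M.
Proof.
have [M0 [_ h0]] := continuous_bounded_on (@enorm_continuous R n) comega0.
have [M1 [_ h1]] := continuous_bounded_on (@enorm_continuous R n) comega1.
exists (M0 + M1) => -[x xi] [/= /h0 hx /h1 hxi].
rewrite /cost ger0_norm ?enorm_ge0//; apply: (le_trans (enorm_sub_triangle x 0 xi)).
rewrite (enorm_sub_sym 0 xi) !subr0; apply: lerD.
  exact: le_trans (ler_norm _) hx.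
exact: le_trans (ler_norm _) hxi.
Qed.

Let cost_integrable (pi : {finite_measure set (V * V)%type -> \bar R}) :
  pi.-integrable Z (EFin \o (fun z => cost z.1 z.2)).
Proof.
have [M hM] := cost_bounded; apply: (integrable_bounded pi mZ _ hM).
exact: measurable_funTS.
Qed.

Definition plan_cost (pi : {finite_measure set (V * V)%type -> \bar R}) : R :=
  \int[pi]_(z in Z) cost z.1 z.2.

Lemma plan_costE (pi : {finite_measure set (V * V)%type -> \bar R}) :
  (\int[pi]_(z in Z) (cost z.1 z.2)%:E = (plan_cost pi)%:E)%E.
Proof. by rewrite /plan_cost /Rintegral fineK//; apply: integrable_fin_num => //; exact: cost_integrable. Qed.

Definition optimal_cost : R := fine (transport_cost omega0 omega1 cost u0 ubar).

(** The objective is finite at [ubar], its [J] term is real and [alpha] is positive, so the infimum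
    is finite. *)
Lemma optimal_costE : transport_cost omega0 omega1 cost u0 ubar = optimal_cost%:E.
Proof.
have [_ + _] := hubar; rewrite /objective /optimal_cost.
set D := transport_cost _ _ _ _ _ => Dlt.
have D0 : (0 <= D)%E.
  apply/ereal_infP => _ [pi _ ->]; apply: integral_ge0 => z _.
  by rewrite lee_fin enorm_ge0.
rewrite fineK// ge0_fin_numE//.
move: Dlt; case: (D) D0 => [r _ _|_|//]; first exact: ltry.
by rewrite gt0_muley ?lte_fin// addey.
Qed.

Lemma near_optimal_plan (eps : R) : 0 < eps ->
  exists2 pi : {finite_measure set (V * V)%type -> \bar R},
    plan ubar pi & plan_cost pi <= optimal_cost + eps.
Proof.
move=> e0; have Dfin : transport_cost omega0 omega1 cost u0 ubar \is a fin_num.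
  by rewrite optimal_costE.
have [_ [pi pip ->]] := lb_ereal_inf_adherent e0 Dfin.
by rewrite -/(transport_cost _ _ _ _ _) optimal_costE plan_costE -EFinD lte_fin => /ltW; exists pi.
Qed.

Lemma optimal_cost_le (u : {charge set V -> \bar R}) (pi : {finite_measure set (V * V)%type -> \bar R}) :
  plan u pi -> (transport_cost omega0 omega1 cost u0 u <= (plan_cost pi)%:E)%E.
Proof. by move=> pip; apply: ereal_inf_lbound; exists pi => //; rewrite plan_costE. Qed.

Lemma plan_fst (u : {charge set V -> \bar R}) (pi : {finite_measure set (V * V)%type -> \bar R})
  (f : V -> R) (M : R) : plan u pi -> measurable_fun setT f ->
  (forall x, omega0 x -> `|f x| <= M) ->
  \int[u0]_(x in omega0) f x = \int[pi]_(z in Z) f z.1.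
Proof.
move=> [conc p1 _] mf fM.
transitivity (\int[image_finite_measure pi (@measurable_fst _ _ V V)]_(x in omega0) f x).
  by rewrite /Rintegral; congr fine; apply: eq_measure_integral => A mA _; exact/esym/p1.
rewrite (Rintegral_image _ _ mo0 mf fM) /Rintegral; congr fine.
have mf1 : measurable_fun setT (f \o @fst V V) by exact: measurableT_comp measurable_fst.
apply: concentrated_integral => //.
- by rewrite -[X in measurable X]setTI; exact: measurable_fst.
- by move=> z [].
- by apply/measurable_EFinP; exact: measurable_funTS.
- by apply: (@integrable_bounded _ _ _ pi _ _ M mZ) => [|z []/fM//]; exact: measurable_funTS.
Qed.

Lemma plan_snd (m : {finite_measure set V -> \bar R}) (pi : {finite_measure set (V * V)%type -> \bar R})
  (f : V -> R) (M : R) : plan m pi -> measurable_fun setT f ->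
  (forall x, omega1 x -> `|f x| <= M) ->
  \int[m]_(x in omega1) f x = \int[pi]_(z in Z) f z.2.
Proof.
move=> [conc _ p2] mf fM.
transitivity (\int[image_finite_measure pi (@measurable_snd _ _ V V)]_(x in omega1) f x).
  by rewrite /Rintegral; congr fine; apply: eq_measure_integral => A mA _; exact/esym/p2.
rewrite (Rintegral_image _ _ mo1 mf fM) /Rintegral; congr fine.
have mf1 : measurable_fun setT (f \o @snd V V) by exact: measurableT_comp measurable_snd.
apply: concentrated_integral => //.
- by rewrite -[X in measurable X]setTI; exact: measurable_snd.
- by move=> z [].
- by apply/measurable_EFinP; exact: measurable_funTS.
- by apply: (@integrable_bounded _ _ _ pi _ _ M mZ) => [|z [_] /fM//]; exact: measurable_funTS.
Qed.

Lemma plan_concentrated (u : set V -> \bar R) (pi : {finite_measure set (V * V)%type -> \bar R}) :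
  plan u pi -> concentrated_on omega1 u.
Proof.
move=> [conc _ p2] A mA A0; rewrite -p2//; apply: conc.
  by rewrite -[X in measurable X]setTI; exact: measurable_snd.
by apply/seteqP; split=> // -[x y] [/= Ay [_ /= oy]]; have : (A `&` omega1) y by []; rewrite A0.
Qed.

Lemma plan_mconv (a b : {nonneg R}) (m m' : {finite_measure set V -> \bar R})
    (pi pi' : {finite_measure set (V * V)%type -> \bar R}) : a%:num + b%:num = 1 ->
  plan m pi -> plan m' pi' -> plan (mconv a b m m') (mconv a b pi pi').
Proof.
move=> ab [c1 f1 s1] [c2 f2 s2]; split=> [A mA A0|A mA|A mA].
- by rewrite mconvE c1// c2// !mule0 adde0.
- rewrite /pushforward mconvE -[pi _]/(pushforward pi fst A) -[pi' _]/(pushforward pi' fst A).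
  by rewrite f1// f2// -ge0_muleDl// -EFinD ab mul1e.
- rewrite /pushforward mconvE -[pi _]/(pushforward pi snd A) -[pi' _]/(pushforward pi' snd A).
  by rewrite s1// s2// mconvE.
Qed.

(** Along (1 - t) m + t m' the transport cost is at most (1 - t) times the optimal cost plus t times
    the cost of pi', by convexity, while [J] has a derivative represented by [p]. Divide by t and
    let t tend to 0 from the right. On the left, pi matters only through its second marginal [ubar],
    hence [optimal_cost] in place of its own cost. *)
Lemma variational_inequality (m' : {finite_measure set V -> \bar R})
    (pi pi' : {finite_measure set (V * V)%type -> \bar R}) :
  plan ubar pi -> plan m' pi' ->
  \int[pi]_(z in Z) p z.2 + alpha * optimal_cost <=
  \int[pi']_(z in Z) p z.2 + alpha * plan_cost pi'.
Proof.
move=> pip pip'; pose m := image_finite_measure pi (@measurable_snd _ _ V V).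
have [Cp _] := hp; have [cp _] := Cp.
have mp : measurable_fun setT p by exact: continuous_measurable_rV_real.
have [M [_ pM]] := C0_bounded comega1 Cp.
have um A : measurable A -> ubar A = m A by move=> mA; have [_ _ <-] := pip.
have pim : plan m pi by have [c1 f1 s1] := pip; split.
rewrite -(plan_snd pim mp pM) -(plan_snd pip' mp pM).
pose u' : {charge set V -> \bar R} := charge_of_finite_measure m'.
have um' A : measurable A -> u' A = m' A by [].
suff H : alpha * optimal_cost - alpha * plan_cost pi' <=
  \int[m']_(x in omega1) p x - \int[m]_(x in omega1) p x by lra.
pose h x := solution_operator Omega omega1 q u' x - solution_operator Omega omega1 q ubar x.
have <- := adjoint_derivative oOmega bOmega n0 comega1 q1 nq wp um um' hp.
set Su := solution_operator Omega omega1 q ubar.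
have [Wu _] : poisson_solution Omega q (Estar Omega omega1 ubar) Su.
  exact: (solution_operatorP oOmega bOmega n0 comega1 nq wp um).
have [Wu' _] : poisson_solution Omega q (Estar Omega omega1 u') (solution_operator Omega omega1 q u').
  exact: (solution_operatorP oOmega bOmega n0 comega1 nq wp um').
have Wh : W1p0 Omega q h.
  rewrite (_ : h = fun x => -1 * Su x + solution_operator Omega omega1 q u' x).
    by apply: W1p0_lin => //; exact: ltW.
  by apply/funext => x; rewrite /h mulN1r addrC.
have [_ Jlim] := hdJ Wu; have {}Jlim := Jlim _ Wh.
have [_ _ [r r0 hmin]] := hubar.
pose K := fine (m setT + m' setT).
have K0 : 0 <= K by rewrite fine_ge0// adde_ge0.
(* By [tv_dist_convex] the last condition keeps the perturbed measure in the neighbourhood where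
   [ubar] is minimal. *)
have key (t : R) : 0 < t -> t <= 1 -> 2 * t * K < r ->
    alpha * optimal_cost - alpha * plan_cost pi' <= t^-1 * (J (fun x => Su x + t * h x) - J Su).
  move=> t0 t1 tK; have t1' : 0 <= 1 - t by rewrite subr_ge0.
  pose a := NngNum t1'; pose b := NngNum (ltW t0).
  have ab : a%:num + b%:num = 1 by rewrite /= subrK.
  pose mt : {finite_measure set V -> \bar R} := mconv a b m m'.
  pose ut : {charge set V -> \bar R} := charge_of_finite_measure mt.
  have utmt A : measurable A -> ut A = mt A by [].
  have utE A : measurable A -> ut A = ((1 - t)%:E * m A + t%:E * m' A)%E.
    by move=> mA; exact: (mconvE a b m m' A).
  have tvlt : (tv_dist ut ubar < r%:E)%E.
    by apply: (le_lt_trans (tv_dist_convex (ltW t0) t1 um utE)); rewrite lte_fin.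
  have utc : concentrated_on omega1 ut.
    exact: plan_concentrated (plan_mconv ab pim pip').
  have mtI (f : V -> R) : C0 Omega f -> \int[mt]_(x in omega1) f x =
      (1 - t) * \int[m]_(x in omega1) f x + t * \int[m']_(x in omega1) f x.
    move=> Cf; have [N [_ fN]] := C0_bounded comega1 Cf; have [cf _] := Cf.
    apply: (Rintegral_mconv a b m m' mo1 _ fN).
    by apply: measurable_funTS; exact: continuous_measurable_rV_real.
  have seg := solution_segment oOmega bOmega n0 comega1 q1 nq wp um um' utmt mtI.
  have [Wut _] : poisson_solution Omega q (Estar Omega omega1 ut) (solution_operator Omega omega1 q ut).
    exact: (solution_operatorP oOmega bOmega n0 comega1 nq wp utmt).
  have Wseg : W1p0 Omega q (fun x => Su x + t * h x).
    rewrite (_ : (fun x => _) = fun x => t * h x + Su x).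
      by apply: W1p0_lin => //; exact: ltW.
    by apply/funext => x; rewrite addrC.
  have Jut : J (solution_operator Omega omega1 q ut) = J (fun x => Su x + t * h x).
    exact: (continuous_on_W1p0_ae oOmega q1 cJ Wseg Wut seg).
  have := hmin _ utc tvlt; rewrite /objective Jut optimal_costE -/Su => fmin.
  have : J Su + alpha * optimal_cost <= J (fun x => Su x + t * h x) +
      alpha * ((1 - t) * optimal_cost + t * plan_cost pi').
    apply/ler_addgt0Pr => e e0.
    (* Mixing a plan for [ubar], optimal up to e / alpha, with pi' produces a plan for [ut] and thus
       bounds its transport cost. *)
    have [pie piep piec] := near_optimal_plan (divr_gt0 e0 alpha0).
    have piem : plan m pie by have [c1 f1 s1] := piep; split=> // A mA; rewrite s1// um.
    pose pit : {finite_measure set (V * V)%type -> \bar R} := mconv a b pie pi'.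
    have /optimal_cost_le tc : plan ut pit by exact: plan_mconv.
    have [N hN] := cost_bounded.
    have pitE : plan_cost pit = (1 - t) * plan_cost pie + t * plan_cost pi'.
      by apply: (Rintegral_mconv a b pie pi' mZ _ hN); exact: measurable_funTS.
    have aE0 : (0 <= alpha%:E)%E by rewrite lee_fin ltW.
    have := le_trans fmin (leeD2l _ (lee_wpmul2l aE0 tc)).
    rewrite -!EFinM -!EFinD lee_fin pitE => H.
    have ea : 0 <= e / alpha by rewrite divr_ge0 ?ltW.
    have h1 : (1 - t) * plan_cost pie <= (1 - t) * optimal_cost + e / alpha.
      rewrite (le_trans (ler_wpM2l t1' piec))// mulrDr lerD2l ler_piMl// gerBl.
      exact: ltW.
    have := ler_wpM2l (ltW alpha0) h1.
    rewrite (mulrDr alpha ((1 - t) * optimal_cost)) (mulrC e) mulVKf ?gt_eqF//; lra.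
  move=> Hm; rewrite [leRHS]mulrC ler_pdivlMr//; lra.
(* [K] may vanish, and division by zero yields 0; the added 1 keeps the threshold positive. *)
have Kr : 0 < r / (2 * K + 1) by rewrite divr_gt0// ltr_wpDl// mulr_ge0.
have Jlim' : t^-1 * (J (fun x => Su x + t * h x) - J Su) @[t --> 0^'+] --> dJ Su h.
  exact: cvg_dnbhs_at_right.
rewrite -(cvg_lim _ Jlim')//; apply: limr_ge; first by apply/cvg_ex; exists (dJ Su h).
near=> t; apply: key.
- by near: t; exact: nbhs_right_gt.
- by near: t; exact: nbhs_right_le.
- have : t < r / (2 * K + 1) by near: t; exact: nbhs_right_lt.
  rewrite ltr_pdivlMr ?ltr_wpDl// ?mulr_ge0//.
  have : 0 < t by near: t; exact: nbhs_right_gt.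
  nra.
Unshelve. all: by end_near. Qed.

End variational_inequality.

(** * The contact set *)

Section contact.
Context (R : realType) (n : nat).
Local Notation V := 'rV[R]_n.
Variables (omega0 omega1 : set V).
Hypotheses (comega0 : compact omega0) (comega1 : compact omega1) (ne1 : omega1 !=set0).
Variables (alpha : R) (p : V -> R).
Hypotheses (alpha0 : 0 < alpha) (cp : continuous p).
Implicit Types (x xi eta : V) (K : set V) (s : seq V).

Let mo0 : measurable omega0. Proof. exact: compact_rV_measurable. Qed.
Let mo1 : measurable omega1. Proof. exact: compact_rV_measurable. Qed.

Definition phase x xi : R := p xi + alpha * enorm (x - xi).

(** The nonempty list is given as head [xi0] and tail [s]. A selection made by finitely many
    comparisons of measurable functions is measurable in x. *)
Fixpoint argmin xi0 s x : V :=
  if s is xi :: s' then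
    let eta := argmin xi0 s' x in if phase x xi <= phase x eta then xi else eta
  else xi0.

Lemma argmin_le xi0 s x xi : xi \in xi0 :: s -> phase x (argmin xi0 s x) <= phase x xi.
Proof.
elim: s => [|eta s IH]; first by rewrite inE => /eqP ->.
rewrite !inE => h /=; case: ifPn => [le|]; last rewrite -ltNge => /ltW lt.
  case/or3P : h => [xi0E|/eqP ->//|xis]; apply: (le_trans le); apply: IH;
    by rewrite inE ?xi0E ?xis ?orbT.
case/or3P : h => [xi0E|/eqP ->//|xis]; apply: IH; by rewrite inE ?xi0E ?xis ?orbT.
Qed.

Lemma argmin_mem xi0 s x : argmin xi0 s x \in xi0 :: s.
Proof.
elim: s => [|eta s IH] /=; first by rewrite inE.
case: ifP => _; first by rewrite !inE eqxx orbT.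
by move: IH; rewrite !inE => /orP[->//|->]; rewrite !orbT.
Qed.

Lemma measurable_phase d (T : measurableType d) (f g : T -> V) :
  measurable_fun setT f -> measurable_fun setT g ->
  measurable_fun setT (fun t => phase (f t) (g t)).
Proof.
move=> mf mg; apply: measurable_funD.
  exact: measurableT_comp (continuous_measurable_rV_real cp) mg.
by apply: measurable_funM => //; exact: measurable_enorm_sub.
Qed.

Lemma measurable_argmin xi0 s : measurable_fun setT (argmin xi0 s).
Proof.
elim: s => [|eta s IH] /=; first exact: measurable_cst.
apply: measurable_fun_if => //.
- by apply: measurable_fun_ler; apply: measurable_phase.
- exact: measurable_funTS.
Qed.

Lemma phase_continuous : continuous (fun z : V * V => phase z.1 z.2).
Proof.
move=> z; apply: cvgD; first by apply: (@continuous_comp _ _ _ snd p); [exact: cvg_snd|exact: cp].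
apply: cvgM; first exact: cvg_cst.
apply: (@continuous_comp _ _ _ (fun z : V * V => z.1 - z.2) (@enorm R n)); last exact: enorm_continuous.
by apply: (cvgB (@cvg_fst _ _ (nbhs z.1) (nbhs z.2) _) (@cvg_snd _ _ (nbhs z.1) (nbhs z.2) _)).
Qed.

Lemma phase_continuousl eta : continuous (fun z : V * V => phase z.1 eta).
Proof.
move=> z; apply: cvgD; first exact: cvg_cst.
apply: cvgM; first exact: cvg_cst.
apply: (@continuous_comp _ _ _ (fun z : V * V => z.1 - eta) (@enorm R n)); last exact: enorm_continuous.
by apply: (cvgB (@cvg_fst _ _ (nbhs z.1) (nbhs z.2) _) (cvg_cst eta)).
Qed.

Lemma phase_continuousr x : continuous (phase x).
Proof.
have c1 : continuous (fun xi : V => enorm (x - xi)).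
  move=> xi; apply: (@continuous_comp _ _ _ (fun xi : V => x - xi) (@enorm R n)); last exact: enorm_continuous.
  rewrite (_ : (fun xi : V => x - xi) = fun xi : V => x + -1 *: xi).
    exact: continuous_affine_rV.
  by apply/funext => y; rewrite scaleN1r.
by move=> xi; apply: (cvgD (cp (x := xi)) (cvgM (cvg_cst alpha) (c1 xi))).
Qed.

(** By the triangle inequality, replacing eta by xi changes the phase by at most |p xi - p eta| +
    alpha |eta - xi|. This does not involve x, so one finite subcover of [omega1] serves all x. *)
Lemma finite_net (eps : R) : 0 < eps -> exists xi0 s,
  (forall xi, xi \in xi0 :: s -> omega1 xi) /\
  (forall x eta, omega1 eta -> exists2 xi, xi \in xi0 :: s & phase x xi <= phase x eta + eps).
Proof.
move=> e0; have e2 := divr_gt0 e0 (ltr0n R 2).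
have [xi0 oxi0] := ne1.
pose U xi : set V := [set eta | `|p xi - p eta| + alpha * enorm (eta - xi) < eps].
have oU xi : open (U xi).
  have c0 : continuous (fun eta : V => p xi - p eta).
    by move=> eta; apply: (cvgB (cvg_cst (p xi)) (cp (x := eta))).
  have c1 : continuous (fun eta : V => enorm (eta - xi)).
    move=> eta.
    apply: (@continuous_comp _ _ _ (fun eta : V => eta - xi) (@enorm R n)); last exact: enorm_continuous.
    rewrite (_ : (fun eta : V => eta - xi) = fun eta : V => - xi + 1 *: eta).
      exact: continuous_affine_rV.
    by apply/funext => y; rewrite scale1r addrC.
  have cf : continuous (fun eta => `|p xi - p eta| + alpha * enorm (eta - xi)).
    by move=> eta; apply: (cvgD (cvg_norm (c0 eta)) (cvgM (cvg_cst alpha) (c1 eta))).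
  by move/continuousP : cf => /(_ _ (@open_lt R eps)).
have := comega1; rewrite compact_cover => /(_ V omega1 U (fun xi _ => oU xi)).
case.
  move=> xi oxi; exists xi => //; rewrite /U/= !subrr normr0 add0r.
  by rewrite enorm0 mulr0.
move=> D Dsub cov; exists xi0, (finmap.enum_fset D); split.
  by move=> xi; rewrite inE => /orP[/eqP ->//|/Dsub/set_mem].
move=> x eta /cov[xi /= xiD]; rewrite /U/= => xe; exists xi; first by rewrite inE xiD orbT.
rewrite /phase.
have h1 := enorm_sub_triangle x eta xi.
have h2 := ler_norm (p xi - p eta).
have h3 : alpha * enorm (x - xi) <= alpha * enorm (x - eta) + alpha * enorm (eta - xi).
  by rewrite -mulrDr ler_wpM2l// ltW.
lra.
Qed.

Definition contact K (delta : R) : set V :=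
  [set x | omega0 x /\ exists2 xi, K xi &
    forall eta, omega1 eta -> phase x xi <= phase x eta + delta].

(** The projection of the pairs (x, xi) in [omega0 * K] satisfying the inequalities, which are
    closed conditions for each eta. *)
Lemma contact_compact K delta : compact K -> compact (contact K delta).
Proof.
move=> cK.
pose F := [set z : V * V | (omega0 `*` K) z /\
  forall eta, omega1 eta -> phase z.1 z.2 - phase z.1 eta <= delta].
have -> : contact K delta = fst @` F.
  apply/seteqP; split => [x [ox [xi Kxi h]]|_ [[x xi] [[/= ox Kxi] h] <-]].
    by exists (x, xi) => //; split=> // eta oeta; rewrite lerBlDl h.
  by split=> //; exists xi => // eta /h; rewrite lerBlDl.
apply: continuous_compact.
  by apply: continuous_subspaceT => z; exact: cvg_fst.
rewrite (_ : F = (omega0 `*` K) `&` \bigcap_(eta in omega1)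
    ((fun z : V * V => phase z.1 z.2 - phase z.1 eta) @^-1` [set t | t <= delta])).
  apply: compact_closedI; first exact: compact_setX.
  apply: closed_bigI => eta oeta; apply: (proj1 (continuous_closedP _)); last exact: closed_le.
  move=> z; apply: cvgB; first exact: phase_continuous.
  exact: phase_continuousl.
by apply/seteqP; split => z.
Qed.

(** A minimizer of [phase x] over the compact [K] is at least as good as each approximate one, so a
    single point works for all k, hence with error 0. *)
Lemma contact0_bigcap K : compact K ->
  \bigcap_k contact K k.+1%:R^-1 = contact K 0.
Proof.
move=> cK; apply/seteqP; split => [x h|x [ox [xi Kxi h]] k _]; last first.
  split=> //; exists xi => // eta /h; rewrite addr0 => /le_trans; apply.
  by rewrite lerDl invr_ge0.
have [ox [xi0 Kxi0 _]] := h 0%N Logic.I; split=> //.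
have cph : {within K, continuous (phase x)}.
  exact/continuous_subspaceT/phase_continuousr.
have [xi /set_mem Kxi ximin] := EVT_min_rV (ex_intro _ xi0 Kxi0) cK cph.
exists xi => // eta oeta; apply/ler_addgt0Pr => e e0; rewrite addr0.
have [k _ /(_ k (leqnn k))/= ke] := near_infty_natSinv_lt (PosNum e0).
have [_ [xik Kxik /(_ eta oeta) hk]] := h k Logic.I.
by rewrite (le_trans (ximin xik (mem_set Kxik)))// (le_trans hk)// lerD2l ltW.
Qed.

Lemma phase_bounded K K' : compact K -> compact K' ->
  exists M, forall x xi, K x -> K' xi -> `|phase x xi| <= M.
Proof.
move=> cK cK'; have [M0 [_ h0]] := continuous_bounded_on (@enorm_continuous R n) cK.
have [M1 [_ h1]] := continuous_bounded_on (@enorm_continuous R n) cK'.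
have [M2 [_ h2]] := continuous_bounded_on cp cK'.
exists (M2 + alpha * (M0 + M1)) => x xi /h0 hx xiK; have hxi := h1 _ xiK.
rewrite /phase (le_trans (ler_normD _ _))// lerD ?h2// normrM gtr0_norm// ler_wpM2l ?(ltW alpha0)//.
rewrite ger0_norm ?enorm_ge0//; apply: (le_trans (enorm_sub_triangle x 0 xi)).
rewrite (enorm_sub_sym 0 xi) !subr0; apply: lerD.
  exact: le_trans (ler_norm _) hx.
exact: le_trans (ler_norm _) hxi.
Qed.

Let chain_le (a b c d delta eps : R) :
  a - b <= delta / 2 -> b <= c -> c <= d + eps -> eps <= delta / 2 -> a <= d + delta.
Proof. by lra. Qed.

(** * Comparison of the measure of K with that of its contact set *)

Section contact_measure.
Variables (u0 : {finite_measure set V -> \bar R}) (ubar : {charge set V -> \bar R}).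
Local Notation Z := (omega0 `*` omega1).
Local Notation plan := (transport_plan omega0 omega1 u0).
Hypothesis hu0 : concentrated_on omega0 u0.
(** Competitors keep the first marginal [u0] but have an arbitrary second marginal, which allows
    mass to be rerouted to the best point for each x. *)
Hypothesis near_optimal : forall eps : R, 0 < eps ->
  exists2 pi : {finite_measure set (V * V)%type -> \bar R}, plan ubar pi &
    forall (m' : {finite_measure set V -> \bar R}) (pi' : {finite_measure set (V * V)%type -> \bar R}),
      plan m' pi' ->
      \int[pi]_(z in Z) phase z.1 z.2 <= \int[pi']_(z in Z) phase z.1 z.2 + eps.

Let mZ : measurable Z. Proof. exact: measurableX. Qed.

Lemma graph_plan (T : V -> V) (mT : measurable_fun setT T)
    (mG : measurable_fun setT (fun x => (x, T x))) : (forall x, omega1 (T x)) ->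
  plan (image_finite_measure u0 mT) (image_finite_measure u0 mG).
Proof.
move=> To1; split=> [A mA A0|//|//].
rewrite image_finite_measureE; apply: hu0.
  by rewrite -[X in measurable X]setTI; exact: mG.
apply/seteqP; split=> // x [/= Ax ox].
have : (A `&` Z) (x, T x) by split=> //; split=> //; exact: To1.
by rewrite A0.
Qed.

(* Mass of a near-optimal plan landing on K from outside the contact set could
   be sent to a point of lower phase, with a gain of order delta. *)
Lemma contact_bound K (delta : R) : compact K -> K `<=` omega1 -> 0 < delta ->
  (ubar K <= u0 (contact K delta))%E.
Proof.
move=> cK Ko1 d0; apply/lee_addgt0Pr => e e0.
pose U := fine (u0 setT); have U0 : 0 <= U by rewrite fine_ge0.
have UE : u0 setT = U%:E by rewrite fineK// fin_num_measure.
(* The accuracy of the net. With the first bound, a point beaten by the net by at most delta / 2 is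
   a [delta]-minimizer over [omega1]; with the second, the net error summed over the mass of [u0] is
   at most e delta / 4. *)
pose eps0 := Num.min (delta / 2) (e * delta / 4 / (U + 1)).
have eps0_gt0 : 0 < eps0.
  by rewrite lt_min !divr_gt0 ?mulr_gt0// ltr_wpDl.
have eps0d : eps0 <= delta / 2 by rewrite ge_min lexx.
have eps0U : eps0 * U <= e * delta / 4.
  have : eps0 <= e * delta / 4 / (U + 1) by rewrite ge_min lexx orbT.
  rewrite ler_pdivlMr ?ltr_wpDl// => h; apply: le_trans h.
  by rewrite ler_wpM2l ?(ltW eps0_gt0)// lerDl.
have eps_gt0 : 0 < e * delta / 4 by rewrite divr_gt0// mulr_gt0.
have [pi pip piopt] := near_optimal eps_gt0.
have [xi0 [s [so1 net]]] := finite_net eps0_gt0.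
pose T := argmin xi0 s; have mT : measurable_fun setT T by exact: measurable_argmin.
have To1 x : omega1 (T x) by apply: so1; exact: argmin_mem.
have mG : measurable_fun setT (fun x => (x, T x)) by exact: measurable_fun_pair.
have [M phiM] := phase_bounded comega0 comega1.
have mph : measurable_fun setT (fun z : V * V => phase z.1 z.2).
  by apply: measurable_phase; [exact: measurable_fst|exact: measurable_snd].
have mphT : measurable_fun setT (fun x => phase x (T x)) by exact: measurable_phase.
have phZ z : Z z -> `|phase z.1 z.2| <= M by move=> [h1 h2]; exact: phiM.
have phT x : omega0 x -> `|phase x (T x)| <= M by move=> ox; exact: phiM.
have piE : \int[image_finite_measure u0 mG]_(z in Z) phase z.1 z.2 =
    \int[pi]_(z in Z) phase z.1 (T z.1).
  rewrite (Rintegral_image u0 mG mZ mph phZ) -(plan_fst comega0 comega1 pip mphT phT).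
  congr Rintegral; apply/seteqP; split => [x []//|x ox]; split=> //=.
have opt : \int[pi]_(z in Z) phase z.1 z.2 <= \int[pi]_(z in Z) phase z.1 (T z.1) + e * delta / 4.
  by rewrite -piE; apply: piopt; exact: graph_plan.
pose gap (z : V * V) := phase z.1 z.2 - phase z.1 (T z.1).
have mphT1 : measurable_fun setT (fun z : V * V => phase z.1 (T z.1)).
  by apply: (measurableT_comp mphT); exact: measurable_fst.
have mgap : measurable_fun setT gap by exact: measurable_funB.
have i1 : pi.-integrable Z (EFin \o (fun z => phase z.1 z.2)).
  by apply: (integrable_bounded pi mZ _ phZ); exact: measurable_funTS.
have i2 : pi.-integrable Z (EFin \o (fun z => phase z.1 (T z.1))).
  by apply: (@integrable_bounded _ _ _ pi _ _ M mZ) => [|z [/phT]//]; exact: measurable_funTS.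
have igap : pi.-integrable Z (EFin \o gap) by exact: (integrableB mZ i1 i2).
have gapI : \int[pi]_(z in Z) gap z <= e * delta / 4.
  by rewrite /gap RintegralB// lerBlDr addrC.
have gap_ge z : Z z -> - eps0 <= gap z.
  move=> [oz1 oz2]; have [xi xis h] := net z.1 z.2 oz2.
  have := argmin_le z.1 xis; rewrite -/T => /le_trans/(_ h).
  by rewrite /gap lerNl opprB lerBlDl.
pose E := Z `&` [set z | delta / 2 < gap z].
have mE : measurable E.
  apply: measurableI => //; rewrite (_ : [set z | _] = gap @^-1` `]delta / 2, +oo[).
    by rewrite -[X in measurable X]setTI; apply: mgap => //; exact: measurable_itv.
  by apply/seteqP; split => z /=; rewrite in_itv/= andbT.
have pi_Z : fine (pi Z) <= U.
  have [_ p1 _] := pip; rewrite -lee_fin -UE fineK ?fin_num_measure// -(p1 setT)//.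
  rewrite /pushforward preimage_setT; apply: le_measure => //.
    exact: mem_set.
  exact: mem_set measurableT.
(* [T] minimizes over the net only, so [gap] may drop to [- eps0]. The nonnegative function
   [gap + eps0] has integral at most twice e delta / 4 and is at least delta / 2 on [E]. *)
have markov : delta / 2 * fine (pi E) <= e * delta / 2.
  have iE : pi.-integrable Z (EFin \o (fun z => delta / 2 * \1_E z)).
    apply: (@integrable_bounded _ _ _ pi _ _ (delta / 2) mZ) => [|z _].
      by apply: measurable_funM => //; exact: measurable_indic.
    by rewrite normrM indicE ger0_norm ?divr_ge0 ?(ltW d0)// ler_piMr ?divr_ge0 ?(ltW d0)//;
      case: (_ \in _); rewrite ?normr1 ?normr0.
  have ic : pi.-integrable Z (EFin \o cst eps0) by exact: finite_measure_integrable_cst.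
  have <- : \int[pi]_(z in Z) (delta / 2 * \1_E z) = delta / 2 * fine (pi E).
    rewrite RintegralZl//; last first.
      apply: (@integrable_bounded _ _ _ pi _ _ 1 mZ) => [|z _].
        exact: measurable_indic.
      by rewrite indicE; case: (_ \in _); rewrite ?normr1 ?normr0.
    by rewrite /Rintegral integral_indic// setIAC setIid.
  apply: (@le_trans _ _ (\int[pi]_(z in Z) (gap z + eps0))).
    apply: le_Rintegral => //; first exact: (integrableD mZ igap ic).
    move=> z Zz; rewrite indicE; case: (boolP (z \in E)) => [/set_mem[_ /= zE]|_].
      by rewrite mulr1 ltW// ltr_wpDr// ltW.
    by rewrite mulr0 -lerBlDr sub0r gap_ge.
  rewrite RintegralD// Rintegral_cst//.
  have h : eps0 * fine (pi Z) <= e * delta / 4.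
    exact: le_trans (ler_wpM2l (ltW eps0_gt0) pi_Z) eps0U.
  by rewrite (le_trans (lerD gapI h))// le_eqVlt; apply/orP; left; apply/eqP; field.
have piEe : (pi E <= e%:E)%E.
  rewrite -[pi E]fineK ?fin_num_measure// lee_fin.
  have d2 : 0 < delta / 2 by rewrite divr_gt0.
  by rewrite -(ler_pM2l d2) (le_trans markov)// le_eqVlt; apply/orP; left; apply/eqP; field.
have mC : measurable (contact K delta).
  by apply: compact_rV_measurable; exact: contact_compact.
have mK := compact_rV_measurable cK.
have [cpi p1 p2] := pip.
have mC1 : measurable (fst @^-1` contact K delta : set (V * V)).
  by rewrite -[X in measurable X]setTI; exact: measurable_fst.
have mK2 : measurable (snd @^-1` K : set (V * V)).
  by rewrite -[X in measurable X]setTI; exact: measurable_snd.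
rewrite -p2// -p1// /pushforward (concentrated_setI cpi mZ mK2) addeC.
(* A pair over [K] outside [E] has gap at most delta / 2, so its first point is in the contact
   set. *)
apply: (@le_trans _ _ (pi (E `|` fst @^-1` contact K delta))).
  apply: le_measure.
  - by apply: mem_set; exact: measurableI.
  - by apply: mem_set; exact: measurableU.
  move=> -[x xi] [/= Kxi [/= ox oxi]].
  have [gz|gz] := ltP (delta / 2) (gap (x, xi)); first by left.
  right; split=> //; exists xi => // eta oeta.
  have [xi' xi's h] := net x eta oeta; have := argmin_le x xi's.
  by rewrite -/T => hT; exact: chain_le gz hT h eps0d.
by apply: (le_trans (measureU2 _ _ _)) => //; rewrite leeD2r.
Qed.

(** The finite measure [u0] is continuous along the contact sets decreasing to [contact K 0]. *)
Lemma contact_null K : compact K -> K `<=` omega1 -> u0 (contact K 0) = 0%E ->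
  (ubar K <= 0)%E.
Proof.
move=> cK Ko1 N0.
have mC k : measurable (contact K k.+1%:R^-1).
  by apply: compact_rV_measurable; exact: contact_compact.
have nd : nonincreasing_seq (fun k => contact K k.+1%:R^-1).
  move=> i j ij; apply/subsetPset => x [ox [xi Kxi h]]; split=> //.
  exists xi => // eta /h /le_trans; apply; rewrite lerD2l lef_pV2 ?posrE//.
  by rewrite ler_nat.
have := @nonincreasing_cvg_mu _ _ _ u0 (fun k => contact K k.+1%:R^-1).
move=> /(_ _ mC _ nd) H.
have {}H : u0 (contact K k.+1%:R^-1) @[k --> \oo] --> 0%E.
  rewrite -N0 -contact0_bigcap//; apply: H.
    by rewrite ltey_eq fin_num_measure.
  exact: bigcapT_measurable.
rewrite -(cvg_lim _ H)//; apply: lime_ge; first by apply/cvg_ex; exists 0%E.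
by apply: nearW => k; apply: contact_bound => //; rewrite invr_gt0.
Qed.

End contact_measure.
End contact.

(** * Inner regularity *)

Section inner_regularity.
Context (R : realType) (n : nat).
Local Notation V := 'rV[R]_n.
Variable m : {finite_measure set V -> \bar R}.

Definition approximable (A : set V) := measurable A /\ forall e : R, 0 < e ->
  exists F U : set V, [/\ closed F, open U, F `<=` A, A `<=` U & (m (U `\` F) <= e%:E)%E].

(** A countable union of closed sets need not be closed; continuity from above allows it to be cut
    to a finite union at the price of e. *)
Lemma bigcup_exhaust (F : nat -> set V) (W : set V) (e : R) :
  (forall k, closed (F k)) -> measurable W -> 0 < e ->
  exists N, (m (W `\` \big[setU/set0]_(k < N) F k) <= m (W `\` \bigcup_k F k) + e%:E)%E.
Proof.
move=> cF mW e0; have mF k : measurable (F k) by exact: closed_rV_measurable.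
pose D N := W `\` \big[setU/set0]_(k < N) F k.
have mD N : measurable (D N) by apply: measurableD => //; exact: bigsetU_measurable.
have nd : nonincreasing_seq D.
  move=> i j ij; apply/subsetPset => x [Wx nx]; split=> // h; apply: nx.
  by move: x h {Wx}; exact: subset_bigsetU.
have DE : \bigcap_N D N = W `\` \bigcup_k F k.
  apply/seteqP; split => [x h|x [Wx nx] N _].
    split; first by have [] := h 0%N Logic.I.
    move=> [k _ Fx]; have [_] := h k.+1 Logic.I; apply.
    by rewrite big_ord_recr; right.
  split=> // h; apply: nx; move: h; rewrite -bigcup_mkord => -[k _ Fx].
  by exists k.
have H : m (D N) @[N --> \oo] --> m (W `\` \bigcup_k F k).
  rewrite -DE; apply: nonincreasing_cvg_mu => //.
    by rewrite ltey_eq fin_num_measure.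
  exact: bigcapT_measurable.
have fW : m (W `\` \bigcup_k F k) \is a fin_num.
  by apply: fin_num_measure; rewrite -DE; exact: bigcapT_measurable.
have Hf : fine (m (D N)) @[N --> \oo] --> fine (m (W `\` \bigcup_k F k)).
  by apply: fine_cvg; rewrite fineK.
have /cvgrPdist_lt/(_ e e0)[N _ /(_ N (leqnn N))/= hN] := Hf.
exists N; rewrite -/(D N) -[m (D N)]fineK ?fin_num_measure// -[X in (_ <= X + _)%E]fineK//.
rewrite -EFinD lee_fin; move: hN; rewrite ltr_distlC => /andP[_ /ltW].
by rewrite addrC.
Qed.

Lemma open_approximable (U : set V) : open U -> approximable U.
Proof.
move=> oU; split; first exact: open_rV_measurable.
move=> e e0; have mU := open_rV_measurable oU.
pose F k : set V := if unpickle k is Some i then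
  (if `[< qcball i `<=` U >] then qcball i else set0) else set0.
have cF k : closed (F k).
  rewrite /F; case: unpickle => [i|]; last exact: closed0.
  case: ifPn => _; last exact: closed0.
  by apply: compact_closed; [exact: norm_hausdorff|exact: qcball_compact].
have FU : \bigcup_k F k = U.
  rewrite [RHS](open_bigcup_qcball oU); apply/seteqP; split => [x [k _]|x [i _ xi]].
    by rewrite /F; case: unpickle => // i xi; exists i.
  by exists (pickle i) => //; rewrite /F pickleK.
have [N] := bigcup_exhaust cF mU e0; rewrite FU setDv measure0 add0e => hN.
exists (\big[setU/set0]_(k < N) F k), U; split=> //.
  by apply: closed_bigsetU => k _; exact: cF.
by rewrite -bigcup_mkord => x [k _ Fx]; rewrite -FU; exists k.
Qed.

(** The approximable sets form a sigma-algebra containing the open sets; complements exchange the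
    roles of the closed and the open set. *)
Lemma approximable_measurable (A : set V) : measurable A -> approximable A.
Proof.
move: A; apply: smallest_sub; last exact: open_approximable.
split.
- split=> // e e0; exists set0, set0; split=> //.
    exact: closed0.
  by rewrite setDv measure0 lee_fin ltW.
- move=> A [mA aA]; rewrite setTD; split; first exact: measurableC.
  move=> e e0; have [F [U [cF oU FA AU mUF]]] := aA e e0.
  exists (~` U), (~` F); split.
  + exact: open_closedC.
  + exact: closed_openC.
  + exact: subsetC.
  + exact: subsetC.
  + by rewrite setDE setCK setIC -setDE.
- move=> A aA; have mA k : measurable (A k) by have [] := aA k.
  split; first exact: bigcupT_measurable.
  (* Half of e pays for truncating the union of the closed sets, the other half is distributed
     geometrically over the sets [A k]. *)
  move=> e e0; have e2 := divr_gt0 e0 (ltr0n R 2).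
  have P k : exists FU : set V * set V, [/\ closed FU.1, open FU.2, FU.1 `<=` A k, A k `<=` FU.2 &
      (m (FU.2 `\` FU.1) <= (e / 2 / (2 ^ k.+1)%:R)%:E)%E].
    have ek : 0 < e / 2 / (2 ^ k.+1)%:R by rewrite divr_gt0// ltr0n expn_gt0.
    by have [_ /(_ _ ek)[F [U h]]] := aA k; exists (F, U).
  pose FU k := projT1 (cid (P k)).
  have FUP k : [/\ closed (FU k).1, open (FU k).2, (FU k).1 `<=` A k, A k `<=` (FU k).2 &
      (m ((FU k).2 `\` (FU k).1) <= (e / 2 / (2 ^ k.+1)%:R)%:E)%E] := projT2 (cid (P k)).
  have cF k : closed (FU k).1 by have [] := FUP k.
  have oU k : open (FU k).2 by have [] := FUP k.
  pose W := \bigcup_k (FU k).2.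
  have oW : open W by apply: bigcup_open => k _.
  have mW := open_rV_measurable oW.
  have [N hN] := bigcup_exhaust cF mW e2.
  exists (\big[setU/set0]_(k < N) (FU k).1), W; split=> //.
  + by apply: closed_bigsetU => k _; exact: cF.
  + rewrite -(bigcup_mkord N (fun k => (FU k).1)) => x [k _ Fx]; exists k => //.
    by have [_ _ FA _ _] := FUP k; exact: FA.
  + move=> x [k _ Ax]; exists k => //.
    by have [_ _ _ AU _] := FUP k; exact: AU.
  apply: (le_trans hN); rewrite [leRHS](_ : _ = (e / 2)%:E + (e / 2)%:E)%E; last first.
    by rewrite -EFinD -splitr.
  rewrite leeD2r//.
  have mD k : measurable ((FU k).2 `\` (FU k).1).
    by apply: measurableD; [exact: open_rV_measurable|exact: closed_rV_measurable].
  apply: (@le_trans _ _ (\sum_(0 <= k <oo) m ((FU k).2 `\` (FU k).1))%E).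
    apply: measure_sigma_subadditive => //.
      by apply: measurableD => //; apply: bigcupT_measurable => k; exact: closed_rV_measurable.
    by move=> x [[k _ Ux] nF]; exists k => //; split=> // Fx; apply: nF; exists k.
  apply: (@le_trans _ _ (\sum_(0 <= k <oo) (0%E + (e / 2 / (2 ^ k.+1)%:R)%:E))%E).
    apply: lee_nneseries => // k _.
    by rewrite add0e; have [] := FUP k.
  apply: (le_trans (epsilon_trick _ _ (ltW e2))) => //.
  by rewrite eseries0// add0e.
Qed.

Lemma measure_closed_null (A : set V) : measurable A ->
  (forall F, closed F -> F `<=` A -> m F = 0%E) -> m A = 0%E.
Proof.
move=> mA h; have [_ aA] := approximable_measurable mA.
apply/eqP; rewrite eq_le measure_ge0 andbT; apply/lee_addgt0Pr => e e0; rewrite add0e.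
have [F [U [cF oU FA AU mUF]]] := aA e e0.
have mF := closed_rV_measurable cF; have mU := open_rV_measurable oU.
apply: (@le_trans _ _ (m (F `|` (U `\` F)))).
  apply: le_measure; rewrite ?inE//; first by apply: measurableU => //; exact: measurableD.
  by move=> x Ax; have [Fx|nF] := pselect (F x); [left|right; split=> //; exact: AU].
apply: (le_trans (measureU2 _ _ _)) => //; first exact: measurableD.
have mF0 : m F = 0%E by exact: h.
have -> : (m F + m (U `\` F) = m (U `\` F))%E by rewrite mF0 add0e.
by [].
Qed.

End inner_regularity.

(** * Geometry of the contact set *)

Definition rays (R : realType) (n : nat) (g : 'rV[R]_n -> 'rV[R]_n) (M : R)
    (A : set 'rV[R]_n) : set 'rV[R]_n :=
  [set x | exists2 xi, A xi & exists2 s, 0 <= s <= M & x = xi + s *: g xi].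

Section rays.
Context (R : realType) (k : nat).
Local Notation V := 'rV[R]_k.+1.
Local Notation lam := (lebesgue_rV R k.+1).
Variables (K : set V) (g : V -> V) (L G M : R).
Hypotheses (L0 : 0 <= L) (G0 : 0 <= G) (M0 : 0 <= M).
Hypothesis gL : forall x y, K x -> K y -> enorm (g x - g y) <= L * enorm (x - y).
Hypothesis gG : forall x, K x -> `|g x| <= G.

(** [Lambda * r] exceeds the distance from a swept point to the nearest sampled one: r for moving
    the base point, M L r for the change of direction, G r for rounding the parameter down to a
    multiple of r, and one more r for strictness. At most M / r + 1 <= (M + 1) / r cubes of side 2
    Lambda r are used, of total volume C r^k. *)
Let Lambda := 2 + M * L + G.
Let C := (M + 1) * (Lambda *+ 2) ^+ k.+1.

Let Lambda0 : 0 < Lambda.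
Proof. by rewrite /Lambda; have := mulr_ge0 M0 L0; have := G0; lra. Qed.

Let C0 : 0 <= C.
Proof.
by rewrite /C mulr_ge0 ?addr_ge0 ?exprn_ge0 ?mulrn_wge0 ?(ltW Lambda0).
Qed.

(* A piece of diameter r sweeps out a tube, covered by about M / r balls of
   radius of order r. *)
Lemma rays_cover (A : set V) (r : R) : 0 < r <= 1 ->
  (forall x y, A x -> A y -> enorm (x - y) <= r) ->
  exists B, [/\ measurable B, rays g M (A `&` K) `<=` B & (lam B <= (C * r ^+ k)%:E)%E].
Proof.
move=> /andP[r0 r1] Ar.
have [[xi0 [A0 K0]]|nAK] := pselect (exists x, (A `&` K) x); last first.
  exists set0; split => //; first by move=> x [xi AK]; case: nAK; exists xi.
  by rewrite measure0 lee_fin mulr_ge0 ?exprn_ge0// ltW.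
pose N := (Num.truncn (M / r)).+1.
pose b (j : nat) : set V := ball (xi0 + (j%:R * r) *: g xi0) (Lambda * r).
have mb j : measurable (b j) by apply: open_rV_measurable; exact: ball_open.
have Lr0 : 0 < Lambda * r by rewrite mulr_gt0.
exists (\big[setU/set0]_(j < N) b j); split; first exact: bigsetU_measurable.
  move=> _ [xi [Axi Kxi] [s /andP[s0 sM] ->]].
  have sr0 : 0 <= s / r by rewrite divr_ge0// ltW.
  have /andP[jl ju] := truncn_itv sr0; set j := Num.truncn (s / r) in jl ju.
  rewrite -bigcup_mkord; exists j.
    by rewrite /N /= ltnS; apply: le_truncn; rewrite ler_pM2r ?invr_gt0.
  rewrite /b -ball_normE /=.
  have -> : xi0 + (j%:R * r) *: g xi0 - (xi + s *: g xi) =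
      (xi0 - xi) + s *: (g xi0 - g xi) - (s - j%:R * r) *: g xi0.
    by rewrite scalerBr scalerBl; apply/rowP => i; rewrite !mxE; ring.
  have E1 := Ar _ _ A0 Axi.
  have E2 : `|s *: (g xi0 - g xi)| <= M * (L * r).
    rewrite normrZ (ger0_norm s0); apply: ler_pM => //.
    apply: (le_trans (norm_le_enorm _)); apply: (le_trans (gL K0 Kxi)).
    by rewrite ler_wpM2l.
  have E3 : `|(s - j%:R * r) *: g xi0| <= r * G.
    rewrite normrZ; apply: ler_pM => //; last exact: gG.
    move: jl ju; rewrite ler_pdivlMr// ltr_pdivrMr// => jl ju.
    move: ju; rewrite -natr1 mulrDl mul1r => ju.
    by rewrite ger0_norm ?subr_ge0// lerBlDr addrC ltW.
  apply: (le_lt_trans (ler_normB _ _)).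
  apply: (@le_lt_trans _ _ (r + M * (L * r) + r * G)).
    apply: lerD => //; apply: (le_trans (ler_normD _ _)); apply: lerD => //.
    exact: le_trans (norm_le_enorm _) E1.
  have -> : Lambda * r = (r + M * (L * r) + r * G) + r by rewrite /Lambda; ring.
  by rewrite ltrDl.
have sub : (lam (\big[setU/set0]_(j < N) b j) <= \sum_(j < N) lam (b j))%E.
  apply: (@content_subadditive _ _ _ lam _ b N) => //.
  exact: bigsetU_measurable.
apply: (le_trans sub).
apply: (@le_trans _ _ (\sum_(j < N) ((Lambda * r *+ 2) ^+ k.+1)%:E)%E).
  by apply: lee_sum => j _; have -> := lebesgue_rV_ball (xi0 + (j%:R * r) *: g xi0) Lr0.
rewrite sumEFin lee_fin sumr_const card_ord -[_ *+ N]mulr_natl.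
have E : (Lambda * r *+ 2) ^+ k.+1 = (Lambda *+ 2) ^+ k.+1 * r ^+ k * r.
  by rewrite -mulrnAl exprMn -mulrA -exprSr.
rewrite E /C [_ * r]mulrC mulrA -(mulrA (M + 1)).
apply: ler_wpM2r.
  by rewrite mulr_ge0 ?exprn_ge0 ?mulrn_wge0 ?(ltW r0) ?(ltW Lambda0).
have /andP[jl _] := truncn_itv (divr_ge0 M0 (ltW r0)).
rewrite /N -natr1 mulrDl mul1r; apply: lerD => //.
by move: jl; rewrite ler_pdivlMr.
Qed.

Lemma rays_null (N : set V) : (0 < k)%N -> (hausdorff k%:R K <= 0)%E ->
  measurable N -> N `<=` rays g M K -> lam N = 0%E.
Proof.
move=> k0 hK mN NK.
apply/eqP; rewrite eq_le measure_ge0 andbT; apply/lee_addgt0Pr => e e0; rewrite add0e.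
pose eps := e / (C + 1) / 2.
have C1 : 0 < C + 1 by rewrite ltr_wpDl.
have eps0 : 0 < eps by rewrite !divr_gt0.
(* Covers at scale 1 are enough: [rays_cover] requires only diameters at most 1. *)
have : (hausdorff_pre k%:R 1 K < eps%:E)%E.
  apply: (@le_lt_trans _ _ 0%E); last by rewrite lte_fin.
  by apply: le_trans hK; apply: ereal_sup_ubound; exists 1 => //=; exact: ltr01.
move=> /ereal_inf_lt[_ [A [KA Ad ->]] Aeps].
have dA0 i : (0 <= ediam (A i))%E by apply: ereal_sup_ubound; left.
pose d i := fine (ediam (A i)).
have dE i : ediam (A i) = (d i)%:E.
  by rewrite fineK// ge0_fin_numE// (le_lt_trans (Ad i))// ltry.
have d0 i : 0 <= d i by rewrite fine_ge0.
have d1 i : d i <= 1 by have := Ad i; rewrite dE lee_fin.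
have dP i x y : A i x -> A i y -> enorm (x - y) <= d i.
  move=> Ax Ay; rewrite -lee_fin -dE; apply: ereal_sup_ubound; right.
  by exists x, y.
pose h i : R := eps / (2 ^ i.+1)%:R.
have h0 i : 0 < h i by rewrite divr_gt0// ltr0n expn_gt0.
(* Pieces may have diameter 0, whereas [rays_cover] needs a positive radius. Padding by [eta i] adds
   at most [h i] to the k-th power, as k > 0, and the [h i] sum to [eps]; so the total is at most C
   (eps + eps) <= e. *)
pose eta i := Num.min 1 (h i).
have eta0 i : 0 < eta i by rewrite lt_min ltr01 h0.
pose r i := Num.max (d i) (eta i).
have r01 i : 0 < r i <= 1 by rewrite lt_max eta0 orbT /= ge_max d1 ge_min lexx.
have Ar i x y : A i x -> A i y -> enorm (x - y) <= r i.
  by move=> Ax Ay; rewrite le_max dP.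
have rE i : r i ^+ k <= d i ^+ k + h i.
  rewrite /r; have [_|_] := leP (d i) (eta i); last by rewrite lerDl ltW.
  rewrite ler_wpDl ?exprn_ge0//; apply: (@le_trans _ _ (eta i)).
    by apply: ler_iXnr; rewrite ?k0 ?(ltW (eta0 i))// /eta ge_min lexx.
  by rewrite ge_min lexx orbT.
have P i := cid (rays_cover (r01 i) (Ar i)).
pose B i := projT1 (P i).
have [mB KB lB] : [/\ forall i, measurable (B i), forall i, rays g M (A i `&` K) `<=` B i &
    forall i, (lam (B i) <= (C * r i ^+ k)%:E)%E].
  by split=> i; have [] := projT2 (P i).
have NB : N `<=` \bigcup_i B i.
  move=> x /NK[xi Kxi hx]; have [i _ Ai] := KA _ Kxi.
  by exists i => //; apply: KB; exists xi.
apply: (le_trans (measure_sigma_subadditive _ mB mN NB)).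
apply: (@le_trans _ _ (\sum_(0 <= i <oo) (C%:E * (ediam (A i) `^ k%:R + (eps / (2 ^ i.+1)%:R)%:E)))%E).
  apply: lee_nneseries => // i _; apply: (le_trans (lB i)).
  rewrite dE poweR_EFin powR_mulrn// -EFinD -EFinM lee_fin.
  by apply: ler_wpM2l.
have T0 i : (0 <= ediam (A i) `^ k%:R)%E by exact: poweR_ge0.
rewrite nneseriesZl; last first.
  by move=> i _; rewrite adde_ge0// lee_fin ltW//; exact: h0.
apply: (@le_trans _ _ (C%:E * (eps%:E + eps%:E))%E).
  apply: lee_wpmul2l; first by rewrite lee_fin.
  apply: (le_trans (epsilon_trick _ _ (ltW eps0))) => //.
  by rewrite leeD2r// ltW.
rewrite -EFinD -EFinM lee_fin.
have -> : eps + eps = e / (C + 1) by rewrite /eps -splitr.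
rewrite mulrCA -[leRHS]mulr1 ler_wpM2l ?(ltW e0)// ler_pdivrMr// mul1r.
by rewrite lerDl.
Qed.

End rays.

Lemma hausdorff_rays_null (R : realType) (n : nat) (K N : set 'rV[R]_n)
    (g : 'rV[R]_n -> 'rV[R]_n) (L G M : R) :
  (1 < n)%N -> 0 <= L -> 0 <= G -> 0 <= M ->
  (forall x y, K x -> K y -> enorm (g x - g y) <= L * enorm (x - y)) ->
  (forall x, K x -> `|g x| <= G) ->
  (hausdorff (n%:R - 1) K <= 0)%E ->
  measurable N -> N `<=` rays g M K -> lebesgue_rV R n N = 0%E.
Proof.
case: n K N g => [//|k] K N g; rewrite -natr1 addrK => k0 L0 G0 M0 gL gG.
exact: rays_null gL gG _ k0.
Qed.

Lemma le_hausdorff (R : realType) (n : nat) (s : R) (A B : set 'rV[R]_n) :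
  A `<=` B -> (hausdorff s A <= hausdorff s B)%E.
Proof.
move=> AB; apply: ub_ereal_sup => _ [delta d0 <-].
apply: (@le_trans _ _ (hausdorff_pre s delta B)).
  apply: le_ereal_inf => _ [C [BC Cd ->]]; exists C; split=> //.
  exact: subset_trans BC.
by apply: ereal_sup_ubound; exists delta.
Qed.

(** * First order condition for minimizers of the phase *)

Section critical.
Context (R : realType) (n : nat).
Local Notation V := 'rV[R]_n.
Implicit Types (x xi v w : V).

Lemma edot_line w v (s : R) :
  edot (w + s *: v) (w + s *: v) = edot w w + s * (edot w v *+ 2) + s ^+ 2 * edot v v.
Proof.
rewrite -mulr_natl /edot !mulr_sumr -!big_split; apply: eq_bigr => i _ /=.
by rewrite !mxE; ring.
Qed.

Lemma edot_line_deriv w v (s : R) :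
  edot (w + s *: v) v = edot w v + s * edot v v.
Proof.
rewrite /edot !mulr_sumr -!big_split; apply: eq_bigr => i _ /=.
by rewrite !mxE; ring.
Qed.

Lemma is_derive_enorm_line w v (t : R) : 0 < enorm (w + t *: v) ->
  is_derive t 1 (fun s : R => enorm (w + s *: v)) (edot (w + t *: v) v / enorm (w + t *: v)).
Proof.
move=> e0; have Q0 : 0 < edot (w + t *: v) (w + t *: v) by rewrite -sqr_enorm exprn_gt0.
pose Q (s : R) := edot w w + s * (edot w v *+ 2) + s ^+ 2 * edot v v.
have dQ : is_derive t 1 Q ((edot (w + t *: v) v) *+ 2).
  rewrite edot_line_deriv; apply: is_derive_eq.
  rewrite /GRing.scale /= !(mulr0, mulr1, add0r, mul1r) mulrnDl.
  by rewrite [edot v v * _]mulrC -mulr2n mulrnAl.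
have -> : (fun s : R => enorm (w + s *: v)) = Num.sqrt \o Q.
  by apply/funext => s; rewrite /= /enorm edot_line.
rewrite edot_line in Q0.
have dS : is_derive (Q t) 1 Num.sqrt (2 * Num.sqrt (Q t))^-1 by exact: is_derive1_sqrt.
have H := is_derive1_comp dS dQ; apply: (is_derive_eq H).
rewrite /enorm edot_line -/(Q t) -mulr_natl.
have S0 : Num.sqrt (Q t) != 0 by rewrite gt_eqF// sqrtr_gt0.
by rewrite /GRing.scale /=; field.
Qed.

Lemma continuous_line w v : continuous (fun s : R => w + s *: v).
Proof.
move=> s; apply: cvgD; first exact: cvg_cst.
by apply: cvgZ; [exact: cvg_id|exact: cvg_cst].
Qed.

Lemma edot_delta x i : edot x (delta_mx ord0 i) = x ord0 i.
Proof.
rewrite /edot (bigD1 i)//= big1 => [|j ji]; rewrite mxE eqxx/= ?eqxx ?mulr1 ?addr0//.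
by rewrite (negbTE ji) mulr0.
Qed.

Lemma edotN x v : edot x (- v) = - edot x v.
Proof. by rewrite /edot -sumrN; apply: eq_bigr => i _; rewrite mxE mulrN. Qed.

(** If x = xi both sides agree. Otherwise the norm is differentiable at x - xi, and the derivative
    of the phase vanishes along each coordinate line through xi, so that grad p xi = alpha (x - xi)
    / |x - xi|. *)
Lemma phase_critical (U : set V) (alpha : R) (p : V -> R) x xi : open U -> U xi ->
  (forall eta, U eta -> differentiable p eta) -> 0 < alpha ->
  (forall eta, U eta -> phase alpha p x xi <= phase alpha p x eta) ->
  x = xi + (enorm (x - xi) / alpha) *: grad p xi.
Proof.
move=> oU Uxi dp a0 min.
have [xxi|] := eqVneq (enorm (x - xi)) 0.
  rewrite xxi mul0r scale0r addr0; apply/eqP; rewrite -subr_eq0; apply/eqP/rowP => i.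
  by apply/eqP; rewrite [X in _ == X]mxE -normr_le0 -xxi coord_le_enorm.
move=> xxi; have e0 : 0 < enorm (x - xi) by rewrite lt_neqAle eq_sym xxi enorm_ge0.
suff H i : grad p xi ord0 i = alpha * ((x - xi) ord0 i / enorm (x - xi)).
  apply/rowP => i; rewrite mxE [X in _ + X]mxE H !mxE.
  by field; rewrite xxi gt_eqF.
pose v : V := delta_mx ord0 i.
have E (s : R) : x - (xi + s *: v) = (x - xi) + s *: (- v) by rewrite scalerN opprD addrA.
pose f (s : R) := p (xi + s *: v) + alpha * enorm ((x - xi) + s *: (- v)).
have : \forall s \near nbhs (0 : R), U (xi + s *: v) /\ 0 < enorm ((x - xi) + s *: (- v)).
  apply: filterI.
    have := @continuous_line xi v 0 U; apply.
    by rewrite /= scale0r addr0; exact: open_nbhs_nbhs.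
  have c : continuous (fun s : R => enorm ((x - xi) + s *: (- v))).
    move=> s; apply: (@continuous_comp _ _ _ (fun s : R => (x - xi) + s *: (- v)) (@enorm R n)).
      exact: continuous_line.
    exact: enorm_continuous.
  have := c 0 [set r | 0 < r]; apply.
  by rewrite scale0r addr0; apply: open_nbhs_nbhs; split=> //; exact: open_gt.
move=> /nbhs_ballP[/= e e'0 he].
have near s : s \in `]- e, e[ -> U (xi + s *: v) /\ 0 < enorm ((x - xi) + s *: (- v)).
  move=> se; apply: he; rewrite /ball /= sub0r normrN.
  by move: se; rewrite in_itv /= -ltr_norml.
have df s : s \in `]- e, e[ -> is_derive s 1 f (edot (grad p (xi + s *: v)) v +
    alpha * (edot ((x - xi) + s *: (- v)) (- v) / enorm ((x - xi) + s *: (- v)))).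
  move=> /near[Us es]; have H1 := is_derive_line (dp _ Us).
  have H2 := is_derive_enorm_line es.
  exact: is_deriveD.
have z : (0 : R) \in `]- e, e[ by rewrite in_itv /= oppr_lt0 e'0.
have D0 : is_derive (0 : R) 1 f 0.
  apply: (@derive1_at_min _ f (- e) e) => //.
  - by rewrite (@le_trans _ _ 0)// ?oppr_le0 ltW.
  - by move=> s /df [].
  move=> s /near[Us _]; have := min _ Us.
  by rewrite /phase E /f !scale0r !addr0.
have [_ D1] := df 0 z; have [_ D2] := D0; move: D1; rewrite D2 !scale0r !addr0.
rewrite edotN !edot_delta mulNr mulrN => /esym/eqP.
by rewrite subr_eq0 => /eqP.
Qed.

End critical.

(** Both inequalities say p + q < p q. *)
Lemma conjugate_lt (R : realType) (p q : R) : 1 < p -> 1 < q ->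
  conjugate q < p -> conjugate p < q.
Proof.
rewrite /conjugate => p1 q1; rewrite ltr_pdivrMr ?subr_gt0// ltr_pdivrMr ?subr_gt0//.
by rewrite !mulrBr !mulr1 !ltrBrDl addrC [q * p]mulrC.
Qed.

Lemma contact_rays (R : realType) (n : nat) (omega0 omega1 K : set 'rV[R]_n)
    (alpha M : R) (p : 'rV[R]_n -> R) : 0 < alpha ->
  (forall x, omega1° x -> differentiable p x) -> K `<=` omega1° ->
  (forall z, (omega0 `*` omega1) z -> `|enorm (z.1 - z.2)| <= M) ->
  contact omega0 omega1 alpha p K 0 `<=` rays (grad p) (M / alpha) K.
Proof.
move=> a0 dp Ko hM x [ox [xi Kxi min]]; have oxi := Ko _ Kxi.
exists xi => //; exists (enorm (x - xi) / alpha).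
  rewrite divr_ge0 ?enorm_ge0 ?(ltW a0)//= ler_pM2r ?invr_gt0//.
  by apply: (le_trans (ler_norm _)); apply: (hM (x, xi)); split=> //; exact: interior_subset oxi.
apply: (phase_critical (@open_interior _ omega1) oxi dp a0) => eta oeta.
by rewrite -[leRHS]addr0; apply: min; exact: interior_subset oeta.
Qed.

Lemma phase_integral (R : realType) (n : nat) (omega0 omega1 : set 'rV[R]_n)
    (alpha : R) (p : 'rV[R]_n -> R)
    (pi : {finite_measure set ('rV[R]_n * 'rV[R]_n)%type -> \bar R}) :
  compact omega0 -> compact omega1 -> continuous p ->
  \int[pi]_(z in omega0 `*` omega1) phase alpha p z.1 z.2 =
  \int[pi]_(z in omega0 `*` omega1) p z.2 + alpha * plan_cost omega0 omega1 pi.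
Proof.
move=> c0 c1 cp; have mZ : measurable (omega0 `*` omega1).
  by apply: measurableX; exact: compact_rV_measurable.
have [M hM] := cost_bounded c0 c1; have [M' [_ hM']] := continuous_bounded_on cp c1.
have ic : pi.-integrable (omega0 `*` omega1) (EFin \o (fun z => enorm (z.1 - z.2))).
  apply: (integrable_bounded pi mZ _ hM); apply: measurable_funTS.
  by apply: measurable_enorm_sub; [exact: measurable_fst|exact: measurable_snd].
rewrite /plan_cost -RintegralZl// -RintegralD//.
  apply: (@integrable_bounded _ _ _ pi _ _ M' mZ) => [|z [_ /hM']//].
  apply: measurable_funTS.
  exact: measurableT_comp (continuous_measurable_rV_real cp) measurable_snd.
apply: (@integrable_bounded _ _ _ pi _ _ (`|alpha| * M) mZ) => [|z /hM h].
  apply: measurable_funTS; apply: measurable_funM => //.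
  by apply: measurable_enorm_sub; [exact: measurable_fst|exact: measurable_snd].
by rewrite normrM ler_wpM2l.
Qed.

Theorem theorem8p3 (R : realType) (d : nat) (hd : d = 2%N \/ d = 3%N)
    (Omega omega0 omega1 : set 'rV[R]_d)
    (hOmega : bounded_lipschitz_domain Omega)
    (homega0 : compact omega0) (homega0_ne : omega0 !=set0)
    (homega1 : compact omega1) (homega1_ne : omega1 !=set0)
    (homega1_sub : omega1 `<=` closure Omega)
    (u0 : {finite_measure set 'rV[R]_d -> \bar R})
    (hu0 : concentrated_on omega0 u0)
    (alpha : R) (halpha : 0 < alpha)
    (pOmega : R) (hpOmega : d%:R < pOmega)
    (hpoisson : forall r : R, conjugate pOmega < r -> r < pOmega ->
       poisson_well_posed Omega r)
    (q : R) (hq : 1 < q)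
    (hq_gt : d%:R < conjugate q) (hq_lt : conjugate q < pOmega)
    (hq_3 : d = 3%N -> conjugate q < 6)
    (J : ('rV[R]_d -> R) -> R) (hJ : continuous_on_W1p0 Omega q J)
    (dJ : ('rV[R]_d -> R) -> ('rV[R]_d -> R) -> R)
    (hdJ : gateaux_derivative_on_W1p0 Omega q J dJ)
    (ubar : {charge set 'rV[R]_d -> \bar R})
    (hubar : local_minimizer omega1
       (objective Omega omega1 omega0 (fun x xi => enorm (x - xi)) u0 q J alpha)
       ubar)
    (p : 'rV[R]_d -> R) (hp : adjoint_state Omega omega1 q dJ ubar p)
    (hp_diff : forall x, omega1° x -> differentiable p x)
    (hp_C1 : {within omega1°, continuous (grad p)})
    (L : R) (hL : 0 < L)
    (hp_lip : forall x y, omega1° x -> omega1° y ->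
       enorm (grad p x - grad p y) <= L * enorm (x - y))
    (hu0_ac : u0 `<< lebesgue_rV R d)
    (hu0_density : exists (U0 : 'rV[R]_d -> R) (M : R),
       [/\ measurable_fun omega0 U0,
           {ae lebesgue_rV R d, forall x, omega0 x -> `|U0 x| <= M}
         & forall A, measurable A ->
             u0 A = (\int[lebesgue_rV R d]_(x in A `&` omega0) (U0 x)%:E)%E]) :
  forall A, measurable A -> A `<=` omega1° ->
    hausdorff (d%:R - 1) A = 0%E -> ubar A = 0%E.
Proof.
have d1 : (1 < d)%N by case: hd => ->.
have d0 : (0 < d)%N := ltnW d1.
have d2 : 2 <= d%:R :> R by rewrite ler_nat.
have [oOmega _ _ bOmega _] := hOmega.
have pO1 : 1 < pOmega by apply: lt_trans hpOmega; rewrite ltr1n.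
(* As q' > d >= 2, q lies below 2 and so below [pOmega]; the lower bound on q follows by conjugating
   q' < [pOmega]. *)
have q2 : q < 2.
  have : 2 < conjugate q by exact: le_lt_trans hq_gt.
  by rewrite /conjugate ltr_pdivlMr ?subr_gt0// mulrBr; lra.
have wp : poisson_well_posed Omega q.
  apply: hpoisson; first exact: conjugate_lt.
  by apply: (lt_trans q2); exact: le_lt_trans hpOmega.
have cp : continuous p by have [[]] := hp.
have near_optimal (eps : R) : 0 < eps ->
    exists2 pi : {finite_measure set ('rV[R]_d * 'rV[R]_d)%type -> \bar R},
    transport_plan omega0 omega1 u0 ubar pi &
    forall (m' : {finite_measure set 'rV[R]_d -> \bar R})
        (pi' : {finite_measure set ('rV[R]_d * 'rV[R]_d)%type -> \bar R}),
      transport_plan omega0 omega1 u0 m' pi' ->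
      \int[pi]_(z in omega0 `*` omega1) phase alpha p z.1 z.2 <=
      \int[pi']_(z in omega0 `*` omega1) phase alpha p z.1 z.2 + eps.
  (* The cost enters the phase with the factor [alpha], hence a plan optimal up to eps / alpha. *)
  move=> e0; have [pi plan_pi le_pi] :=
    near_optimal_plan homega0 homega1 halpha hubar (divr_gt0 e0 halpha).
  exists pi => // m' pi' plan_pi'; rewrite !phase_integral//.
  have vi := variational_inequality oOmega bOmega d0 homega0 homega1 hq hq_gt halpha wp hJ hdJ
    hubar hp plan_pi plan_pi'.
  apply: (@le_trans _ _ (\int[pi]_(z in omega0 `*` omega1) p z.2 +
      alpha * optimal_cost omega0 omega1 u0 ubar + eps)); last by rewrite lerD2r.
  rewrite -addrA lerD2l -[eps](divfK (lt0r_neq0 halpha)) [_ * alpha]mulrC -mulrDr.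
  by rewrite ler_wpM2l// ltW.
move=> A mA Ao hA; have Ao1 : A `<=` omega1 := subset_trans Ao (@interior_subset _ _).
have [pi plan_pi _] := near_optimal 1 ltr01.
(* As a second marginal, [ubar] agrees on Borel sets with a finite measure, to which inner
   regularity applies. *)
pose m := image_finite_measure pi (@measurable_snd _ _ 'rV[R]_d 'rV[R]_d).
have mE B : measurable B -> m B = ubar B by have [_ _] := plan_pi; apply.
have : m A = 0%E; last by rewrite mE.
apply: measure_closed_null => // F cF FA.
have Fo := subset_trans FA Ao; have F1 := subset_trans FA Ao1.
have kF : compact F by exact: subclosed_compact cF homega1 F1.
apply/eqP; rewrite eq_le measure_ge0 andbT mE; last exact: compact_rV_measurable.
apply: (contact_null homega0 homega1 homega1_ne halpha cp hu0 near_optimal) => //.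
set N := contact _ _ _ _ _ _.
have mN : measurable N by apply: compact_rV_measurable; exact: contact_compact.
suff lN : lebesgue_rV R d N = 0%E.
  apply: (hu0_ac N _ N) => // B mB BN; apply/eqP; rewrite eq_le measure_ge0 andbT -lN.
  by apply: le_measure; rewrite ?inE.
have [M hM] := cost_bounded homega0 homega1.
have [D hD] := cost_bounded homega1 homega1.
have [F0|nF] := pselect (F !=set0); last first.
  have -> : N = set0 by apply/seteqP; split=> // x [_ [xi Fxi _]]; case: nF; exists xi.
  exact: measure0.
have [xi0 Fxi0] := F0.
have D0 : 0 <= D by apply: le_trans (hD (xi0, xi0) _) => //; split; exact: F1.
have [N0|nN] := pselect (N !=set0); last first.
  have -> : N = set0 by apply/seteqP; split=> // x Nx; case: nN; exists x.
  exact: measure0.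
have M0 : 0 <= M.
  have [x [ox [xi Fxi _]]] := N0.
  by apply: le_trans (hM (x, xi) _) => //; split=> //; exact: F1.
(* The rays have parameter at most M / alpha, [M] bounding the distances from [omega0] to [omega1].
   The gradient is bounded on [F] by its value at [xi0] plus [L] times the bound [D] on distances
   within [omega1]. *)
apply: (hausdorff_rays_null (K := F) (g := grad p) (L := L) (M := M / alpha)
    (G := L * D + `|grad p xi0|)) => //.
- exact: ltW.
- by rewrite addr_ge0// mulr_ge0// ltW.
- by rewrite divr_ge0// ltW.
- by move=> x y /Fo ox /Fo oy; exact: hp_lip.
- move=> x Fx; rewrite -[grad p x](subrK (grad p xi0)).
  apply: (le_trans (ler_normD _ _)); rewrite lerD2r.
  apply: (le_trans (norm_le_enorm _)); apply: (le_trans (hp_lip _ _ (Fo _ Fx) (Fo _ Fxi0))).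
  rewrite ler_wpM2l ?(ltW hL)//; apply: (le_trans (ler_norm _)).
  by apply: (hD (x, xi0)); split; exact: F1.
- by rewrite -hA; exact: le_hausdorff.
- exact: contact_rays.
Qed.
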